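(* For a real Banach lattice $X$, the following three properties are equivalent: the Solid Krein–Milman Property, the Krein–Milman Property, and the Radon–Nikodým Property.
   Context: $X$ has the Solid Krein–Milman Property (SKMP) if every norm closed, norm bounded, solid, convex subset $A$ of $X$ equals the norm closure of the solid convex hull of its order extreme points. Here a set $C$ is solid if $x\in X$, $z\in C$, $|x|\le|z|$ imply $x\in C$; the solid convex hull of $S$ is the smallest convex solid set containing $S$; and $a\in A$ is an order extreme point of $A$ if for all $x_0,x_1\in A$ and $t\in(0,1)$, $a\le(1-t)x_0+tx_1$ implies $x_0=a=x_1$. The Krein–Milman Property (every closed bounded convex set is the closed convex hull of its extreme points) and the Radon–Nikodým Property have their standard Banach-space meanings. *)

(* Defs.v *)
From HB Require Import structures.
From mathcomp Require Import all_boot all_order all_algebra.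
From mathcomp Require Import all_classical all_reals all_analysis.
Set Implicit Arguments. Unset Strict Implicit. Unset Printing Implicit Defensive.
Import Order.TTheory GRing.Theory Num.Theory.
Import numFieldNormedType.Exports.
Local Open Scope classical_set_scope.
Local Open Scope ring_scope.

Record vector_lattice (R : realType) (X : lmodType R) := VectorLattice {
  vle : X -> X -> Prop;
  vsup : X -> X -> X;
  vle_refl : forall x, vle x x;
  vle_anti : forall x y, vle x y -> vle y x -> x = y;
  vle_trans : forall x y z, vle x y -> vle y z -> vle x z;
  vle_add : forall x y z, vle x y -> vle (x + z) (y + z);
  vle_scale : forall (a : R) x y, 0 <= a -> vle x y -> vle (a *: x) (a *: y);
  vsup_ubl : forall x y, vle x (vsup x y);
  vsup_ubr : forall x y, vle y (vsup x y);
  vsup_least : forall x y z, vle x z -> vle y z -> vle (vsup x y) z }.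

Definition vabs (R : realType) (X : lmodType R) (L : vector_lattice X) (x : X) : X :=
  vsup L x (- x).

(* Lattice norm: |x| <= |y| implies ||x|| <= ||y||.  Together with completeness
   of X this makes (X, L) a real Banach lattice. *)
Definition lattice_norm (R : realType) (X : normedModType R)
  (L : vector_lattice X) : Prop :=
  forall x y : X, vle L (vabs L x) (vabs L y) -> `|x| <= `|y|.

Definition convex_set (R : realType) (X : normedModType R) (A : set X) : Prop :=
  forall x y, A x -> A y -> forall t : R, 0 <= t <= 1 ->
    A ((1 - t) *: x + t *: y).

Definition norm_bounded (R : realType) (X : normedModType R) (A : set X) : Prop :=
  exists M : R, forall x, A x -> `|x| <= M.

Definition conv_hull (R : realType) (X : normedModType R) (S : set X) : set X :=
  [set x | forall C : set X, convex_set C -> S `<=` C -> C x].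

Definition extreme_points (R : realType) (X : normedModType R) (A : set X) : set X :=
  [set a | A a /\ forall x0 x1, A x0 -> A x1 -> forall t : R, 0 < t < 1 ->
     a = (1 - t) *: x0 + t *: x1 -> x0 = a /\ x1 = a].

Definition KMP (R : realType) (X : normedModType R) : Prop :=
  forall A : set X, closed A -> norm_bounded A -> convex_set A ->
    A = closure (conv_hull (extreme_points A)).

Definition solid (R : realType) (X : normedModType R) (L : vector_lattice X)
  (C : set X) : Prop :=
  forall x z, C z -> vle L (vabs L x) (vabs L z) -> C x.

Definition solid_conv_hull (R : realType) (X : normedModType R)
  (L : vector_lattice X) (S : set X) : set X :=
  [set x | forall C : set X, convex_set C -> solid L C -> S `<=` C -> C x].

Definition order_extreme_points (R : realType) (X : normedModType R)
  (L : vector_lattice X) (A : set X) : set X :=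
  [set a | A a /\ forall x0 x1, A x0 -> A x1 -> forall t : R, 0 < t < 1 ->
     vle L a ((1 - t) *: x0 + t *: x1) -> x0 = a /\ x1 = a].

Definition SKMP (R : realType) (X : normedModType R) (L : vector_lattice X) : Prop :=
  forall A : set X, closed A -> norm_bounded A -> solid L A -> convex_set A ->
    A = closure (solid_conv_hull L (order_extreme_points L A)).

Section RNP.
Context (R : realType) (X : normedModType R).
Context (d : measure_display) (T : measurableType d).

Definition vector_measure (F : set T -> X) : Prop :=
  forall A : nat -> set T, (forall n, measurable (A n)) -> trivIset setT A ->
    (fun n => \sum_(k < n) F (A k)) @ \oo --> F (\bigcup_n A n).

Definition bounded_variation (F : set T -> X) : Prop :=
  exists M : R, forall (n : nat) (A : nat -> set T),
    (forall k, measurable (A k)) -> trivIset setT A ->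
    \sum_(k < n) `|F (A k)| <= M.

Definition vabs_continuous (F : set T -> X) (mu : set T -> \bar R) : Prop :=
  forall E, measurable E -> mu E = 0%E -> F E = 0.

Definition simple_repr (s : seq (X * set T)) : Prop :=
  forall p, p \in s -> measurable p.2.

Definition simple_eval (s : seq (X * set T)) (t : T) : X :=
  \sum_(p <- s) ((\1_(p.2) t : R) *: p.1).

Definition simple_int (mu : set T -> \bar R) (s : seq (X * set T)) (E : set T) : X :=
  \sum_(p <- s) (fine (mu (E `&` p.2)) *: p.1).

(* g is Bochner integrable w.r.t. the finite measure mu, and F(E) is the
   Bochner integral of g over E for every measurable E *)
Definition bochner_density (mu : {measure set T -> \bar R}) (F : set T -> X) (g : T -> X) : Prop :=
  exists s : nat -> seq (X * set T),
    [/\ forall n, simple_repr (s n),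
        {ae mu, forall t, (fun n => simple_eval (s n) t) @ \oo --> g t},
        forall n, measurable_fun setT (fun t => `|simple_eval (s n) t - g t|),
        (fun n => (\int[mu]_t ((`|simple_eval (s n) t - g t|)%:E))%E) @ \oo --> 0%E
      & forall E, measurable E -> (fun n => simple_int mu (s n) E) @ \oo --> F E].

End RNP.

Definition RNP (R : realType) (X : normedModType R) : Prop :=
  forall (d : measure_display) (T : measurableType d)
    (mu : {finite_measure set T -> \bar R}) (F : set T -> X),
    vector_measure F -> bounded_variation F -> vabs_continuous F mu ->
    exists g : T -> X, bochner_density mu F g.

(* Main.v *)
(* Call STAR the property that every nonempty closed bounded solid convex subset
   of X has an extreme point.  KMP and SKMP both imply STAR: an order extreme
   point is extreme, and the hull of an empty set of extreme points is empty.

   STAR implies RNP.  STAR makes X a KB-space (norm bounded increasing sequences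
   converge), so vector measures have positive parts and, on an order interval,
   the norm is dominated up to e by a single positive functional.  A positive
   measure F <= nu splits into an increasing limit of measures bounded by
   multiples k * mes * u of the scalar measure, which are L^1-limits of step
   functions, and a part F' disjoint from all these multiples.  If F' <> 0, a
   sequence of partitions adapted to F' carries vectors v_w, indexed by words,
   decreasing along branches and nearly disjoint from u at large depth.  The
   elements whose modulus disintegrates along such a tree form a closed bounded
   solid convex set; an extreme point is carried by a single infinite branch, so
   it is disjoint from its own majorant u and vanishes, contradicting STAR.

   RNP implies KMP and SKMP.  Let K be the set (resp. its positive part), ordered
   by equality (resp. by the lattice order), and suppose that x lies off the
   closed hull D.  Starting from D one separates: if every point off D could be
   approximated by elements dominated by averages of points in D or at distance
   at least e, iterating would produce a bounded dyadic (sub)martingale that does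
   not converge in L^1, contrary to RNP.  Repeating with smaller e gives nested
   slices shrinking to an (order) extreme point off D. *)

(* No weak compactness and no conditional expectation on abstract sigma-algebras is used: measures
   enter through their values on finite partitions, and L^1 distance through total variation. Two
   estimates replace compactness. First, in an interval [[0, a]] the midpoint convexity defects of
   the maps [x -> (x - k h)^+] control [|b - c|] up to the mesh [h] ([grid_gap]). So whatever nearly
   optimizes these countably many maps is Cauchy. This gives the closedness of the tree sets, where
   the disintegrations of approximants need not converge by themselves, and the approximation of
   order bounded measures by step functions. Second, [norm_sum_interval] bounds a sum of norms by
   the norm of a sum, as if the norm were additive on an order interval. A tree carries a scalar
   measure besides the vector one: its mass bounds the set, and its values are the coefficients when
   an element is split between a branch and the rest. Both implications from RNP share one argument
   for an abstract domination relation. The one for SKMP also needs the KB property, obtained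
   through KMP and STAR. *)
Require Import Defs.
From HB Require Import structures.
From mathcomp Require Import all_boot all_order all_algebra.
From mathcomp Require Import all_classical all_reals all_analysis.
From mathcomp Require Import measurable_realfun ring lra zify.
Set Implicit Arguments. Unset Strict Implicit. Unset Printing Implicit Defensive.
Import Order.TTheory GRing.Theory Num.Theory.
Import numFieldNormedType.Exports.
(* [Defs.convex_set] must take precedence over the constant of the same name in MathComp-Analysis. *)
Import Defs.
Local Open Scope classical_set_scope.
Local Open Scope ring_scope.

(** * Vector lattices *)

(* Reflection of module expressions: two of them agree if all their scalar
   coefficients do, which [ring] or [field] decides. *)
Inductive vexp (R : Type) : Type :=
| VVar of nat | VZero | VAdd of vexp R & vexp R | VOpp of vexp R
| VScale of R & vexp R.
Arguments VVar {R}. Arguments VZero {R}.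

Section VExp.
Variables (R : realType) (X : lmodType R).

Fixpoint veval (env : seq X) (e : vexp R) : X :=
  match e with
  | VVar n => nth 0 env n
  | VZero => 0
  | VAdd a b => veval env a + veval env b
  | VOpp a => - veval env a
  | VScale r a => r *: veval env a
  end.

Fixpoint vcoef (e : vexp R) (i : nat) : R :=
  match e with
  | VVar n => if n == i then 1 else 0
  | VZero => 0
  | VAdd a b => vcoef a i + vcoef b i
  | VOpp a => - vcoef a i
  | VScale r a => r * vcoef a i
  end.

Fixpoint vcoefs_eq (e1 e2 : vexp R) (n : nat) : Prop :=
  if n is m.+1 then vcoef e1 m = vcoef e2 m /\ vcoefs_eq e1 e2 m else True.

Lemma vevalE env e : veval env e = \sum_(i < size env) vcoef e i *: nth 0 env i.
Proof.
elim: e => [n||a IHa b IHb|a IHa|r a IHa] /=.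
- have [lt_n|le_n] := ltnP n (size env).
    rewrite (bigD1 (Ordinal lt_n)) //= eqxx scale1r big1 ?addr0 // => i ne.
    by rewrite ifN ?scale0r // eq_sym; apply: contra ne => /eqP h; apply/eqP/val_inj.
  rewrite nth_default // big1 // => i _; rewrite ifN ?scale0r //.
  by rewrite neq_ltn (leq_trans (ltn_ord i) le_n) orbT.
- by rewrite big1 // => i _; rewrite scale0r.
- by rewrite IHa IHb -big_split; apply: eq_bigr => i _; rewrite scalerDl.
- by rewrite IHa -sumrN; apply: eq_bigr => i _; rewrite scaleNr.
- by rewrite IHa scaler_sumr; apply: eq_bigr => i _; rewrite scalerA.
Qed.

Lemma veval_eq env e1 e2 : vcoefs_eq e1 e2 (size env) -> veval env e1 = veval env e2.
Proof.
move=> h; rewrite !vevalE; apply: eq_bigr => i _; congr (_ *: _).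
elim: (size env) i h => [[]//|n IH] [i i_n] /= [h1 h2].
move: i_n; rewrite ltnS leq_eqVlt => /orP[/eqP->//|lt_i].
exact: (IH (Ordinal lt_i)).
Qed.
End VExp.

(** The inner [match goal] runs a tactic while a term is being computed; its failure selects the
    next branch, so the comparison returns a boolean term. Syntactic equality is tried before
    unification. *)
Ltac v_conv t a :=
  match goal with
  | _ => let _ := match goal with _ => constr_eq t a end in constr:(true)
  | _ => let _ := match goal with _ => unify t a end in constr:(true)
  | _ => constr:(false)
  end.
Ltac v_index t env :=
  lazymatch env with
  | cons ?a ?l => lazymatch v_conv t a with
      true => constr:(O) | false => let n := v_index t l in constr:(S n) end
  end.
Ltac v_mem t env :=
  lazymatch env with
  | nil => constr:(false)
  | cons ?a ?l => lazymatch v_conv t a with true => constr:(true) | false => v_mem t l end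
  end.
Ltac v_collect t env :=
  lazymatch t with
  | (?a + ?b)%R => let e := v_collect a env in v_collect b e
  | (- ?a)%R => v_collect a env
  | (?r *: ?a)%R => v_collect a env
  | (0)%R => env
  | _ => lazymatch v_mem t env with true => env | false => constr:(cons t env) end
  end.
Ltac v_reify R t env :=
  lazymatch t with
  | (?a + ?b)%R => let x := v_reify R a env in let y := v_reify R b env in constr:(@VAdd R x y)
  | (- ?a)%R => let x := v_reify R a env in constr:(@VOpp R x)
  | (?r *: ?a)%R => let x := v_reify R a env in constr:(@VScale R r x)
  | (0)%R => constr:(@VZero R)
  | _ => let n := v_index t env in constr:(@VVar R n)
  end.
Ltac vlin_with K X :=

  lazymatch goal with
  | |- ?a = ?b =>
    let env0 := v_collect a (@nil X) in
    let env := v_collect b env0 in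
    let x := v_reify (Real.sort K) a env in
    let y := v_reify (Real.sort K) b env in
    refine (@veval_eq K _ env x y _); cbn [vcoefs_eq vcoef size eqn eq_op nat_of_bool];
    repeat split; rewrite /= ?mulr1 ?mulr0 ?addr0 ?add0r; try (ring || lra || field)
  end.

Section LatticeAlgebra.
Variables (R : realType) (X : lmodType R) (L : vector_lattice X).
Local Notation "x ⊑ y" := (vle L x y) (at level 70).
Ltac vlin := vlin_with R X.

Definition vpos (x : X) : X := vsup L x 0.
(** The record provides suprema only. In this form the splitting [vinf_split] is immediate and facts
    about infima reduce to positive parts. *)
Definition vinf (x y : X) : X := x - vpos (x - y).

(** Most order arguments below end here: a sum of known inequalities is exhibited, and [vlin] checks
    that it has the same difference as the goal. *)
Lemma vle_by x y z t : z ⊑ t -> y - x = t - z -> x ⊑ y.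
Proof.
move=> h e; have := vle_add (x - z) h.
have -> : z + (x - z) = x by vlin.
by have -> : t + (x - z) = y by rewrite -[y](subrK x) e; vlin.
Qed.

Lemma vsub_ge0 x y : x ⊑ y -> 0 ⊑ y - x.
Proof. by move=> h; apply: (vle_by h); vlin. Qed.

Lemma vge0_sub x y : 0 ⊑ y - x -> x ⊑ y.
Proof. by move=> h; apply: (vle_by h); vlin. Qed.

Lemma vleD x y z t : x ⊑ y -> z ⊑ t -> x + z ⊑ y + t.
Proof.
move=> h1 h2; apply: (vle_trans (vle_add z h1)); apply: (vle_by h2); vlin.
Qed.

Lemma vleN x y : x ⊑ y -> - y ⊑ - x.
Proof. by move=> h; apply: (vle_by h); vlin. Qed.

Lemma vlexx x : x ⊑ x. Proof. exact: vle_refl. Qed.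

Lemma vaddr_ge0 x y : 0 ⊑ x -> 0 ⊑ y -> 0 ⊑ x + y.
Proof. by move=> h1 h2; rewrite -[0]addr0; apply: vleD. Qed.

Lemma vscale_ge0 (a : R) x : 0 <= a -> 0 ⊑ x -> 0 ⊑ a *: x.
Proof. by move=> ha hx; rewrite -(scaler0 _ a); apply: vle_scale. Qed.

Lemma vscale_le (a b : R) x : a <= b -> 0 ⊑ x -> a *: x ⊑ b *: x.
Proof.
move=> ab hx; apply: vge0_sub; rewrite -scalerBl; apply: vscale_ge0 => //; lra.
Qed.

Lemma vsum_ge0 (I : Type) (r : seq I) (P : pred I) (f : I -> X) :
  (forall i, P i -> 0 ⊑ f i) -> 0 ⊑ \sum_(i <- r | P i) f i.
Proof.
by move=> h; apply: (big_ind (fun x => 0 ⊑ x)) => //; [exact: vlexx|exact: vaddr_ge0].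
Qed.

Lemma vle_sum (I : Type) (r : seq I) (P : pred I) (f g : I -> X) :
  (forall i, P i -> f i ⊑ g i) -> \sum_(i <- r | P i) f i ⊑ \sum_(i <- r | P i) g i.
Proof.
by move=> h; apply: (big_ind2 (fun x y => x ⊑ y)) => //; [exact: vlexx|move=> *; exact: vleD].
Qed.

Lemma vle_sum_seq (I : eqType) (r : seq I) (P : pred I) (f g : I -> X) :
  (forall i, i \in r -> P i -> f i ⊑ g i) ->
  \sum_(i <- r | P i) f i ⊑ \sum_(i <- r | P i) g i.
Proof.
move=> h; rewrite big_seq_cond [X in _ ⊑ X]big_seq_cond.
by apply: vle_sum => i /andP[]; exact: h.
Qed.

Lemma vpos_ge0 x : 0 ⊑ vpos x. Proof. exact: vsup_ubr. Qed.
Lemma vpos_ge x : x ⊑ vpos x. Proof. exact: vsup_ubl. Qed.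
Lemma vpos_least x z : x ⊑ z -> 0 ⊑ z -> vpos x ⊑ z.
Proof. exact: vsup_least. Qed.

Lemma vpos_mono x y : x ⊑ y -> vpos x ⊑ vpos y.
Proof.
move=> h; apply: vpos_least (vpos_ge0 _); exact: vle_trans h (vpos_ge y).
Qed.

Lemma vpos_id x : 0 ⊑ x -> vpos x = x.
Proof. move=> h; apply: vle_anti (vpos_ge x); exact: vpos_least (vlexx x) h. Qed.

Lemma vpos_eq0 x : x ⊑ 0 -> vpos x = 0.
Proof. move=> h; apply: vle_anti (vpos_ge0 x); exact: vpos_least h (vlexx 0). Qed.

Lemma vpos_subD x y : vpos (x + y) ⊑ vpos x + vpos y.
Proof.
apply: vpos_least; first exact: vleD (vpos_ge x) (vpos_ge y).
exact: vaddr_ge0 (vpos_ge0 x) (vpos_ge0 y).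
Qed.

Lemma vpos_sum (I : Type) (r : seq I) (P : pred I) (f : I -> X) :
  vpos (\sum_(i <- r | P i) f i) ⊑ \sum_(i <- r | P i) vpos (f i).
Proof.
apply: (big_ind2 (fun x y => vpos x ⊑ y)) => [|x x' y y' h1 h2|i _].
- by rewrite vpos_id; exact: vlexx.
- exact: vle_trans (vpos_subD x y) (vleD h1 h2).
- exact: vlexx.
Qed.

Lemma vposN x : vpos (- x) = vpos x - x.
Proof.
apply: vle_anti.
  apply: vpos_least; first by apply: (vle_by (vpos_ge0 x)); vlin.
  by apply: (vle_by (vpos_ge x)); vlin.
apply: (@vle_by _ _ (vpos x) (vpos (- x) + x)); last by vlin.
apply: vpos_least; first by apply: (vle_by (vpos_ge0 (- x))); vlin.
by apply: (vle_by (vpos_ge (- x))); vlin.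
Qed.

Lemma vposZ (a : R) x : 0 <= a -> vpos (a *: x) = a *: vpos x.
Proof.
have lem b y : 0 <= b -> vpos (b *: y) ⊑ b *: vpos y.
  move=> hb; apply: vpos_least; first exact: vle_scale hb (vpos_ge y).
  exact: vscale_ge0 hb (vpos_ge0 y).
move=> ha; apply: vle_anti; first exact: lem.
have [->|an0] := eqVneq a 0; first by rewrite scale0r; exact: vpos_ge0.
have ai : 0 <= a^-1 by rewrite invr_ge0.
have := vle_scale ha (lem _ (a *: x) ai).
by rewrite !scalerA mulVf // mulfV // !scale1r.
Qed.

Lemma vinf_lbl x y : vinf x y ⊑ x.
Proof. by apply: (vle_by (vpos_ge0 (x - y))); rewrite /vinf; vlin. Qed.

Lemma vinf_lbr x y : vinf x y ⊑ y.
Proof. by apply: (vle_by (vpos_ge (x - y))); rewrite /vinf; vlin. Qed.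

Lemma vinf_greatest x y z : z ⊑ x -> z ⊑ y -> z ⊑ vinf x y.
Proof.
move=> h1 h2; apply: (@vle_by _ _ (vpos (x - y)) (x - z)); last by rewrite /vinf; vlin.
apply: vpos_least; last exact: vsub_ge0.
by apply: (vle_by h2); vlin.
Qed.

Lemma vinf_ge0 x y : 0 ⊑ x -> 0 ⊑ y -> 0 ⊑ vinf x y.
Proof. exact: vinf_greatest. Qed.

Lemma vinf_mono x y z t : x ⊑ z -> y ⊑ t -> vinf x y ⊑ vinf z t.
Proof.
move=> h1 h2; apply: vinf_greatest.
  exact: vle_trans (vinf_lbl x y) h1.
exact: vle_trans (vinf_lbr x y) h2.
Qed.

Lemma vinf_l x y : x ⊑ y -> vinf x y = x.
Proof.
move=> h; apply: vle_anti (vinf_lbl x y) _; exact: vinf_greatest (vlexx x) h.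
Qed.

Lemma vinfZ (a : R) x y : 0 <= a -> vinf (a *: x) (a *: y) = a *: vinf x y.
Proof. by move=> ha; rewrite /vinf -scalerBr vposZ // scalerBr. Qed.

Lemma vinf_split x y : vinf x y + vpos (x - y) = x.
Proof. by rewrite /vinf subrK. Qed.

Lemma vinf_superD a b c d : vinf a b + vinf c d ⊑ vinf (a + c) (b + d).
Proof.
apply: vinf_greatest; apply: vleD; (exact: vinf_lbl || exact: vinf_lbr).
Qed.

Lemma vinf_subD z x y : 0 ⊑ z -> 0 ⊑ x -> 0 ⊑ y ->
  vinf z (x + y) ⊑ vinf z x + vinf z y.
Proof.
move=> hz hx hy; set w := vinf z (x + y).
have wz : w ⊑ z by exact: vinf_lbl.
have wxy : w ⊑ x + y by exact: vinf_lbr.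
apply: (@vle_by _ _ (w - vinf z x) (vinf z y)); last by vlin.
apply: vinf_greatest.
  by apply: (vle_by (vleD wz (vinf_ge0 hz hx))); vlin.
apply: (@vle_by _ _ (w - y) (vinf z x)); last by vlin.
apply: vinf_greatest.
  by apply: (vle_by (vleD wz hy)); vlin.
by apply: (vle_by wxy); vlin.
Qed.

Lemma vabsE x : vabs L x = vpos x + vpos (- x).
Proof.
apply: vle_anti.
  apply: vsup_least.
    by apply: (vle_by (vleD (vpos_ge x) (vpos_ge0 (- x)))); vlin.
  by apply: (vle_by (vleD (vpos_ge0 x) (vpos_ge (- x)))); vlin.
rewrite vposN; apply: (@vle_by _ _ (2 *: vpos x) (vabs L x + x)); last by vlin.
rewrite -vposZ //; apply: vpos_least.
  by apply: (vle_by (vsup_ubl L x (- x))); rewrite /vabs; vlin.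
by apply: (vle_by (vsup_ubr L x (- x))); rewrite /vabs; vlin.
Qed.

Lemma vabs_ge0 x : 0 ⊑ vabs L x.
Proof. by rewrite vabsE; apply: vaddr_ge0; exact: vpos_ge0. Qed.

Lemma vabs_ge x : x ⊑ vabs L x. Proof. exact: vsup_ubl. Qed.
Lemma vabs_geN x : - x ⊑ vabs L x. Proof. exact: vsup_ubr. Qed.
Lemma vabs_least x z : x ⊑ z -> - x ⊑ z -> vabs L x ⊑ z.
Proof. exact: vsup_least. Qed.

Lemma vabs_id x : 0 ⊑ x -> vabs L x = x.
Proof. by move=> h; rewrite vabsE vposN vpos_id // subrr addr0. Qed.

Lemma vabsN x : vabs L (- x) = vabs L x.
Proof. by rewrite !vabsE opprK addrC. Qed.

Lemma vabs_subD x y : vabs L (x + y) ⊑ vabs L x + vabs L y.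
Proof.
apply: vabs_least; first exact: vleD (vabs_ge x) (vabs_ge y).
by apply: (vle_by (vleD (vabs_geN x) (vabs_geN y))); vlin.
Qed.

Lemma vabsZ (a : R) x : vabs L (a *: x) = `|a| *: vabs L x.
Proof.
have [a0|a0] := leP 0 a.
  by rewrite (ger0_norm a0) !vabsE -scalerN !vposZ // scalerDr.
have na : 0 <= - a by lra.
have -> : a *: x = - a *: - x by vlin.
by rewrite (ltr0_norm a0) !vabsE -scalerN !vposZ // opprK -scalerDr addrC.
Qed.

Lemma vabs_vabs x : vabs L (vabs L x) = vabs L x.
Proof. exact: vabs_id (vabs_ge0 x). Qed.

Lemma vpos_le_vabs x : vpos x ⊑ vabs L x.
Proof. exact: vpos_least (vabs_ge x) (vabs_ge0 x). Qed.

Lemma vpos_abs_lip x y : vabs L (vpos x - vpos y) ⊑ vabs L (x - y).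
Proof.
have lem a b : vpos a - vpos b ⊑ vabs L (a - b).
  have h := vpos_subD (a - b) b; rewrite subrK in h.
  by apply: (vle_by (vleD h (vpos_le_vabs (a - b)))); vlin.
apply: vabs_least; first exact: lem.
have := lem y x; rewrite -(vabsN (y - x)) opprB.
by have -> : - (vpos x - vpos y) = vpos y - vpos x by vlin.
Qed.

Lemma vsupE x y : vsup L x y = y + vpos (x - y).
Proof.
apply: vle_anti.
  apply: vsup_least.
    by apply: (vle_by (vpos_ge (x - y))); vlin.
  by apply: (vle_by (vpos_ge0 (x - y))); vlin.
apply: (@vle_by _ _ (vpos (x - y)) (vsup L x y - y)); last by vlin.
apply: vpos_least.
  by apply: (vle_by (vsup_ubl L x y)); vlin.
by apply: (vle_by (vsup_ubr L x y)); vlin.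
Qed.

Lemma vsup_vinf x y : vsup L x y + vinf x y = x + y.
Proof. by rewrite vsupE /vinf; vlin. Qed.

Lemma vsup_le_add x y : 0 ⊑ x -> 0 ⊑ y -> vsup L x y ⊑ x + y.
Proof.
move=> hx hy; apply: vsup_least.
  by apply: (vle_by hy); vlin.
by apply: (vle_by hx); vlin.
Qed.

Lemma vposE x : vpos x = 2^-1 *: (x + vabs L x).
Proof. by rewrite vabsE vposN; vlin. Qed.

(** Greedy form of the Riesz decomposition: each [x i] takes its infimum with what is left of [z],
    and the uncovered part is passed on. *)
Fixpoint riesz_rem (z : X) (x : nat -> X) (i : nat) : X :=
  if i is j.+1 then vpos (riesz_rem z x j - x j) else z.
Definition riesz_part (z : X) (x : nat -> X) (i : nat) : X :=
  vinf (riesz_rem z x i) (x i).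

Lemma riesz_rem_ge0 z x i : 0 ⊑ z -> 0 ⊑ riesz_rem z x i.
Proof. by case: i => //= i _; exact: vpos_ge0. Qed.

Lemma riesz_part_ge0 z x i : 0 ⊑ z -> 0 ⊑ x i -> 0 ⊑ riesz_part z x i.
Proof. by move=> h1 h2; apply: vinf_ge0 => //; exact: riesz_rem_ge0. Qed.

Lemma riesz_part_le z x i : riesz_part z x i ⊑ x i.
Proof. exact: vinf_lbr. Qed.

Lemma riesz_split z x m :
  z = \sum_(i < m) riesz_part z x i + riesz_rem z x m.
Proof.
elim: m => [|m IH]; first by rewrite big_ord0 add0r.
by rewrite big_ord_recr /= -addrA vinf_split.
Qed.

(** After [i] steps the remainder lies below the sum of the terms not yet used, so nothing remains
    at the end. *)
Lemma riesz_sum z x m : (forall i, (i < m)%N -> 0 ⊑ x i) ->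
  z ⊑ \sum_(i < m) x i -> 0 ⊑ z -> \sum_(i < m) riesz_part z x i = z.
Proof.
move=> hx hz z0; have := riesz_split z x m.
suff -> : riesz_rem z x m = 0 by rewrite addr0.
suff h i : (i <= m)%N -> riesz_rem z x i ⊑ \sum_(i <= j < m) x j.
  have := h m (leqnn m); rewrite big_geq // => h0.
  exact: vle_anti h0 (riesz_rem_ge0 _ _ z0).
elim: i => [|i IH] im; first by rewrite big_mkord.
change (riesz_rem z x i.+1) with (vpos (riesz_rem z x i - x i)).
apply: vpos_least; last first.
  rewrite big_seq; apply: vsum_ge0 => j; rewrite mem_index_iota => /andP[_]; exact: hx.
have := IH (ltnW im); rewrite (big_ltn im) => /= h.
by apply: (vle_by h); vlin.
Qed.

(** [e] is its own infimum with [p + q], which is at most the sum of its infima with [p] and with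
    [q]; the latter is below the infimum of [r] and [q], which is 0. *)
Lemma vle_of_disjoint e p q r :
  0 ⊑ e -> 0 ⊑ p -> 0 ⊑ q -> e ⊑ p + q -> e ⊑ r -> vinf r q = 0 -> e ⊑ p.
Proof.
move=> e0 p0 q0 epq er rq.
have h := vinf_subD e0 p0 q0; rewrite (vinf_l epq) in h.
have h2 : vinf e q ⊑ 0 by rewrite -rq; apply: vinf_mono => //; exact: vlexx.
apply: (vle_trans h); rewrite -[X in _ ⊑ X]addr0; apply: vleD => //; exact: vinf_lbr.
Qed.

Lemma vinf_pos_neg x : vinf (vpos x) (vpos (- x)) = 0.
Proof. by rewrite /vinf vposN (_ : vpos x - (vpos x - x) = x) ?subrr //; vlin. Qed.

(* Disjointness propagates [vpos e <= vpos (m - k h)] from k to k + 1, and at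
   k = n + 1 the right-hand side vanishes. *)
Lemma grid_dist (e m h : X) (n : nat) :
  0 ⊑ m -> m ⊑ n%:R *: h -> 0 ⊑ h ->
  (forall k, (k <= n)%N -> e ⊑ vabs L (m - k%:R *: h)) -> e ⊑ h.
Proof.
move=> m0 mn h0 H.
pose p (k : nat) := vpos (m - k%:R *: h).
pose d := vpos (e - h).
suff S k : (k <= n)%N -> d ⊑ p k.+1.
  have := S n (leqnn n); rewrite /p vpos_eq0.
    move=> hd; apply: (vle_by (vle_trans (vpos_ge (e - h)) hd)); vlin.
  apply: (vle_by (vleD mn h0)); rewrite -[n.+1]addn1 natrD; vlin.
move: k; have step k : (k <= n)%N -> d ⊑ p k.+1 + vpos (k%:R *: h - h - m).
  move=> kn; apply: vpos_least; last by apply: vaddr_ge0; exact: vpos_ge0.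
  have := H k kn; rewrite vabsE => hk.
  have a1 : vpos (m - k%:R *: h) ⊑ p k.+1 + h.
    rewrite /p; apply: vpos_least; last by apply: vaddr_ge0 => //; exact: vpos_ge0.
    by apply: (vle_by (vpos_ge (m - k.+1%:R *: h))); rewrite -[k.+1]addn1 natrD; vlin.
  have a2 : vpos (- (m - k%:R *: h)) ⊑ vpos (k%:R *: h - h - m) + h.
    apply: vpos_least; last by apply: vaddr_ge0 => //; exact: vpos_ge0.
    by apply: (vle_by (vpos_ge (k%:R *: h - h - m))); vlin.
  have a3 : e - h ⊑ vpos (m - k%:R *: h) + vpos (- (m - k%:R *: h)) - h.
    by apply: (vle_by hk); vlin.
  apply: (vle_trans a3).
  have a4 : vinf (vpos (m - k%:R *: h)) (vpos (- (m - k%:R *: h))) = 0 by exact: vinf_pos_neg.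
  have a5 := vsup_vinf (vpos (m - k%:R *: h)) (vpos (- (m - k%:R *: h))).
  rewrite a4 addr0 in a5; rewrite -a5.
  suff : vsup L (vpos (m - k%:R *: h)) (vpos (- (m - k%:R *: h))) ⊑
         p k.+1 + vpos (k%:R *: h - h - m) + h.
    by move=> h1; apply: (vle_by h1); vlin.
  apply: vsup_least.
    by apply: (vle_by (vleD a1 (vpos_ge0 (k%:R *: h - h - m)))); vlin.
  by apply: (vle_by (vleD a2 (vpos_ge0 (m - k.+1%:R *: h)))); rewrite /p; vlin.
elim=> [|k IH] kn.
  have := step 0%N kn; rewrite scale0r.
  rewrite [vpos (0 - h - m)]vpos_eq0 ?addr0 //.
  by apply: (vle_by (vaddr_ge0 m0 h0)); vlin.
have ih := IH (ltnW kn).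
apply: (vle_of_disjoint _ _ _ (step _ kn) ih); try exact: vpos_ge0.
have := vinf_pos_neg (m - k.+1%:R *: h) => hd.
apply: vle_anti; last by apply: vinf_ge0; exact: vpos_ge0.
rewrite -hd; apply: vinf_mono; first exact: vlexx.
apply: vpos_mono; apply: (vle_by h0); rewrite -[k.+1]addn1 natrD; vlin.
Qed.

(** Midpoint convexity defect of the positive part, equal to [(|a| + |b| - |a + b|) / 4]. *)
Definition vgap (a b : X) : X :=
  2^-1 *: vpos a + 2^-1 *: vpos b - vpos (2^-1 *: (a + b)).

Lemma vgap_ge0 a b : 0 ⊑ vgap a b.
Proof.
have h2 : 0 <= 2^-1 :> R by lra.
apply: vsub_ge0; rewrite scalerDr -!vposZ //; exact: vpos_subD.
Qed.

(** Because [4 vgap a b = |a| + |b| - |a + b|], small defects at a level [k h] mean that [b - a] is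
    at most twice the distance of the midpoint to [k h], up to [4 S] with [S] the sum of the
    defects. Thus half of [b - a - 4 S] lies below the distance of the midpoint to every grid level,
    and [grid_dist] bounds it by the mesh [h]. *)
Lemma grid_gap (a b h : X) (n : nat) :
  0 ⊑ h -> 0 ⊑ a -> 0 ⊑ b -> a ⊑ n%:R *: h -> b ⊑ n%:R *: h ->
  vabs L (b - a) ⊑
  4 *: (\sum_(k < n.+1) vgap (a - k%:R *: h) (b - k%:R *: h)) + 2 *: h.
Proof.
move=> h0.
have half0 : 0 <= 2^-1 :> R by lra.
have vgapC x y : vgap x y = vgap y x.
  by rewrite /vgap (addrC x y); vlin.
suff lem x y : 0 ⊑ x -> 0 ⊑ y -> x ⊑ n%:R *: h -> y ⊑ n%:R *: h ->
    y - x ⊑ 4 *: (\sum_(k < n.+1) vgap (x - k%:R *: h) (y - k%:R *: h)) + 2 *: h.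
  move=> a0 b0 an bn; apply: vabs_least; first exact: lem.
  rewrite opprB.
  under eq_bigr do rewrite vgapC.
  exact: lem.
move=> x0 y0 xn yn; set S := \sum_(k < n.+1) _.
have key k : (k <= n)%N ->
    2^-1 *: (y - x - 4 *: S) ⊑ vabs L (2^-1 *: (x + y) - k%:R *: h).
  move=> kn.
  set a1 := x - k%:R *: h; set b1 := y - k%:R *: h.
  have gS : vgap a1 b1 ⊑ S.
    rewrite /S (bigD1 (inord k)) //= inordK // -/a1 -/b1.
    rewrite -[X in X ⊑ _]addr0; apply: vleD; first exact: vlexx.
    by apply: vsum_ge0 => i _; exact: vgap_ge0.
  have hb := vabs_ge b1; have ha := vabs_geN a1.
  have -> : 2^-1 *: (x + y) - k%:R *: h = 2^-1 *: (a1 + b1) by rewrite /a1 /b1; vlin.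
  suff H : b1 - a1 - 4 *: S ⊑ 2 *: vabs L (2^-1 *: (a1 + b1)).
    by apply: (vle_by (vle_scale half0 H)); rewrite /a1 /b1; vlin.
  have h4 : 0 <= 4 :> R by lra.
  apply: (vle_by (vleD (vleD (vle_scale h4 gS) hb) ha)).
  by rewrite /vgap !vposE; vlin.
have mid0 : 0 ⊑ 2^-1 *: (x + y) by apply: vscale_ge0 => //; exact: vaddr_ge0.
have midn : 2^-1 *: (x + y) ⊑ n%:R *: h.
  by apply: (vle_by (vle_scale half0 (vleD xn yn))); vlin.
have := grid_dist mid0 midn h0 key => H.
have two0 : 0 <= 2 :> R by lra.
by apply: (vle_by (vle_scale two0 H)); vlin.
Qed.

(** Intuitively [y] exceeds [u] wherever [(y - u)^+] lives, whatever the factor [N]. Formally [u] is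
    below [y + (u - y)^+], and [(u - y)^+] is disjoint from every multiple of [(y - u)^+]. *)
Lemma vpos_scaled_inf (N : R) (y u : X) : 0 <= N -> 0 ⊑ y -> 0 ⊑ u ->
  vinf (N *: vpos (y - u)) u ⊑ y.
Proof.
move=> N0 y0 u0; set p := vpos (y - u); set q := vpos (u - y).
have p0 : 0 ⊑ p by exact: vpos_ge0.
have q0 : 0 ⊑ q by exact: vpos_ge0.
have pq : vinf p q = 0 by rewrite /p /q -(opprB y u) vinf_pos_neg.
have disj : vinf (N *: p) q = 0.
  apply: vle_anti; last by apply: vinf_ge0 => //; exact: vscale_ge0.
  have N1 : 0 <= N + 1 by lra.
  rewrite -(scaler0 _ (N + 1)) -pq -vinfZ //.
  apply: vinf_mono; first by apply: vscale_le => //; lra.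
  by rewrite -{1}(scale1r q); apply: vscale_le => //; lra.
apply: (@vle_of_disjoint _ _ q (N *: p)) => //.
- by apply: vinf_ge0 => //; exact: vscale_ge0.
- apply: (vle_trans (vinf_lbr _ _)).
  by apply: (vle_by (vpos_ge (u - y))); rewrite /q; vlin.
- exact: vinf_lbl.
Qed.

End LatticeAlgebra.

Arguments vlexx {R X L} x.
Arguments vpos_ge0 {R X L} x.
Arguments vpos_ge {R X L} x.
Arguments vinf_lbl {R X L} x y.
Arguments vinf_lbr {R X L} x y.
Arguments vabs_ge0 {R X L} x.
Arguments vabs_ge {R X L} x.
Arguments vabs_geN {R X L} x.
Arguments vpos_le_vabs {R X L} x.
Arguments vpos_subD {R X L} x y.
Arguments vabs_subD {R X L} x y.
Arguments vinf_superD {R X L} a b c d.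
Arguments vgap_ge0 {R X L} a b.
Arguments vinf_split {R X L} x y.
Arguments vsup_vinf {R X L} x y.
Arguments vsup_ubl {R X} _ x y.

(** * Limits and KB-spaces *)

Section SeqLim.
Variables (R : realType) (X : normedModType R).
Implicit Types (u v : nat -> X) (l : X).

Definition seqlim u l :=
  forall e : R, 0 < e -> exists N, forall n, (N <= n)%N -> `|u n - l| <= e.

Lemma norm_eq0_small (x : X) : (forall e : R, 0 < e -> `|x| <= e) -> x = 0.
Proof.
move=> h; apply/eqP; rewrite -normr_eq0 eq_le normr_ge0 andbT.
by apply/ler_addgt0Pr => e e0; rewrite add0r; exact: h.
Qed.

Lemma seqlim_cvg u l : seqlim u l <-> (u @ \oo --> l).
Proof.
split=> h.
  apply/cvgrPdist_le => e e0; have [N hN] := h e e0.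
  by exists N => // n /= Nn; rewrite distrC; exact: hN.
move=> e e0; have /cvgrPdist_le/(_ e e0) [N _ hN] := h.
by exists N => n Nn; rewrite distrC; exact: hN.
Qed.

Lemma seqlim_uniq u l l' : seqlim u l -> seqlim u l' -> l = l'.
Proof.
move=> h h'; apply/eqP; rewrite -subr_eq0; apply/eqP/norm_eq0_small => e e0.
have e2 : 0 < e / 2 by lra.
have [N hN] := h _ e2; have [N' hN'] := h' _ e2.
have := hN _ (leq_maxl N N'); have := hN' _ (leq_maxr N N').
set n := maxn N N' => h1 h2.
have -> : l - l' = (l - u n) + (u n - l') by rewrite addrA subrK.
by apply: (le_trans (ler_normD _ _)); rewrite (distrC l); lra.
Qed.

Lemma seqlim_cst l : seqlim (fun=> l) l.
Proof. by move=> e e0; exists 0%N => n _; rewrite subrr normr0; lra. Qed.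

Lemma seqlimD u v l l' : seqlim u l -> seqlim v l' -> seqlim (fun n => u n + v n) (l + l').
Proof.
move=> h h' e e0; have e2 : 0 < e / 2 by lra.
have [N hN] := h _ e2; have [N' hN'] := h' _ e2.
exists (maxn N N') => n; rewrite geq_max => /andP[/hN h1 /hN' h2].
by rewrite opprD addrACA; apply: (le_trans (ler_normD _ _)); lra.
Qed.

Lemma seqlimN u l : seqlim u l -> seqlim (fun n => - u n) (- l).
Proof. by move=> h e e0; have [N hN] := h e e0; exists N => n /hN; rewrite -opprD normrN. Qed.

Lemma seqlimB u v l l' : seqlim u l -> seqlim v l' -> seqlim (fun n => u n - v n) (l - l').
Proof. by move=> h h'; apply: seqlimD => //; exact: seqlimN. Qed.

Lemma seqlim_sum (I : Type) (r : seq I) (f : I -> nat -> X) (g : I -> X) :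
  (forall i, seqlim (f i) (g i)) ->
  seqlim (fun n => \sum_(i <- r) f i n) (\sum_(i <- r) g i).
Proof.
move=> h; elim: r => [|i r IH].
  rewrite big_nil; under eq_fun do rewrite big_nil; exact: seqlim_cst.
by rewrite big_cons; under eq_fun do rewrite big_cons; exact: seqlimD.
Qed.

Lemma seqlim_sub u l (f : nat -> nat) : (forall n, (n <= f n)%N) ->
  seqlim u l -> seqlim (fun n => u (f n)) l.
Proof.
by move=> hf h e e0; have [N hN] := h e e0; exists N => n Nn; apply: hN; exact: leq_trans (hf n).
Qed.

Lemma seqlim_shift u l k : seqlim u l <-> seqlim (fun n => u (n + k)%N) l.
Proof.
split; first by apply: seqlim_sub => n; exact: leq_addr.
move=> h e e0; have [N hN] := h e e0; exists (N + k)%N => n Nn.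
have kn : (k <= n)%N by apply: leq_trans Nn; exact: leq_addl.
by rewrite -(subnK kn); apply: hN; rewrite leq_subRL // addnC.
Qed.

Lemma seqlim_norm_le u l (M : R) : seqlim u l ->
  (exists N, forall n, (N <= n)%N -> `|u n| <= M) -> `|l| <= M.
Proof.
move=> h [N0 hM]; apply/ler_addgt0Pr => e e0; have [N hN] := h e e0.
have h1 := hN _ (leq_maxr N0 N); have h2 := hM _ (leq_maxl N0 N).
set n := maxn N0 N in h1 h2.
have -> : l = u n - (u n - l) by rewrite opprB addrC subrK.
by apply: (le_trans (ler_normB _ _)); lra.
Qed.

Lemma closureP (A : set X) x :
  closure A x <-> forall e : R, 0 < e -> exists2 y, A y & `|x - y| <= e.
Proof.
split=> [h e e0|h B /nbhs_ballP[e /= e0 he]].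
  have [y [Ay /= hy]] := h _ (nbhsx_ballx x e e0).
  by exists y => //; move: hy; rewrite -ball_normE /= => /ltW.
have [y Ay hy] := h (e / 2) ltac:(lra); exists y; split => //.
by apply: he; rewrite -ball_normE /=; lra.
Qed.

Lemma closure_near (A : set X) x : closure A x ->
  forall e : R, 0 < e -> exists2 y, A y & `|x - y| <= e.
Proof. by case: (closureP A x) => h _. Qed.

Lemma closed_seqlim (A : set X) u l : closed A -> (forall n, A (u n)) -> seqlim u l -> A l.
Proof.
move=> cA Au ul; apply: cA; apply/closureP => e e0; have [N hN] := ul e e0.
by exists (u N) => //; rewrite distrC; exact: hN.
Qed.

Lemma half_pow_small (c e : R) : 0 < e -> exists N, forall n, (N <= n)%N -> c * 2^-1 ^+ n <= e.
Proof.
move=> e0.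
have h : (fun n => c * 2^-1 ^+ n) @ \oo --> (c * 0 : R).
  apply: cvgMl_tmp; apply: cvg_expr; rewrite ger0_norm; lra.
rewrite mulr0 in h.
have /cvgrPdist_le/(_ e e0) [N _ hN] := h.
exists N => n Nn; have := hN n Nn; rewrite /= sub0r normrN => h1.
exact: le_trans (ler_norm _) h1.
Qed.

Lemma half_pow_gt0 n : 0 < 2^-1 ^+ n :> R.
Proof. by apply: exprn_gt0; lra. Qed.

Lemma sum_half_pow m n : (m <= n)%N ->
  \sum_(m <= i < n) (2^-1 ^+ i : R) = 2 * (2^-1 ^+ m - 2^-1 ^+ n).
Proof.
elim: n => [|n IH]; first by rewrite leqn0 => /eqP->; rewrite big_geq // subrr mulr0.
rewrite leq_eqVlt => /orP[/eqP->|]; first by rewrite big_geq // subrr mulr0.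
by rewrite ltnS => mn; rewrite big_nat_recr //= IH // exprS; lra.
Qed.

Lemma sum_half_pow_le m n : \sum_(m <= i < n) (2^-1 ^+ i : R) <= 2 * 2^-1 ^+ m.
Proof.
have [mn|nm] := leqP m n.
  by rewrite sum_half_pow //; have := half_pow_gt0 n; lra.
by rewrite big_geq ?(ltnW nm) //; have := half_pow_gt0 m; lra.
Qed.

End SeqLim.
Arguments half_pow_small {R} c [e] _.
Arguments half_pow_gt0 {R} n.
Arguments sum_half_pow_le {R} m n.

Section Complete.
Variables (R : realType) (X : completeNormedModType R).

Lemma cauchy_seqlim (u : nat -> X) :
  (forall e : R, 0 < e -> exists N, forall m n, (N <= m)%N -> (N <= n)%N -> `|u m - u n| <= e) ->
  exists l, seqlim u l.
Proof.
move=> h; suff : cvg (u @ \oo).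
  by move=> /cvg_ex[l hl]; exists l; apply/seqlim_cvg.
apply/cauchy_cvgP/cauchy_exP => e e0.
have [N hN] := h (e / 2) ltac:(lra); exists (u N); exists N => // n /= Nn.
by rewrite -ball_normE /=; have := hN _ _ (leqnn N) Nn; lra.
Qed.

Lemma cauchy_geom (u : nat -> X) (c : R) :
  (forall n, `|u n.+1 - u n| <= c * 2^-1 ^+ n) ->
  exists2 l, seqlim u l & forall n, `|u n - l| <= 2 * c * 2^-1 ^+ n.
Proof.
move=> h.
have c0 : 0 <= c by have := h 0%N; rewrite expr0 mulr1; exact: le_trans.
have key m n : (m <= n)%N -> `|u n - u m| <= 2 * c * 2^-1 ^+ m.
  move=> mn; rewrite -telescope_sumr //.
  apply: (le_trans (ler_norm_sum _ _ _)).
  apply: (@le_trans _ _ (\sum_(m <= i < n) c * 2^-1 ^+ i)); first by apply: ler_sum.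
  by rewrite -mulr_sumr; have := sum_half_pow_le (R:=R) m n; nra.
have [l hl] : exists l, seqlim u l.
  apply: cauchy_seqlim => e e0; have e2 : 0 < e / 2 by lra.
  have [N hN] := half_pow_small (2 * c) e2.
  exists N => m n Nm Nn; have h1 := key _ _ Nm; have h2 := key _ _ Nn.
  have := hN N (leqnn N).
  have -> : u m - u n = (u m - u N) - (u n - u N) by rewrite opprB addrA subrK.
  by move=> h3; apply: (le_trans (ler_normB _ _)); lra.
exists l => // n.
apply: (@seqlim_norm_le _ _ (fun k => u n - u k) _ _ (seqlimB (seqlim_cst (u n)) hl)).
by exists n => k nk; rewrite distrC; exact: key.
Qed.
End Complete.

Section BanachLattice.
Variables (R : realType) (X : completeNormedModType R) (L : vector_lattice X).
Hypothesis hL : lattice_norm L.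
Local Notation "x ⊑ y" := (vle L x y) (at level 70).
Local Notation vpos := (vpos L).
Local Notation vinf := (vinf L).
Local Notation vabs := (vabs L).
Ltac vlin := vlin_with R X.

Lemma norm_vabs x : `|vabs x| = `|x|.
Proof.
by apply/eqP; rewrite eq_le; apply/andP; split; apply: hL; rewrite vabs_vabs; exact: vlexx.
Qed.

Lemma norm_vabs_le x y : vabs x ⊑ y -> `|x| <= `|y|.
Proof. by move=> h; apply: hL; apply: vle_trans h _; exact: vabs_ge. Qed.

Lemma norm_vle x y : 0 ⊑ x -> x ⊑ y -> `|x| <= `|y|.
Proof. by move=> x0 xy; apply: norm_vabs_le; rewrite vabs_id. Qed.

Lemma norm_vpos x : `|vpos x| <= `|x|.
Proof. rewrite -(norm_vabs x); apply: norm_vle; [exact: vpos_ge0|exact: vpos_le_vabs]. Qed.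

Lemma norm_vpos_lip x y : `|vpos x - vpos y| <= `|x - y|.
Proof. apply: hL; exact: vpos_abs_lip. Qed.

(** The positive cone is closed: [(- x)^+] lies below [|y - x|] for every positive [y]. *)
Lemma vge0_approx x : (forall e : R, 0 < e -> exists2 y, 0 ⊑ y & `|x - y| <= e) -> 0 ⊑ x.
Proof.
move=> h; suff e0 : vpos (- x) = 0.
  by have := vpos_ge (L:=L) (- x); rewrite e0 => h1; apply: (vle_by (vleN h1)); vlin.
apply: norm_eq0_small => e e0; have [y y0 hy] := h e e0.
apply: le_trans hy; rewrite distrC -(norm_vabs (y - x)).
apply: norm_vle; first exact: vpos_ge0.
apply: vpos_least; last exact: vabs_ge0.
by apply: (vle_by (vleD (vabs_ge (y - x)) y0)); vlin.
Qed.

Lemma vge0_lim u l : seqlim u l -> (exists N, forall n, (N <= n)%N -> 0 ⊑ u n) -> 0 ⊑ l.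
Proof.
move=> h [N0 u0]; apply: vge0_approx => e e0; have [N hN] := h e e0.
by exists (u (maxn N0 N)); [apply: u0; exact: leq_maxl|rewrite distrC; apply: hN; exact: leq_maxr].
Qed.

Lemma vle_lim u v l l' : seqlim u l -> seqlim v l' ->
  (exists N, forall n, (N <= n)%N -> u n ⊑ v n) -> l ⊑ l'.
Proof.
move=> h h' [N hN]; apply: vge0_sub; apply: (vge0_lim (seqlimB h' h)).
by exists N => n /hN; exact: vsub_ge0.
Qed.

Lemma vle_lim_r u l x : seqlim u l -> (exists N, forall n, (N <= n)%N -> x ⊑ u n) -> x ⊑ l.
Proof. by move=> h; apply: vle_lim h; exact: seqlim_cst. Qed.

Lemma vle_lim_l u l x : seqlim u l -> (exists N, forall n, (N <= n)%N -> u n ⊑ x) -> l ⊑ x.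
Proof. by move=> h; apply: vle_lim h _; exact: seqlim_cst. Qed.

Lemma vle_small x : (forall n : nat, exists y, x ⊑ y /\ `|y| <= 2^-1 ^+ n) -> x ⊑ 0.
Proof.
move=> h; suff : 0 ⊑ - x by move=> /vleN; rewrite opprK oppr0.
apply: vge0_approx => e e0; have [N hN] := half_pow_small 1 e0.
have [y [xy hy]] := h N; exists (y - x); first exact: vsub_ge0.
have -> : - x - (y - x) = - y by vlin.
rewrite normrN; by have := hN N (leqnn N); lra.
Qed.

(* Banach lattices with this property are the KB-spaces. *)
Definition KB := forall s : nat -> X, (forall n, s n ⊑ s n.+1) ->
  (exists M : R, forall n, `|s n| <= M) -> exists l, seqlim s l.

Lemma incr_le (s : nat -> X) : (forall n, s n ⊑ s n.+1) ->
  forall m n, (m <= n)%N -> s m ⊑ s n.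
Proof.
move=> h m n /subnK <-; elim: (n - m)%N => [|k IH]; first exact: vlexx.
exact: vle_trans IH (h _).
Qed.

Lemma incr_lim_ge (s : nat -> X) l : (forall n, s n ⊑ s n.+1) -> seqlim s l ->
  forall n, s n ⊑ l.
Proof. by move=> h hl n; apply: (vle_lim_r hl); exists n => m; exact: incr_le. Qed.

Lemma KB_decr : KB -> forall (s : nat -> X) (a : X), (forall n, s n.+1 ⊑ s n) ->
  (forall n, a ⊑ s n) -> exists2 l, seqlim s l & a ⊑ l /\ forall n, l ⊑ s n.
Proof.
move=> kb s a hs ha.
have [l hl] : exists l, seqlim (fun n => - s n) l.
  apply: kb => [n|]; first exact: vleN.
  exists (`|s 0%N - a| + `|a|) => n; rewrite normrN.
  have -> : s n = (s n - a) + a by rewrite subrK.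
  apply: le_trans (ler_normD _ _) _; apply: lerD => //.
  apply: norm_vle; first exact: vsub_ge0.
  elim: n => [|n IH]; first exact: vlexx.
  by apply: vle_trans IH; apply: (vle_by (hs n)); vlin.
have hl' : seqlim s (- l).
  have := seqlimN hl; under eq_fun do rewrite opprK; done.
exists (- l) => //; split; first by apply: (vle_lim_r hl'); exists 0%N.
move=> n; have := incr_lim_ge (fun n => vleN (hs n)) hl n => h.
by apply: (vle_by h); vlin.
Qed.

(** An exhaustion argument: above each member there is one beyond which [S] moves by at most [e],
    since otherwise an increasing bounded sequence with jumps above [e] would contradict KB. The
    limit of such members for [e = 2^-n] is an upper bound because [S] is directed. *)
Lemma KB_directed : KB -> forall S : set X, S !=set0 ->
  (forall a b, S a -> S b -> exists c, [/\ S c, a ⊑ c & b ⊑ c]) -> norm_bounded S ->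
  exists l, (forall a, S a -> a ⊑ l) /\ (forall e : R, 0 < e -> exists2 a, S a & `|l - a| <= e).
Proof.
move=> kb S [a0 Sa0] dir [M hM].
pose small (a : X) (e : R) := S a /\ forall b, S b -> a ⊑ b -> `|b - a| <= e.
have ex e : 0 < e -> forall a, S a -> exists2 c, small c e & a ⊑ c.
  move=> e0 a Sa; apply: contrapT => no.
  have nxt (c : {c | S c /\ a ⊑ c}) :
      {d : {c | S c /\ a ⊑ c} | sval c ⊑ sval d /\ e < `|sval d - sval c|}.
    apply: cid; case: c => c [Sc ac] /=; apply: contrapT => no2; apply: no.
    exists c => //; split=> // b Sb cb; rewrite leNgt; apply/negP => h; apply: no2.
    by exists (exist _ b (conj Sb (vle_trans ac cb))).
  pose s n := sval (iter n (fun c => sval (nxt c)) (exist _ a (conj Sa (vlexx a)))).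
  have [l hl] : exists l, seqlim s l.
    apply: kb => [n|]; first by rewrite /s /=; case: (nxt _) => d [].
    by exists M => n; apply: hM; rewrite /s; case: (iter _ _ _) => c [].
  have [N hN] := hl (e / 2) ltac:(lra).
  have h1 := hN N (leqnn N); have h2 := hN N.+1 (leqnSn N).
  have : e < `|s N.+1 - s N| by rewrite /s /=; case: (nxt _) => d [].
  have -> : s N.+1 - s N = (s N.+1 - l) - (s N - l) by vlin.
  by move=> h3; have := ler_normB (s N.+1 - l) (s N - l); lra.
have ex2 (n : nat) (a : {a | S a}) : {c : {a | S a} | small (sval c) (2^-1 ^+ n) /\ sval a ⊑ sval c}.
  apply: cid; case: a => a Sa /=; have [c hc ac] := ex _ (half_pow_gt0 n) a Sa.
  by exists (exist _ c hc.1).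
pose fix s (n : nat) : {a | S a} := if n is m.+1 then sval (ex2 n (s m)) else sval (ex2 0%N (exist _ a0 Sa0)).
have s_small n : small (sval (s n)) (2^-1 ^+ n).
  by case: n => [|n] /=; case: (ex2 _ _) => c [].
have s_inc n : sval (s n) ⊑ sval (s n.+1) by rewrite /=; case: (ex2 _ _) => c [].
have [l hl] : exists l, seqlim (fun n => sval (s n)) l.
  by apply: kb s_inc _; exists M => n; apply: hM; case: (s n).
exists l; split; last first.
  by move=> e e0; have [N hN] := hl e e0; exists (sval (s N)); [case: (s N)|rewrite distrC; exact: hN].
move=> a Sa; suff : a - l ⊑ 0 by move=> h; apply: (vle_by h); vlin.
apply: vle_small => n.
have [Ss hs] := s_small n; have [c [Sc ac sc]] := dir _ _ Sa Ss.
exists (c - sval (s n)); split; last exact: hs.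
have := incr_lim_ge s_inc hl n => h.
by apply: (vle_by (vleD ac h)); vlin.
Qed.

End BanachLattice.

(** * Positive functionals *)

Section HahnBanach.
Variables (R : realType) (X : lmodType R).
Ltac vlin := vlin_with R X.

Definition sublinear (p : X -> R) :=
  (forall x y, p (x + y) <= p x + p y) /\ (forall a x, 0 < a -> p (a *: x) <= a * p x).

Definition linear_form (f : X -> R) :=
  (forall x y, f (x + y) = f x + f y) /\ (forall a x, f (a *: x) = a * f x).

Lemma sublinear0 p : sublinear p -> p 0 = 0.
Proof.
move=> [_ h]; have := h 2 0 ltac:(lra); have := h 2^-1 0 ltac:(lra).
rewrite !scaler0; lra.
Qed.

Lemma sublinear_ge p x : sublinear p -> - p (- x) <= p x.
Proof. by move=> h; have := h.1 x (- x); rewrite subrr sublinear0 //; lra. Qed.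

(* The largest sublinear minorant q of p with [q (- y) <= - p y]. *)
Definition tilt (p : X -> R) (y x : X) : R :=
  inf [set r | exists2 t, 0 <= t & r = p (x + t *: y) - t * p y].

Section Tilt.
Variables (p : X -> R) (y : X).
Hypothesis hp : sublinear p.

Lemma tilt_homog t : 0 <= t -> p (t *: y) <= t * p y.
Proof.
rewrite le_eqVlt => /orP[/eqP<-|]; last exact: hp.2.
by rewrite scale0r mul0r sublinear0.
Qed.

Lemma tilt_lb x : lbound [set r | exists2 t, 0 <= t & r = p (x + t *: y) - t * p y] (- p (- x)).
Proof.
move=> _ [t t0 ->].
have h := hp.1 (x + t *: y) (- x).
have e : x + t *: y - x = t *: y by vlin.
rewrite e in h.
have : t * p y = p (t *: y).
  move: t0; rewrite le_eqVlt => /orP[/eqP<-|t0].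
    by rewrite scale0r mul0r sublinear0.
  apply/eqP; rewrite eq_le (tilt_homog (ltW t0)) andbT.
  have := hp.2 t^-1 (t *: y); rewrite invr_gt0 => /(_ t0).
  rewrite scalerA mulVf ?scale1r; last by apply: lt0r_neq0.
  by rewrite mulrC ler_pdivlMr // mulrC.
by move=> ->; lra.
Qed.

Lemma tilt_has_inf x : has_inf [set r | exists2 t, 0 <= t & r = p (x + t *: y) - t * p y].
Proof.
split; last by exists (- p (- x)); exact: tilt_lb.
by exists (p (x + 0 *: y) - 0 * p y); exists 0.
Qed.

Lemma tilt_le x t : 0 <= t -> tilt p y x <= p (x + t *: y) - t * p y.
Proof. by move=> t0; apply: ge_inf; [have [] := tilt_has_inf x|exists t]. Qed.

Lemma tilt_adh x e : 0 < e -> exists2 t, 0 <= t & p (x + t *: y) - t * p y < tilt p y x + e.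
Proof. by move=> e0; have [_ [t t0 ->] h] := inf_adherent e0 (tilt_has_inf x); exists t. Qed.

Lemma tilt_le_p x : tilt p y x <= p x.
Proof. by have := tilt_le x (lexx 0); rewrite scale0r mul0r addr0 subr0. Qed.

Lemma tilt_sublinear : sublinear (tilt p y).
Proof.
split=> [x x'|a x a0].
  apply/ler_addgt0Pr => e e0.
  have [t t0 ht] := @tilt_adh x (e / 2) ltac:(lra).
  have [s s0 hs] := @tilt_adh x' (e / 2) ltac:(lra).
  have := @tilt_le (x + x') (t + s) ltac:(lra).
  have := hp.1 (x + t *: y) (x' + s *: y).
  have -> : x + t *: y + (x' + s *: y) = x + x' + (t + s) *: y by vlin.
  by lra.
apply/ler_addgt0Pr => e e0.
have ea : 0 < e / a by exact: divr_gt0.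
have [t t0 ht] := tilt_adh x ea.
have at0 : 0 <= a * t by apply: mulr_ge0 => //; exact: ltW.
have := tilt_le (a *: x) at0.
have -> : a *: x + (a * t) *: y = a *: (x + t *: y) by vlin.
have := hp.2 a (x + t *: y) a0.
have : a * (p (x + t *: y) - t * p y) <= a * (tilt p y x + e / a).
  by rewrite ler_pM2l //; exact: ltW.
have -> : a * (tilt p y x + e / a) = a * tilt p y x + e by field; lra.
by lra.
Qed.

Lemma tiltN : tilt p y (- y) <= - p y.
Proof.
have := @tilt_le (- y) 1 ltac:(lra).
by rewrite scale1r addNr sublinear0 // mul1r sub0r.
Qed.
End Tilt.

(** Zorn's lemma on the sublinear minorants of [p], ordered downwards. The pointwise infimum of a
    chain is finite since every minorant is at least [- p (- x)] at [x], and it is sublinear since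
    two members of a chain are comparable. *)
Lemma minimal_sublinear p : sublinear p -> exists q, [/\ sublinear q, forall x, q x <= p x &
  forall q', sublinear q' -> (forall x, q' x <= q x) -> forall x, q x <= q' x].
Proof.
move=> hp.
pose T := {q : X -> R | sublinear q /\ forall x, q x <= p x}.
pose t0 : T := exist _ p (conj hp (fun x => lexx (p x))).
pose Rl (s t : T) : bool := `[< forall x, sval t x <= sval s x >].
have [||A tot|[q [hq qp]] qmax] := ZL_preorder t0 (R := Rl).
- by move=> t; apply/asboolP.
- move=> r s t /asboolP h1 /asboolP h2; apply/asboolP => x; exact: le_trans (h2 x) (h1 x).
- have [[s0 As0]|A0] := pselect (A !=set0); last first.
    by exists t0 => s As; exfalso; apply: A0; exists s.
  pose V x : set R := [set r | exists2 s, A s & r = sval s x].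
  have Vlb x : lbound (V x) (- p (- x)).
    move=> _ [[s [hs sp]] _ ->] /=.
    by have := sublinear_ge x hs; have := sp (- x); lra.
  have Vinf x : has_inf (V x) by split; [exists (sval s0 x); exists s0|exists (- p (- x))].
  pose m x := inf (V x).
  have mle s x : A s -> m x <= sval s x by move=> As; apply: ge_inf; [case: (Vinf x)|exists s].
  have hm : sublinear m.
    split=> [x y|a x a0]; apply/ler_addgt0Pr => e e0.
      have e2 : 0 < e / 2 by lra.
      have [_ [s As ->] h1] := inf_adherent e2 (Vinf x).
      have [_ [s' As' ->] h2] := inf_adherent e2 (Vinf y).
      rewrite -/(m x) in h1; rewrite -/(m y) in h2.
      have [/asboolP ss|/asboolP ss] := tot _ _ As As'.
        have := mle s' (x + y) As'; have := ss x; have := (svalP s').1.1 x y; lra.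
      have := mle s (x + y) As; have := ss y; have := (svalP s).1.1 x y; lra.
    have [_ [s As ->] h1] := inf_adherent (divr_gt0 e0 a0) (Vinf x).
    have := mle s (a *: x) As; have := (svalP s).1.2 a x a0.
    have : a * sval s x <= a * (m x + e / a) by rewrite ler_pM2l //; exact: ltW.
    have -> : a * (m x + e / a) = a * m x + e by field; lra.
    by lra.
  have mp x : m x <= p x by apply: le_trans (mle s0 x As0) _; exact: (svalP s0).2.
  by exists (exist _ m (conj hm mp)) => s As; apply/asboolP => x /=; exact: mle.
- exists q; split=> // q' hq' q'q.
  have q'p x : q' x <= p x by exact: le_trans (q'q x) (qp x).
  have := qmax (exist _ q' (conj hq' q'p)).
  rewrite /Rl /= => /(_ ltac:(exact/asboolP)) /asboolP; done.
Qed.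

(** A minimal sublinear functional cannot be lowered by tilting, which forces it to be odd and hence
    linear. Starting from [tilt p z] rather than [p] gives [f (- z) <= - p z], so [f] attains [p] at
    [z]. *)
Lemma hahn_banach p z : sublinear p ->
  exists f, [/\ linear_form f, forall x, f x <= p x & f z = p z].
Proof.
move=> hp.
have [f [hf fp fmin]] := minimal_sublinear (tilt_sublinear z hp).
have fN y : f (- y) = - f y.
  apply/eqP; rewrite eq_le; apply/andP; split.
    apply: le_trans (tiltN y hf); apply: fmin; first exact: tilt_sublinear.
    exact: tilt_le_p.
  by have := sublinear_ge (- y) hf; rewrite opprK; lra.
have fD x y : f (x + y) = f x + f y.
  apply/eqP; rewrite eq_le hf.1 /=.
  by have := hf.1 (- x) (- y); rewrite -opprD !fN; lra.
exists f; split.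
- split=> // a x.
  have pos b y : 0 < b -> f (b *: y) = b * f y.
    move=> b0; apply/eqP; rewrite eq_le hf.2 //=.
    by have := hf.2 b (- y) b0; rewrite scalerN !fN mulrN; lra.
  have [a0|a0|->] := ltgtP a 0; last by rewrite scale0r sublinear0 // mul0r.
    by rewrite -[a in LHS]opprK scaleNr fN pos ?oppr_gt0 //; ring.
  exact: pos.
- by move=> x; apply: le_trans (fp x) _; exact: tilt_le_p.
- apply/eqP; rewrite eq_le; apply/andP; split.
    by apply: le_trans (fp z) _; exact: tilt_le_p.
  have := le_trans (fp (- z)) (tiltN z hp).
  by rewrite fN; lra.
Qed.

Lemma linear_form0 f : linear_form f -> f 0 = 0.
Proof. by move=> [_ h]; rewrite -(scale0r 0) h mul0r. Qed.

Lemma linear_formN f x : linear_form f -> f (- x) = - f x.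
Proof. by move=> [_ h]; rewrite -scaleN1r h mulN1r. Qed.

Lemma linear_formB f x y : linear_form f -> f (x - y) = f x - f y.
Proof. by move=> h; rewrite h.1 linear_formN. Qed.

Lemma linear_form_sum f (I : Type) (r : seq I) (P : pred I) (g : I -> X) : linear_form f ->
  f (\sum_(i <- r | P i) g i) = \sum_(i <- r | P i) f (g i).
Proof.
move=> h; apply: (big_morph f h.1); exact: linear_form0.
Qed.
End HahnBanach.

Section PositiveForms.
Variables (R : realType) (X : completeNormedModType R) (L : vector_lattice X).
Hypothesis hL : lattice_norm L.
Local Notation "x ⊑ y" := (vle L x y) (at level 70).
Local Notation vpos := (vpos L).
Local Notation vinf := (vinf L).
Local Notation vabs := (vabs L).
Ltac vlin := vlin_with R X.

Definition pos_form (f : X -> R) (C : R) :=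
  [/\ linear_form f, forall x, 0 ⊑ x -> 0 <= f x & forall x, `|f x| <= C * `|x|].

Lemma pos_form_mono f C x y : pos_form f C -> x ⊑ y -> f x <= f y.
Proof.
by move=> [h1 h2 _] /vsub_ge0 /h2; rewrite linear_formB //; lra.
Qed.

(** Hahn-Banach for the sublinear functional [|x^+|]: as it vanishes on negative vectors, a linear
    form below it is positive. *)
Lemma norming_form z : 0 ⊑ z -> exists2 f, pos_form f 1 & f z = `|z|.
Proof.
move=> z0; pose p x := `|vpos x|.
have hp : sublinear p.
  split=> [x y|a x a0].
    apply: le_trans (ler_normD _ _); exact: (norm_vle hL (vpos_ge0 _) (vpos_subD x y)).
  by rewrite /p vposZ; [rewrite normrZ gtr0_norm|exact: ltW].
have [f [hf fp fz]] := hahn_banach z hp; exists f; last by rewrite fz /p vpos_id.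
split=> // x.
  move=> x0; have := fp (- x); rewrite linear_formN // /p vpos_eq0 ?normr0; first by lra.
  by apply: (vle_by x0); vlin.
rewrite mul1r ler_norml; apply/andP; split; last exact: le_trans (fp x) (norm_vpos hL x).
have := le_trans (fp (- x)) (norm_vpos hL (- x)).
by rewrite linear_formN // normrN; lra.
Qed.

Lemma pos_formZ f C a : 0 <= a -> pos_form f C -> pos_form (fun x => a * f x) (a * C).
Proof.
move=> a0 [[h1 h2] h3 h4]; split.
- by split=> [x y|b x]; rewrite ?h1 ?h2; [ring|ring].
- by move=> x x0; apply: mulr_ge0 => //; exact: h3.
- by move=> x; rewrite normrM (ger0_norm a0) -mulrA; apply: ler_wpM2l.
Qed.

Lemma pos_formD f g C D : pos_form f C -> pos_form g D -> pos_form (fun x => f x + g x) (C + D).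
Proof.
move=> [[h1 h2] h3 h4] [[k1 k2] k3 k4]; split.
- by split=> [x y|b x]; rewrite ?h1 ?h2 ?k1 ?k2; [ring|ring].
- by move=> x x0; apply: addr_ge0; [exact: h3|exact: k3].
- by move=> x; apply: le_trans (ler_normD _ _) _; rewrite mulrDl; apply: lerD.
Qed.

Lemma pos_form0 : pos_form (fun=> 0) 0.
Proof.
split=> [|x _|x]; last by rewrite normr0 mul0r.
  by split=> [x y|a x]; rewrite ?addr0 ?mulr0.
exact: lexx.
Qed.

(* On an order interval of a KB-space the norm is dominated, up to [e], by a
   single positive functional.  Otherwise pick z_n in [0, u] with norm above e on
   which the norming functionals f_i of the earlier z_i are tiny; the tail suprema
   s_n = sup_(j >= n) z_j then decrease but drop by a fixed amount at each step. *)
Lemma dominating_form : KB L -> forall u (e : R), 0 ⊑ u -> 0 < e ->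
  exists f C, pos_form f C /\ forall z, 0 ⊑ z -> z ⊑ u -> `|z| <= e + f z.
Proof.
move=> kb u e u0 e0; apply: contrapT => no.
pose T := {g : X -> R | exists C, pos_form g C}.
have step (n : nat) (g : T) : {zf : X * (X -> R) | [/\ 0 ⊑ zf.1, zf.1 ⊑ u, pos_form zf.2 1,
    zf.2 zf.1 = `|zf.1| & e <= `|zf.1| /\ sval g zf.1 <= e / 8 * 2^-1 ^+ n]}.
  apply: cid; case: g => g [C hg] /=.
  (* Failure for the functional [K g] yields a [z] in the interval with [K g(z) <= |u|]; this [K]
     turns that into the bound [e / 8 * 2^-n] for [g z]. *)
  pose K := 8 * 2 ^+ n * `|u| / e.
  have K0 : 0 <= K.
    rewrite /K; apply: divr_ge0; last exact: ltW.
    by apply: mulr_ge0 => //; apply: mulr_ge0 => //; exact: exprn_ge0.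
  apply: contrapT => no2; apply: no.
  exists (fun x => K * g x), (K * C); split; first exact: pos_formZ.
  move=> z z0 zu; rewrite leNgt; apply/negP => hz; apply: no2.
  have gz0 : 0 <= K * g z by apply: mulr_ge0 => //; case: hg => _ h _; exact: h.
  have [f hf fz] := norming_form z0.
  exists (z, f); split => //=; split; first by lra.
  have zu2 := norm_vle hL z0 zu.
  have u1 : 0 < `|u| by lra.
  have : K * g z <= `|u| by lra.
  have p2 : 2^-1 ^+ n * 2 ^+ n = 1 :> R by rewrite -exprMn mulVf ?expr1n //; lra.
  have q0 : 0 < 2 ^+ n :> R by apply: exprn_gt0; lra.
  have -> : 2^-1 ^+ n = (2 ^+ n)^-1 :> R by rewrite exprVn.
  rewrite /K => h.
  have : 8 * 2 ^+ n * g z / e * `|u| <= 1 * `|u| by rewrite mul1r; apply: le_trans h; rewrite le_eqVlt; apply/orP; left; apply/eqP; ring.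
  rewrite ler_pM2r // ler_pdivrMr // mul1r => h2.
  rewrite ler_pdivlMr //; lra.
have updP n (g : T) : exists C, pos_form (fun x => sval g x + (sval (step n g)).2 x) C.
  have [C hC] := svalP g; have [_ _ h _ _] := svalP (step n g).
  by exists (C + 1); exact: pos_formD.
pose upd (n : nat) (g : T) : T := exist _ _ (updP n g).
pose fix G (n : nat) : T := if n is m.+1 then upd m (G m) else exist _ _ (ex_intro _ _ pos_form0).
pose z n := (sval (step n (G n))).1; pose f n := (sval (step n (G n))).2.
have hz n : [/\ 0 ⊑ z n, z n ⊑ u, pos_form (f n) 1, f n (z n) = `|z n| &
   e <= `|z n| /\ sval (G n) (z n) <= e / 8 * 2^-1 ^+ n] by exact: (svalP (step n (G n))).
have fG i n x : (i < n)%N -> 0 ⊑ x -> f i x <= sval (G n) x.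
  move=> + x0; elim: n => // n IH; rewrite ltnS leq_eqVlt => /orP[/eqP->|lt].
    rewrite /= -/(f n) -/(upd n (G n)).
    have : 0 <= sval (G n) x by have [C [_ h _]] := svalP (G n); exact: h.
    by rewrite /f; lra.
  have := IH lt; have : 0 <= f n x by have [_ _ [_ h _] _ _] := hz n; exact: h.
  by rewrite /f /=; lra.
have fz i j : (i < j)%N -> f i (z j) <= e / 8 * 2^-1 ^+ j.
  by move=> ij; have [h _ _ _ [_ h2]] := hz j; apply: le_trans h2; exact: fG.
(* [S i n] is the supremum of 0 and [z i, ..., z (i + n - 1)]; its limit in [n] is the tail supremum
   [s i]. *)
pose fix S i n := if n is m.+1 then vsup L (S i m) (z (i + m)%N) else 0.
have S0 i n : 0 ⊑ S i n.
  by elim: n => [|n IH]; [exact: vlexx|apply: vle_trans IH _; exact: vsup_ubl].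
have Su i n : S i n ⊑ u.
  by elim: n => [|n IH] //=; apply: vsup_least => //; have [] := hz (i + n)%N.
have Sex i : exists l, seqlim (S i) l.
  apply: kb => [n|]; first exact: vsup_ubl.
  by exists `|u| => n; exact: (norm_vle hL).
pose s i := sval (cid (Sex i)).
have hs i : seqlim (S i) (s i) by exact: svalP (cid (Sex i)).
have Ss i n : S i n ⊑ s i by apply: (incr_lim_ge hL _ (hs i)) => m; exact: vsup_ubl.
have s0 i : 0 ⊑ s i by exact: vle_trans (S0 i 0%N) (Ss i 0%N).
have zs i : z i ⊑ s i.
  by apply: vle_trans (Ss i 1%N); rewrite /= addn0; exact: vsup_ubr.
have ss i : s i.+1 ⊑ s i.
  apply: (vle_lim_l hL (hs i.+1)); exists 0%N => n _; apply: vle_trans (Ss i n.+1).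
  elim: n => [|n IH]; first exact: S0.
  change (S i.+1 n.+1) with (vsup L (S i.+1 n) (z (i.+1 + n)%N)).
  change (S i n.+2) with (vsup L (S i n.+1) (z (i + n.+1)%N)).
  apply: vsup_least; first by apply: vle_trans IH _; exact: vsup_ubl.
  by rewrite addSnnS; exact: vsup_ubr.
have fS i n : f i (S i.+1 n) <= e / 4.
  have [_ _ [lf pf bf] _ _] := hz i.
  have : f i (S i.+1 n) <= \sum_(0 <= k < n) e / 8 * 2^-1 ^+ k.
    elim: n => [|n IH]; first by rewrite big_geq // linear_form0.
    rewrite big_nat_recr //=.
    have [zj _ _ _ _] := hz (i.+1 + n)%N.
    have h := vsup_le_add (S0 i.+1 n) zj.
    apply: le_trans (pos_form_mono (And3 lf pf bf) h) _.
    rewrite lf.1; apply: lerD => //.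
    apply: le_trans (fz i (i.+1 + n)%N _) _; first by rewrite addSn ltnS leq_addr.
    apply: ler_wpM2l; first by lra.
    by apply: ler_wiXn2l; [lra|lra|exact: leq_addl].
  rewrite -mulr_sumr; have := sum_half_pow_le (R:=R) 0 n; rewrite expr0.
  by move=> h1 h2; apply: le_trans h2 _; nra.
have fs i : f i (s i.+1) <= e / 4.
  have [_ _ [lf pf bf] _ _] := hz i.
  apply/ler_addgt0Pr => d d0; have [N hN] := hs i.+1 d d0.
  have := hN N (leqnn N); have := bf (S i.+1 N - s i.+1); have := fS i N.
  rewrite linear_formB // mul1r => h1 h2 h3.
  have := ler_norm (- (f i (S i.+1 N) - f i (s i.+1))); rewrite normrN; lra.
(* [f i] is at least [e] on [z i], hence on [s i], but at most [e / 4] on [s i.+1]. Convergence of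
   [s] would make consecutive terms closer than [e / 2]. *)
have drop i : 3 / 4 * e <= `|s i - s i.+1|.
  have [_ _ [lf pf bf] fzz [ez _]] := hz i.
  have := bf (s i - s i.+1); rewrite mul1r linear_formB //.
  have := ler_norm (f i (s i) - f i (s i.+1)).
  have := pos_form_mono (And3 lf pf bf) (zs i); have := fs i.
  by rewrite fzz; lra.
have [l hl _] := KB_decr hL kb ss s0.
have [N hN] := hl (e / 4) ltac:(lra).
have := hN N (leqnn N); have := hN N.+1 (leqnSn N); have := drop N.
have -> : s N - s N.+1 = (s N - l) - (s N.+1 - l) by vlin.
by have := ler_normB (s N - l) (s N.+1 - l); lra.
Qed.

(** [dominating_form] is applied to each [z i] divided by [c i]; after summation, linearity moves
    the functional onto the sum of the [z i]. The norm is thus nearly additive on families below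
    multiples of [u]. *)
Lemma norm_sum_interval : KB L -> forall u (e : R), 0 ⊑ u -> 0 < e ->
  exists2 C, 0 <= C & forall (I : Type) (r : seq I) (P : pred I) (c : I -> R) (z : I -> X),
    (forall i, P i -> 0 <= c i) -> (forall i, P i -> 0 ⊑ z i /\ z i ⊑ c i *: u) ->
    \sum_(i <- r | P i) `|z i| <=
      e * (\sum_(i <- r | P i) c i) + C * `|\sum_(i <- r | P i) z i|.
Proof.
move=> kb u e u0 e0; have [f [C [[lf pf bf] hf]]] := dominating_form kb u0 e0.
have C0 : 0 <= `|C| by [].
exists `|C| => // I r P c z c0 zc.
have key i : P i -> `|z i| <= e * c i + f (z i).
  move=> Pi; have [z0 zu] := zc i Pi; have := c0 i Pi.
  rewrite le_eqVlt => /orP[/eqP c1|c1].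
    have -> : z i = 0 by apply: vle_anti z0; rewrite -(scale0r u) c1.
    by rewrite normr0 linear_form0 // -c1 mulr0 addr0.
  have ci0 : 0 <= (c i)^-1 by rewrite invr_ge0 ltW.
  have := hf ((c i)^-1 *: z i).
  have h1 : 0 ⊑ (c i)^-1 *: z i by exact: vscale_ge0.
  have h2 : (c i)^-1 *: z i ⊑ u.
    have := vle_scale ci0 zu; rewrite scalerA mulVf ?scale1r //; exact: lt0r_neq0.
  move=> /(_ h1 h2); rewrite normrZ lf.2 (ger0_norm ci0) => h.
  have : c i * ((c i)^-1 * `|z i|) <= c i * (e + (c i)^-1 * f (z i)) by rewrite ler_pM2l.
  rewrite mulrA mulfV ?mul1r; last exact: lt0r_neq0.
  by rewrite mulrDr mulrA mulfV ?mul1r; [lra|exact: lt0r_neq0].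
apply: le_trans (ler_sum _ key) _.
rewrite big_split /= -mulr_sumr lerD2l -linear_form_sum //.
apply: le_trans (ler_norm _) _; apply: le_trans (bf _) _.
by apply: ler_wpM2r => //; exact: ler_norm.
Qed.

End PositiveForms.

(** * Solid sets and trees of bands *)

Section Star.
Variables (R : realType) (X : completeNormedModType R) (L : vector_lattice X).
Hypothesis hL : lattice_norm L.
Local Notation "x ⊑ y" := (vle L x y) (at level 70).
Local Notation vpos := (vpos L).
Local Notation vinf := (vinf L).
Local Notation vabs := (vabs L).
Ltac vlin := vlin_with R X.

(** The property STAR of the overview. *)
Definition solid_extreme_property := forall A : set X, closed A -> norm_bounded A ->
  solid L A -> convex_set A -> A !=set0 -> extreme_points A !=set0.

Lemma convex_closure (U : set X) : convex_set U -> convex_set (closure U).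
Proof.
move=> cU x y /closure_near hx /closure_near hy t t01; apply/closureP => e e0.
have [x' Ux hx'] := hx e e0; have [y' Uy hy'] := hy e e0.
exists ((1 - t) *: x' + t *: y'); first exact: cU.
have -> : (1 - t) *: x + t *: y - ((1 - t) *: x' + t *: y') =
  (1 - t) *: (x - x') + t *: (y - y') by vlin.
move/andP: t01 => [t0 t1].
apply: le_trans (ler_normD _ _) _; rewrite !normrZ (ger0_norm t0) ger0_norm; last by lra.
by nra.
Qed.

(** If [y] in [U] is close to [z], then the positive and negative parts of [x], each cut at [|y|],
    give an element of [U]; what is cut off lies below [|z - y|]. *)
Lemma solid_closure (U : set X) : solid L U -> solid L (closure U).
Proof.
move=> sU x z /closure_near hz xz; apply/closureP => e e0.
have [y Uy hy] := hz (e / 2) ltac:(lra).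
pose a := vinf (vpos x) (vabs y); pose b := vinf (vpos (- x)) (vabs y).
have ha : 0 ⊑ a by apply: vinf_ge0; [exact: vpos_ge0|exact: vabs_ge0].
have hb : 0 ⊑ b by apply: vinf_ge0; [exact: vpos_ge0|exact: vabs_ge0].
exists (a - b).
  apply: (sU _ _ Uy); apply: vabs_least.
    by apply: (vle_by (vleD (vinf_lbr (vpos x) (vabs y)) hb)); rewrite /a; vlin.
  by apply: (vle_by (vleD (vinf_lbr (vpos (- x)) (vabs y)) ha)); rewrite /b; vlin.
have key w : w ⊑ vabs x -> `|vpos (w - vabs y)| <= e / 2.
  move=> wx; apply: le_trans hy; rewrite -(norm_vabs hL (z - y)).
  apply: (norm_vle hL); first exact: vpos_ge0.
  apply: vpos_least; last exact: vabs_ge0.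
  have h := vabs_subD (L := L) (z - y) y; rewrite subrK in h.
  by apply: (vle_by (vleD (vle_trans wx xz) h)); vlin.
have -> : x - (a - b) = vpos (vpos x - vabs y) - vpos (vpos (- x) - vabs y).
  have e1 : x = vpos x - vpos (- x) by rewrite vposN; vlin.
  by rewrite {1}e1 /a /b /vinf; vlin.
apply: le_trans (ler_normB _ _) _.
have := key _ (vpos_le_vabs x).
have : vpos (- x) ⊑ vabs x by rewrite -vabsN; exact: vpos_le_vabs.
by move=> /key; lra.
Qed.

Lemma norm_vabs_lip x y : `|vabs x - vabs y| <= `|x - y|.
Proof.
apply: hL; apply: vabs_least.
  have h := vabs_subD (L := L) (x - y) y; rewrite subrK in h.
  by apply: (vle_by h); vlin.
have h := vabs_subD (L := L) (y - x) x; rewrite subrK in h.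
by rewrite -(vabsN L (x - y)) (opprB x y); apply: (vle_by h); vlin.
Qed.

Lemma midpoint_convex (A : set X) x y : convex_set A -> A x -> A y -> A (2^-1 *: (x + y)).
Proof.
move=> cA Ax Ay; have := cA x y Ax Ay 2^-1 ltac:(lra).
by have -> : (1 - 2^-1) *: x + 2^-1 *: y = 2^-1 *: (x + y) by vlin.
Qed.

Lemma extreme_shift (A : set X) x h : extreme_points A x -> A (x + h) -> A (x - h) -> h = 0.
Proof.
move=> [_ ex] h1 h2; have := ex _ _ h1 h2 2^-1 ltac:(lra).
have -> : (1 - 2^-1) *: (x + h) + 2^-1 *: (x - h) = x by vlin.
move=> /(_ erefl) [e _]; have -> : h = (x + h) - x by vlin.
by rewrite e subrr.
Qed.

(* An extreme point of the closure of the union of the order intervals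
   [- s_n, s_n] would have modulus above every s_n, hence equal to their limit. *)
Lemma solid_extreme_KB : solid_extreme_property -> KB L.
Proof.
move=> star s0 inc0 [M0 hM0].
pose s n := s0 n - s0 0%N.
have inc n : s n ⊑ s n.+1 by apply: (vle_by (inc0 n)); rewrite /s; vlin.
have sp n : 0 ⊑ s n by apply: vsub_ge0; exact: incr_le.
have hM n : `|s n| <= M0 + M0.
  by apply: le_trans (ler_normB _ _) _; apply: lerD.
suff [l hl] : exists l, seqlim s l.
  exists (l + s0 0%N); have := seqlimD hl (seqlim_cst (s0 0%N)).
  by under eq_fun do rewrite /s subrK.
pose U := [set x | exists n, vabs x ⊑ s n].
have bU x : U x -> `|x| <= M0 + M0.
  by move=> [n hn]; apply: le_trans (hM n); exact: (norm_vabs_le hL).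
have sU : solid L U by move=> x z [n hn] xz; exists n; exact: vle_trans xz hn.
have cU : convex_set U.
  move=> x y [n hn] [m hm] t /andP[t0 t1]; exists (maxn n m).
  have hn' := vle_trans hn (incr_le inc (leq_maxl n m)).
  have hm' := vle_trans hm (incr_le inc (leq_maxr n m)).
  have t1' : 0 <= 1 - t by lra.
  apply: vle_trans (vabs_subD _ _) _; rewrite !vabsZ (ger0_norm t0) (ger0_norm t1').
  by apply: (vle_by (vleD (vle_scale t1' hn') (vle_scale t0 hm'))); vlin.
have [|||||x xe] := star (closure U).
- exact: closed_closure.
- exists (M0 + M0) => x /closure_near h; apply/ler_addgt0Pr => e e0.
  have [y Uy hy] := h e e0; have := bU y Uy.
  by have := ler_normD (x - y) y; rewrite subrK; lra.
- exact: solid_closure.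
- exact: convex_closure.
- by exists 0; apply: subset_closure; exists 0%N; rewrite vabs_id; [exact: sp|exact: vlexx].
have [/closure_near hx _] := xe.
have sx n : s n ⊑ vabs x.
  pose h := vpos (s n - vabs x).
  have h0 : 0 ⊑ h by exact: vpos_ge0.
  (* [|x| + h] is the supremum of [|x|] and [s n], which is approximated by suprema of [s n] with
     [|y|] for [y] in [U]. *)
  have sup_in : closure U (vabs x + h).
    apply/closureP => e e0; have [y [m hm] hy] := hx e e0.
    exists (vsup L (s n) (vabs y)).
      exists (maxn n m); rewrite vabs_id; last by apply: vle_trans (sp n) _; exact: vsup_ubl.
      apply: vsup_least; first by apply: incr_le => //; exact: leq_maxl.
      by apply: vle_trans hm _; apply: incr_le => //; exact: leq_maxr.
    apply: le_trans hy; apply: le_trans (norm_vabs_lip x y).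
    have -> : vabs x + h = vsup L (vabs x) (s n).
      by rewrite /h vsupE -(opprB (vabs x)) vposN; vlin.
    rewrite [vsup L (s n) _](_ : _ = vsup L (vabs y) (s n)); last first.
      by apply: vle_anti; apply: vsup_least; (exact: vsup_ubl || exact: vsup_ubr).
    rewrite !vsupE.
    have -> : s n + vpos (vabs x - s n) - (s n + vpos (vabs y - s n)) =
       vpos (vabs x - s n) - vpos (vabs y - s n) by vlin.
    apply: le_trans (norm_vpos_lip hL _ _) _.
    by have -> : vabs x - s n - (vabs y - s n) = vabs x - vabs y by vlin.
  have sC := solid_closure sU.
  have le_sup k : vabs k ⊑ vabs x + h -> closure U k.
    by move=> hk; apply: (sC _ _ sup_in); rewrite [vabs (vabs x + h)]vabs_id //; apply: vaddr_ge0 => //; exact: vabs_ge0.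
  have e : h = 0.
    apply: (extreme_shift xe); apply: le_sup; apply: vle_trans (vabs_subD _ _) _.
      by rewrite (vabs_id h0); exact: vlexx.
    by rewrite vabsN (vabs_id h0); exact: vlexx.
  by have := vpos_ge (L := L) (s n - vabs x); rewrite -/h e => h1; apply: (vle_by h1); vlin.
exists (vabs x) => e e0; have [y [m hm] hy] := hx e e0.
exists m => n mn; apply: le_trans hy; apply: le_trans (norm_vabs_lip x y); rewrite distrC.
apply: (norm_vle hL); first exact: vsub_ge0.
by apply: (vle_by (vle_trans hm (incr_le inc mn))); vlin.
Qed.
End Star.

(** * Successive minimization of convex functionals *)

Section Minimization.
Variables (R : realType) (V : Type) (mid : V -> V -> V) (B : set V).
Variable p : nat -> V -> R.
Hypothesis p_ge0 : forall j v, B v -> 0 <= p j v.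
Hypothesis p_bnd : forall j, exists M, forall v, B v -> p j v <= M.

(** [m] is the limit of the increasing infima of [p j] over the shrinking sets [D N]. *)
Lemma minimize_step (j : nat) (D : nat -> set V) :
  (forall N, D N `<=` B) -> (forall N, D N.+1 `<=` D N) -> (forall N, D N !=set0) ->
  exists m : R, (forall N, exists2 v, D N v & p j v <= m + 2^-1 ^+ N) /\ (forall e, 0 < e -> exists N, forall v, D N v -> m - e <= p j v).
Proof.
move=> DB dec ne; have [M hM] := p_bnd j.
pose I N := [set p j v | v in D N].
have hI N : has_inf (I N).
  split; first by have [v Dv] := ne N; exists (p j v); exists v.
  by exists 0 => _ [v Dv <-]; apply: p_ge0; exact: DB Dv.
pose S := range (fun N => inf (I N)).
have hS : has_sup S.
  split; first by exists (inf (I 0%N)); exists 0%N.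
  exists M => _ [N _ <-]; have [v Dv] := ne N.
  by apply: le_trans (hM v (DB _ _ Dv)); apply: ge_inf; [case: (hI N)|exists v].
exists (sup S); split=> [N|e e0].
  have [_ [v Dv <-] hv] := inf_adherent (half_pow_gt0 N) (hI N).
  exists v => //; apply: le_trans (ltW hv) _; rewrite lerD2r.
  by apply: sup_upper_bound => //; exists N.
have [_ [N _ <-] hN] := sup_adherent e0 hS.
exists N => v Dv; apply: le_trans (ltW hN) _.
by apply: ge_inf; [case: (hI N)|exists v].
Qed.

(* The functionals p_j are minimized one after the other, each on the
   near-minimizers of the previous ones. *)
Lemma lexicographic_minimization (D : nat -> set V) :
  (forall N, D N `<=` B) -> (forall N, D N.+1 `<=` D N) -> (forall N, D N !=set0) ->
  (forall N a b, D N a -> D N b -> D N (mid a b)) ->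
  (forall j a b, B a -> B b -> p j (mid a b) <= 2^-1 * (p j a + p j b)) ->
  exists2 d : nat -> V, forall N, D N (d N) &
  forall j (e : R), 0 < e -> exists N0, forall N M, (N0 <= N)%N -> (N0 <= M)%N ->
    `|p j (d N) - p j (d M)| <= e /\ 2^-1 * (p j (d N) + p j (d M)) - p j (mid (d N) (d M)) <= e.
Proof.
move=> DB dec ne mD mp.
pose good (D : nat -> set V) := [/\ forall N, D N `<=` B, forall N, D N.+1 `<=` D N,
  forall N, D N !=set0 & forall N a b, D N a -> D N b -> D N (mid a b)].
have step (j : nat) (E : {E | good E}) : {E' : {E | good E} | exists m : R,
    [/\ forall N, sval E' N `<=` sval E N,
        forall N v, sval E' N v -> p j v <= m + 2^-1 ^+ N &
        forall e, 0 < e -> exists N, forall v, sval E N v -> m - e <= p j v]}.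
  apply: cid; case: E => E [EB Edec Ene Emid] /=.
  have [m [h1 h2]] := minimize_step j EB Edec Ene.
  pose E' N := [set v | E N v /\ p j v <= m + 2^-1 ^+ N].
  have gE' : good E'.
    split.
    - by move=> N v [Ev _]; exact: EB Ev.
    - move=> N v [Ev hv]; split; first exact: Edec.
      by apply: le_trans hv _; rewrite lerD2l exprS; have := half_pow_gt0 (R:=R) N; lra.
    - by move=> N; have [v Ev hv] := h1 N; exists v.
    - move=> N a b [Ea ha] [Eb hb]; split; first exact: Emid.
      by have := mp j a b (EB _ _ Ea) (EB _ _ Eb); lra.
  exists (exist _ E' gE'); exists m; split => //= N v; by case.
pose fix E (n : nat) : {E | good E} :=
  if n is k.+1 then sval (step k (E k)) else exist _ D (And4 DB dec ne mD).
have EdecN n N M : (N <= M)%N -> sval (E n) M `<=` sval (E n) N.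
  move=> /subnK <-; elim: (M - N)%N => [|k IH] //=.
  by apply: subset_trans IH; have [_ h _ _] := svalP (E n); exact: h.
have Edecn n m N : (n <= m)%N -> sval (E m) N `<=` sval (E n) N.
  move=> /subnK <-; elim: (m - n)%N => [|k IH] //=.
  by apply: subset_trans IH; have [q [h _ _]] := svalP (step (k + n)%N (E (k + n)%N)); exact: h.
(* Diagonal choice: the [N]-th point lies in every refinement of index at most [N]. For large [N]
   and [M] the midpoint also stays in the [j]-th refinement, so its value cannot drop below the
   limiting infimum, and this bounds the defect. *)
have dex N : {v | sval (E N) N v} by apply: cid; have [_ _ h _] := svalP (E N); have [v hv] := h N; exists v.
exists (fun N => sval (dex N)) => [N|j e e0].
  exact: (Edecn 0%N N N (leq0n N) _ (svalP (dex N))).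
have [m [h1 h2 h3]] := svalP (step j (E j)).
have e2 : 0 < e / 2 by lra.
have [N1 hN1] := h3 _ e2; have [N2 hN2] := half_pow_small 1 e2.
exists (maxn j.+1 (maxn N1 N2)) => N M; rewrite !geq_max => /and3P[jN N1N N2N] /and3P[jM N1M N2M].
have up K : (j < K)%N -> p j (sval (dex K)) <= m + 2^-1 ^+ K.
  by move=> jK; apply: h2; exact: (Edecn j.+1 K K jK _ (svalP (dex K))).
have inE K : (j < K)%N -> (N1 <= K)%N -> sval (E j) N1 (sval (dex K)).
  move=> jK N1K; apply: (EdecN j N1 K N1K); exact: (Edecn j K K (ltnW jK) _ (svalP (dex K))).
have a1 := up N jN; have a2 := up M jM.
have b1 := hN1 _ (inE N jN N1N); have b2 := hN1 _ (inE M jM N1M).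
have c1 := hN2 N N2N; have c2 := hN2 M N2M.
have mi : sval (E j) N1 (mid (sval (dex N)) (sval (dex M))).
  by have [_ _ _ h] := svalP (E j); apply: h; exact: inE.
have b3 := hN1 _ mi.
split; last by lra.
by rewrite ler_norml; apply/andP; split; lra.
Qed.
End Minimization.

Section Words.
Variables (A : Type) (step : seq nat -> A -> nat -> A).

(** Value at the end of a path in a tree, where [step] computes the value at a child from its
    parent. The recursion consumes the word from the front and remembers the prefix [w0], so that
    [word_rec_rcons] gives the equation between a node and its child. *)
Fixpoint word_rec (w0 : seq nat) (z : A) (w : seq nat) : A :=
  if w is i :: w' then word_rec (rcons w0 i) (step w0 z i) w' else z.

Lemma word_rec_rcons w0 z w i :
  word_rec w0 z (rcons w i) = step (w0 ++ w) (word_rec w0 z w) i.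
Proof.
elim: w w0 z => [|k w IH] w0 z /=; first by rewrite cats0.
by rewrite IH cat_rcons.
Qed.
End Words.

(** * Closed ideals generated by a positive vector *)

Section Bands.
Variables (R : realType) (X : completeNormedModType R) (L : vector_lattice X).
Hypothesis hL : lattice_norm L.
Local Notation "x ⊑ y" := (vle L x y) (at level 70).
Local Notation vpos := (vpos L).
Local Notation vinf := (vinf L).
Local Notation vabs := (vabs L).
Ltac vlin := vlin_with R X.

(* Membership of [b >= 0] in the closed ideal generated by [v >= 0]. *)
Definition band (v b : X) := forall e : R, 0 < e ->
  exists N : nat, `|vpos (b - N%:R *: v)| <= e.

Lemma band_le v b c : c ⊑ b -> band v b -> band v c.
Proof.
move=> cb h e e0; have [N hN] := h e e0; exists N; apply: le_trans hN.
apply: (norm_vle hL (vpos_ge0 _)); apply: vpos_mono; exact: vle_add.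
Qed.

Lemma band_mono v v' b : v ⊑ v' -> band v b -> band v' b.
Proof.
move=> vv h e e0; have [N hN] := h e e0; exists N; apply: le_trans hN.
apply: (norm_vle hL (vpos_ge0 _)); apply: vpos_mono.
by apply: (vle_by (vle_scale (ler0n R N) vv)); vlin.
Qed.

Lemma band_refl v : band v v.
Proof. by move=> e e0; exists 1%N; rewrite scale1r subrr vpos_id ?normr0; [exact: ltW|exact: vlexx]. Qed.

Lemma band0 v : band v 0.
Proof. by move=> e e0; exists 0%N; rewrite scale0r subrr vpos_id ?normr0; [exact: ltW|exact: vlexx]. Qed.

Lemma bandD v b c : 0 ⊑ v -> band v b -> band v c -> band v (b + c).
Proof.
move=> v0 hb hc e e0; have [N hN] := hb (e / 2) ltac:(lra); have [M hM] := hc (e / 2) ltac:(lra).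
exists (N + M)%N.
apply: le_trans (_ : `|vpos (b - N%:R *: v) + vpos (c - M%:R *: v)| <= _).
  apply: (norm_vle hL (vpos_ge0 _)).
  have -> : b + c - (N + M)%:R *: v = (b - N%:R *: v) + (c - M%:R *: v).
    by rewrite natrD; vlin.
  exact: vpos_subD.
by apply: le_trans (ler_normD _ _) _; lra.
Qed.

Lemma bandZ v b (a : R) : 0 <= a -> 0 ⊑ v -> band v b -> band v (a *: b).
Proof.
move=> a0 v0 hb e e0.
have [N hN] := hb (e / (a + 1)) ltac:(apply: divr_gt0 => //; lra).
pose K := Num.bound (a * N%:R); exists K.
have hK : a * N%:R <= K%:R.
  have := archi_boundP (_ : 0 <= a * N%:R); rewrite mulr_ge0 // => /(_ isT).
  by move=> /ltW.
apply: le_trans (_ : `|a *: vpos (b - N%:R *: v)| <= _).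
  apply: (norm_vle hL (vpos_ge0 _)); rewrite -vposZ //; apply: vpos_mono.
  by apply: (vle_by (vscale_le hK v0)); vlin.
rewrite normrZ ger0_norm //.
apply: le_trans (_ : a * (e / (a + 1)) <= _); first exact: ler_wpM2l.
rewrite mulrA ler_pdivrMr; last by lra.
nra.
Qed.

Lemma band_lim v u l : seqlim u l -> (forall n, band v (u n)) -> band v l.
Proof.
move=> hl hu e e0; have [N hN] := hl (e / 2) ltac:(lra).
have [K hK] := hu N (e / 2) ltac:(lra); exists K.
have -> : vpos (l - K%:R *: v) = vpos (u N - K%:R *: v) - (vpos (u N - K%:R *: v) - vpos (l - K%:R *: v)) by vlin.
apply: le_trans (ler_normB _ _) _.
have := norm_vpos_lip hL (u N - K%:R *: v) (l - K%:R *: v).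
have -> : u N - K%:R *: v - (l - K%:R *: v) = u N - l by vlin.
by have := hN N (leqnn N); lra.
Qed.

(** The infimum of [x] and [u] is at most that of [N v] and [u] plus [(x - N v)^+], and the last
    term tends to 0. *)
Lemma band_small v x u (d : R) : 0 ⊑ v -> 0 ⊑ x -> 0 ⊑ u ->
  (forall N : nat, `|vinf (N%:R *: v) u| <= d) -> band v x -> `|vinf x u| <= d.
Proof.
move=> v0 x0 u0 hd hb; apply/ler_addgt0Pr => e e0; have [N hN] := hb e e0.
apply: le_trans (_ : `|vinf (N%:R *: v) u + vpos (x - N%:R *: v)| <= _); last first.
  by apply: le_trans (ler_normD _ _) _; apply: lerD.
apply: (norm_vle hL); first exact: vinf_ge0.
apply: (@vle_by _ _ _ _ _ (vinf x u - vpos (x - N%:R *: v)) (vinf (N%:R *: v) u)); last by vlin.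
apply: vinf_greatest.
  by apply: (vle_by (vleD (vinf_lbl x u) (vpos_ge (x - N%:R *: v)))); vlin.
by apply: (vle_by (vleD (vinf_lbr x u) (vpos_ge0 (x - N%:R *: v)))); vlin.
Qed.

(** Disjointness from [u] passes to the multiples [N u], so [x] equals [(x - N u)^+], whose norm is
    small for some [N]. *)
Lemma band_disjoint_eq0 u x : 0 ⊑ u -> 0 ⊑ x -> vinf x u = 0 -> band u x -> x = 0.
Proof.
move=> u0 x0 xu hb; apply: norm_eq0_small => e e0; have [N hN] := hb e e0.
apply: le_trans hN; apply: (norm_vle hL) => //.
have h : vinf x (N%:R *: u) ⊑ 0.
  have N1 : 0 <= N%:R + 1 :> R by have := ler0n R N; lra.
  rewrite -(scaler0 _ (N%:R + 1)) -xu -vinfZ //; apply: vinf_mono.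
    by rewrite -{1}(scale1r x); apply: vscale_le => //; have := ler0n R N; lra.
  by apply: vscale_le => //; lra.
by have := vinf_split (L := L) x (N%:R *: u) => {1}<-; apply: (vle_by h); vlin.
Qed.
End Bands.

(** * Solid convex sets of vectors that disintegrate along a tree *)

Section TreeSets.
Variables (R : realType) (X : completeNormedModType R) (L : vector_lattice X).
Hypothesis hL : lattice_norm L.
Local Notation "x ⊑ y" := (vle L x y) (at level 70).
Local Notation vpos := (vpos L).
Local Notation vinf := (vinf L).
Local Notation vabs := (vabs L).
Local Notation band := (band L).
Ltac vlin := vlin_with R X.

(* Nodes are words; a node of depth n has [m n] children.  [b] is a positive
   vector measure on the boundary of the tree, dominated in norm by the scalar
   measure [lam] of total mass at most [M], and localized by the bands of [v]. *)
Record tree (m : nat -> nat) (v : seq nat -> X) (M : R)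
    (b : seq nat -> X) (lam : seq nat -> R) : Prop := Tree {
  tree_ge0 : forall w, 0 ⊑ b w;
  tree_band : forall w, band (v w) (b w);
  tree_sum : forall w, b w = \sum_(i < m (size w)) b (rcons w i);
  tree_out : forall w i, (m (size w) <= i)%N -> b (rcons w i) = 0;
  tree_norm : forall w, `|b w| <= lam w;
  tree_lam : forall w, lam w = \sum_(i < m (size w)) lam (rcons w i);
  tree_lam_out : forall w i, (m (size w) <= i)%N -> lam (rcons w i) = 0;
  tree_mass : lam [::] <= M }.

Definition tree_set m v M : set X :=
  [set x | exists b lam, tree m v M b lam /\ b [::] = vabs x].

Lemma tree_lam_ge0 m v M b lam w : tree m v M b lam -> 0 <= lam w.
Proof. by move=> h; apply: le_trans (tree_norm h w). Qed.

Lemma tree_le_root m v M b lam w : tree m v M b lam -> b w ⊑ b [::].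
Proof.
move=> h; elim/last_ind: w => [|w i IH]; first exact: vlexx.
apply: vle_trans IH; have [mi|im] := leqP (m (size w)) i.
  by rewrite (tree_out h) //; exact: (tree_ge0 h).
rewrite (tree_sum h w) (bigD1 (Ordinal im)) //=.
apply: (@vle_by _ _ _ _ _ 0 (\sum_(j < m (size w) | j != Ordinal im) b (rcons w j))); last by vlin.
by apply: vsum_ge0 => j _; exact: (tree_ge0 h).
Qed.

Lemma tree_lam_le m v M b lam w : tree m v M b lam -> lam w <= M.
Proof.
move=> h; apply: le_trans (tree_mass h).
elim/last_ind: w => // w i IH; apply: le_trans IH.
have [mi|im] := leqP (m (size w)) i.
  by rewrite (tree_lam_out h) //; exact: (tree_lam_ge0 w h).
rewrite (tree_lam h w) (bigD1 (Ordinal im)) //= lerDl.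
by apply: sumr_ge0 => j _; exact: (tree_lam_ge0 _ h).
Qed.

Section Operations.
Variables (m : nat -> nat) (v : seq nat -> X) (M : R).
Hypothesis v0 : forall w, 0 ⊑ v w.

Lemma treeD b lam b' lam' (s t : R) : 0 <= s -> 0 <= t -> s + t = 1 ->
  tree m v M b lam -> tree m v M b' lam' ->
  tree m v M (fun w => s *: b w + t *: b' w) (fun w => s * lam w + t * lam' w).
Proof.
move=> s0 t0 st h h'; split.
- by move=> w; apply: vaddr_ge0; apply: vscale_ge0 => //; [exact: (tree_ge0 h)|exact: (tree_ge0 h')].
- move=> w; apply: bandD => //; apply: bandZ => //; [exact: (tree_band h)|exact: (tree_band h')].
- by move=> w; rewrite (tree_sum h w) (tree_sum h' w) !scaler_sumr -big_split.
- by move=> w i mi; rewrite (tree_out h) // (tree_out h') // !scaler0 addr0.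
- move=> w; apply: le_trans (ler_normD _ _) _; rewrite !normrZ (ger0_norm s0) (ger0_norm t0).
  by apply: lerD; apply: ler_wpM2l => //; [exact: (tree_norm h)|exact: (tree_norm h')].
- by move=> w; rewrite (tree_lam h w) (tree_lam h' w) !mulr_sumr -big_split.
- by move=> w i mi; rewrite (tree_lam_out h) // (tree_lam_out h') // !mulr0 addr0.
- have := tree_mass h; have := tree_mass h'; nra.
Qed.

(** Distributes [z] over the tree: the value at each node is shared among its children by the Riesz
    decomposition relative to [b]. *)
Definition tree_cut (b : seq nat -> X) : seq nat -> X -> seq nat -> X :=
  word_rec (fun w z i => if (i < m (size w))%N then riesz_part L z (fun j => b (rcons w j)) i else 0).

Lemma tree_cut_rcons b w0 z w i : tree_cut b w0 z (rcons w i) =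
  if (i < m (size (w0 ++ w)))%N
  then riesz_part L (tree_cut b w0 z w) (fun j => b (rcons (w0 ++ w) j)) i else 0.
Proof. exact: word_rec_rcons. Qed.

(** The cut stays below [b] at every node, so bands and norm bounds are inherited with the same
    scalar measure. *)
Lemma tree_restrict b lam z : tree m v M b lam -> 0 ⊑ z -> z ⊑ b [::] ->
  tree m v M (tree_cut b [::] z) lam.
Proof.
move=> h z0 zb; set c := tree_cut b [::] z.
have cE w i : c (rcons w i) = if (i < m (size w))%N
  then riesz_part L (c w) (fun j => b (rcons w j)) i else 0 by exact: tree_cut_rcons.
have cb w : 0 ⊑ c w /\ c w ⊑ b w.
  elim/last_ind: w => // w i [c0 cb]; rewrite cE.
  case: ifP => _; last by split; [exact: vlexx|exact: (tree_ge0 h)].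
  by split; [apply: riesz_part_ge0 => //; exact: (tree_ge0 h)|exact: riesz_part_le].
split.
- by move=> w; exact: (cb w).1.
- by move=> w; exact: (band_le hL (cb w).2 (tree_band h w)).
- move=> w; under eq_bigr do rewrite cE ltn_ord.
  rewrite riesz_sum //; last exact: (cb w).1.
    by move=> i _; exact: (tree_ge0 h).
  by rewrite -(tree_sum h); exact: (cb w).2.
- by move=> w i mi; rewrite cE ltnNge mi.
- by move=> w; apply: le_trans (tree_norm h w); apply: (norm_vle hL); [exact: (cb w).1|exact: (cb w).2].
- exact: (tree_lam h).
- exact: (tree_lam_out h).
- exact: (tree_mass h).
Qed.

(** Any tree whose root majorizes [|x|] will do, since it can be cut down to [|x|]. Solidity and
    convexity follow. *)
Lemma tree_set_mem b lam x : tree m v M b lam -> vabs x ⊑ b [::] -> tree_set m v M x.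
Proof.
by move=> h xb; exists (tree_cut b [::] (vabs x)), lam; split=> //; apply: tree_restrict => //; exact: vabs_ge0.
Qed.

Lemma tree_set_solid : solid L (tree_set m v M).
Proof.
by move=> x z [b [lam [h e]]] xz; apply: (tree_set_mem h); rewrite e.
Qed.

Lemma tree_set_bounded : norm_bounded (tree_set m v M).
Proof.
exists M => x [b [lam [h e]]]; rewrite -(norm_vabs hL) -e.
exact: le_trans (tree_norm h _) (tree_mass h).
Qed.

Lemma tree_set_convex : convex_set (tree_set m v M).
Proof.
move=> x y [b [lam [h e]]] [b' [lam' [h' e']]] t /andP[t0 t1].
have s0 : 0 <= 1 - t by lra.
apply: (tree_set_mem (treeD s0 t0 ltac:(lra) h h')) => /=.
rewrite e e'; apply: vle_trans (vabs_subD _ _) _.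
by rewrite !vabsZ (ger0_norm t0) (ger0_norm s0); exact: vlexx.
Qed.

End Operations.

Lemma tree_scale m v M b lam (a : R) : 0 <= a -> (forall w, 0 ⊑ v w) -> tree m v M b lam ->
  tree m v (a * M) (fun w => a *: b w) (fun w => a * lam w).
Proof.
move=> a0 v0 h; split.
- by move=> w; apply: vscale_ge0 => //; exact: (tree_ge0 h).
- by move=> w; apply: bandZ => //; exact: (tree_band h).
- by move=> w; rewrite (tree_sum h w) scaler_sumr.
- by move=> w i mi; rewrite (tree_out h) // scaler0.
- by move=> w; rewrite normrZ (ger0_norm a0); apply: ler_wpM2l => //; exact: (tree_norm h).
- by move=> w; rewrite (tree_lam h w) mulr_sumr.
- by move=> w i mi; rewrite (tree_lam_out h) // mulr0.
- by apply: ler_wpM2l => //; exact: (tree_mass h).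
Qed.

Definition child (v : seq nat -> X) (i : nat) : seq nat -> X := fun w => v (i :: w).

Lemma tree_branch m v M b lam i0 : tree m v M b lam ->
  tree (fun n => m n.+1) (child v i0) (lam [:: i0]) (fun w => b (i0 :: w)) (fun w => lam (i0 :: w)).
Proof.
move=> h; split => //.
- by move=> w; exact: (tree_ge0 h).
- by move=> w; exact: (tree_band h).
- by move=> w; rewrite (tree_sum h).
- by move=> w i mi; rewrite -rcons_cons (tree_out h).
- by move=> w; exact: (tree_norm h).
- by move=> w; rewrite (tree_lam h).
- by move=> w i mi; rewrite -rcons_cons (tree_lam_out h).
Qed.

(** Together with [tree_branch] this divides a tree at the root into two, whose masses add up to
    [lam [::]]; the masses are the weights of the convex combination in [tree_set_extreme_child]. *)
Lemma tree_rest m v M b lam i0 : tree m v M b lam -> (i0 < m 0)%N ->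
  tree m v (lam [::] - lam [:: i0])
   (fun w => if w is i :: w' then if i == i0 then 0 else b w else b [::] - b [:: i0])
   (fun w => if w is i :: w' then if i == i0 then 0 else lam w else lam [::] - lam [:: i0]).
Proof.
move=> h i0m.
have s1 : b [::] - b [:: i0] = \sum_(i < m 0 | i != Ordinal i0m) b [:: val i].
  by rewrite (tree_sum h) (bigD1 (Ordinal i0m)) //=; vlin.
have s2 : lam [::] - lam [:: i0] = \sum_(i < m 0 | i != Ordinal i0m) lam [:: val i].
  by rewrite (tree_lam h) (bigD1 (Ordinal i0m)) //=; ring.
have ne (i : 'I_(m 0)) : (i != Ordinal i0m) = ~~ (val i == i0) by [].
have root0 : b [::] - b [:: i0] ⊑ b [::].
  by apply: (vle_by (tree_ge0 h [:: i0])); vlin.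
split => //.
- case=> [|i w]; last by case: ifP => _; [exact: vlexx|exact: (tree_ge0 h)].
  by rewrite s1; apply: vsum_ge0 => i _; exact: (tree_ge0 h).
- case=> [|i w]; first exact: (band_le hL root0 (tree_band h _)).
  by case: ifP => _; [exact: band0|exact: (tree_band h)].
- case=> [|i w] /=.
    rewrite s1 big_mkcond; apply: eq_bigr => i _; rewrite ne; by case: (val i == i0).
  by case: ifP => _; [rewrite big1|exact: (tree_sum h (i :: w))].
- case=> [|j w] i mi /=; case: ifP => _ //; first exact: (tree_out h (w := [::])).
  exact: (tree_out h (w := j :: w)).
- case=> [|i w]; last by case: ifP => _; [rewrite normr0|exact: (tree_norm h)].
  rewrite s1 s2; apply: le_trans (ler_norm_sum _ _ _) _; apply: ler_sum => i _.
  exact: (tree_norm h).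
- case=> [|i w] /=.
    rewrite s2 big_mkcond; apply: eq_bigr => i _; rewrite ne; by case: (val i == i0).
  by case: ifP => _; [rewrite big1|exact: (tree_lam h (i :: w))].
- case=> [|j w] i mi /=; case: ifP => _ //; first exact: (tree_lam_out h (w := [::])).
  exact: (tree_lam_out h (w := j :: w)).
Qed.

(** Lets elements of the tree set of a child be used as competitors in that of the parent, so that
    extremality passes down. *)
Lemma tree_graft m v M b lam i0 : (i0 < m 0)%N -> v [:: i0] ⊑ v [::] ->
  tree (fun n => m n.+1) (child v i0) M b lam ->
  tree m v M (fun w => if w is i :: w' then if i == i0 then b w' else 0 else b [::])
   (fun w => if w is i :: w' then if i == i0 then lam w' else 0 else lam [::]).
Proof.
move=> i0m vv h; split.
- by case=> [|i w]; [|case: ifP => _; [|exact: vlexx]]; exact: (tree_ge0 h).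
- case=> [|i w]; first exact: (band_mono hL vv (tree_band h [::])).
  by case: ifP => [/eqP->|_]; [exact: (tree_band h w)|exact: band0].
- case=> [|i w] /=.
    rewrite (bigD1 (Ordinal i0m)) //= eqxx big1 ?addr0 // => i ne.
    by rewrite ifN //; apply: contra ne => /eqP e; apply/eqP/val_inj.
  by case: ifP => _; [rewrite (tree_sum h)|rewrite big1].
- case=> [|j w] i mi /=.
    by rewrite ifN //; apply/eqP => e; move: mi; rewrite e leqNgt i0m.
  by case: ifP => _ //; exact: (tree_out h).
- by case=> [|i w]; [|case: ifP => _; [|by rewrite normr0]]; exact: (tree_norm h).
- case=> [|i w] /=.
    rewrite (bigD1 (Ordinal i0m)) //= eqxx big1 ?addr0 // => i ne.
    by rewrite ifN //; apply: contra ne => /eqP e; apply/eqP/val_inj.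
  by case: ifP => _; [rewrite (tree_lam h)|rewrite big1].
- case=> [|j w] i mi /=.
    by rewrite ifN //; apply/eqP => e; move: mi; rewrite e leqNgt i0m.
  by case: ifP => _ //; exact: (tree_lam_out h).
- exact: (tree_mass h).
Qed.

Lemma tree_weaken m v M M' b lam : M <= M' -> tree m v M b lam -> tree m v M' b lam.
Proof. by move=> MM [*]; split => //; exact: le_trans MM. Qed.

(** [x] is a sum of parts [y i] carried by the children. For a nonzero [y i0] and [t] the share of
    its branch in the scalar mass, [x] is the combination with weights [t] and [1 - t] of
    [t^-1 y i0] and [(1 - t)^-1 (x - y i0)]. Rescaling restores the mass bound, so both lie in the
    set, and extremality gives [x = t^-1 y i0]. *)
Lemma tree_set_extreme_child m v M x :
  (forall w, 0 ⊑ v w) -> (forall w i, v (rcons w i) ⊑ v w) -> x != 0 ->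
  extreme_points (tree_set m v M) x ->
  exists2 i, (i < m 0)%N & extreme_points (tree_set (fun n => m n.+1) (child v i) M) x.
Proof.
move=> v0 vdec xn0 [[b [lam [h e]]] ext].
suff [i im hi] : exists2 i, (i < m 0)%N & tree_set (fun n => m n.+1) (child v i) M x.
  exists i => //; split=> // x0 x1 A0 A1 t t01 ex; apply: (ext x0 x1) t t01 ex.
    have [b0 [lam0 [h0 e0]]] := A0.
    by apply: (tree_set_mem (tree_graft im (vdec [::] i) h0)); rewrite e0; exact: vlexx.
  have [b1 [lam1 [h1 e1]]] := A1.
  by apply: (tree_set_mem (tree_graft im (vdec [::] i) h1)); rewrite e1; exact: vlexx.
pose p i := riesz_part L (vpos x) (fun j => b [:: j]) i.
have p0 i : 0 ⊑ p i by apply: riesz_part_ge0; [exact: vpos_ge0|exact: (tree_ge0 h)].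
have pb i : p i ⊑ b [:: i] by exact: riesz_part_le.
have sb : b [::] = \sum_(i < m 0) b [:: val i] by rewrite (tree_sum h).
have sp : \sum_(i < m 0) p i = vpos x.
  rewrite riesz_sum //; last exact: vpos_ge0.
    by move=> i _; exact: (tree_ge0 h).
  by rewrite -sb e; exact: vpos_le_vabs.
(* The identity [x = 2 x^+ - |x|] is split along the children. *)
pose y i := 2 *: p i - b [:: i].
have yb i : vabs (y i) ⊑ b [:: i].
  apply: vabs_least; first by apply: (vle_by (vle_scale (ler0n R 2) (pb i))); rewrite /y; vlin.
  by apply: (vle_by (vle_scale (ler0n R 2) (p0 i))); rewrite /y; vlin.
have sy : \sum_(i < m 0) y i = x.
  by rewrite big_split /= -scaler_sumr sp sumrN -sb e vabsE vposN; vlin.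
have [i0 hi0] : exists i0 : 'I_(m 0), y i0 != 0.
  apply: contrapT => no; move/eqP: xn0; apply; rewrite -sy; apply: big1 => i _.
  by apply/eqP; apply: contrapT => yi; apply: no; exists i; apply/negP.
have l0 : 0 < lam [:: val i0].
  apply: lt_le_trans (tree_norm h _); rewrite normr_gt0; apply: contra hi0 => /eqP bi.
  have := yb i0; rewrite bi => yi.
  apply/eqP; apply: norm_eq0_small => d d0; apply: le_trans (norm_vabs_le hL yi) _.
  by rewrite normr0 ltW.
have lr : lam [:: val i0] <= lam [::].
  by have := tree_lam_ge0 [::] (tree_rest h (ltn_ord i0)) => /=; lra.
pose t := lam [:: val i0] / lam [::].
have t0 : 0 < t by apply: divr_gt0 => //; lra.
have lt : lam [:: val i0] = t * lam [::] by rewrite /t divfK //; apply: lt0r_neq0; lra.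
have ti : 0 <= t^-1 by rewrite invr_ge0 ltW.
have h1 : tree (fun n => m n.+1) (child v i0) M (fun w => t^-1 *: b (val i0 :: w)) (fun w => t^-1 * lam (val i0 :: w)).
  apply: (tree_weaken _ (tree_scale ti (fun w => v0 _) (tree_branch i0 h))).
  by rewrite lt mulrA mulVf ?mul1r; [exact: (tree_mass h)|exact: lt0r_neq0].
have y1 : tree_set (fun n => m n.+1) (child v i0) M (t^-1 *: y i0).
  by apply: (tree_set_mem h1); rewrite vabsZ (ger0_norm ti); apply: vle_scale.
exists i0 => //.
have restx : vabs (x - y i0) ⊑ b [::] - b [:: val i0].
  rewrite -sy sb (bigD1 i0) //= [X in _ ⊑ X - _](bigD1 i0) //=.
  have -> : y i0 + \sum_(i < m 0 | i != i0) y i - y i0 = \sum_(i < m 0 | i != i0) y i by vlin.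
  have -> : b [:: val i0] + \sum_(i < m 0 | i != i0) b [:: val i] - b [:: val i0] =
     \sum_(i < m 0 | i != i0) b [:: val i] by vlin.
  apply: (big_ind2 (fun x y => vabs x ⊑ y)) => //.
    by rewrite vabs_id; exact: vlexx.
  by move=> x1 x2 y1' y2 hx hy; apply: vle_trans (vabs_subD _ _) _; exact: vleD.
have hr := tree_rest h (ltn_ord i0).
have [t1|t1] := eqVneq t 1.
  have e0 : x - y i0 = 0.
    apply: norm_eq0_small => d d0; apply: le_trans (norm_vabs_le hL restx) _.
    have := tree_norm hr [::] => /=; rewrite lt t1; lra.
  have -> : x = t^-1 *: y i0.
    by rewrite t1 invr1 scale1r -[LHS](subrK (y i0)) e0 add0r.
  exact: y1.
have t1' : t < 1.
  rewrite lt_neqAle t1 /= /t ler_pdivrMr ?mul1r //; lra.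
have si : 0 <= (1 - t)^-1 by rewrite invr_ge0; lra.
have nt : 1 - t != 0 by rewrite subr_eq0 eq_sym.
have nt0 : t != 0 by exact: lt0r_neq0.
have h2 : tree m v M (fun w => (1 - t)^-1 *:
     (if w is i :: w' then if i == i0 then 0 else b w else b [::] - b [:: val i0]))
   (fun w => (1 - t)^-1 * (if w is i :: w' then if i == i0 then 0 else lam w else lam [::] - lam [:: val i0])).
  apply: (tree_weaken _ (tree_scale si v0 hr)).
  have -> : (1 - t)^-1 * (lam [::] - lam [:: val i0]) = lam [::] by rewrite lt; field.
  exact: (tree_mass h).
have y2 : tree_set m v M ((1 - t)^-1 *: (x - y i0)).
  by apply: (tree_set_mem h2); rewrite vabsZ (ger0_norm si); apply: vle_scale.
have y1' : tree_set m v M (t^-1 *: y i0).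
  have [b1 [lam1 [k1 e1]]] := y1.
  by apply: (tree_set_mem (tree_graft (ltn_ord i0) (vdec [::] i0) k1)); rewrite e1; exact: vlexx.
have [||<- _] := ext _ _ y1' y2 (1 - t); last exact: y1.
  by apply/andP; split; lra.
rewrite !scalerA mulfV //.
have -> : (1 - (1 - t)) * t^-1 = 1 by field.
vlin.
Qed.

Lemma tree_set_no_extreme m v M u a :
  (forall w, 0 ⊑ v w) -> (forall w i, v (rcons w i) ⊑ v w) -> v [::] ⊑ u ->
  (forall w (N : nat), (0 < size w)%N -> `|vinf (N%:R *: v w) u| <= 2^-1 ^+ size w) ->
  tree_set m v M a -> a != 0 -> extreme_points (tree_set m v M) = set0.
Proof.
move=> v0 vdec vu small Aa an0; rewrite -subset0 => x ext /=.
have u0 : 0 ⊑ u by exact: vle_trans (v0 _) vu.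
(* 0 is not extreme, being the midpoint of [a] and [- a]. *)
have [x0|xn0] := eqVneq x 0.
  move/eqP: an0; apply; apply: (extreme_shift ext); rewrite x0.
    by rewrite add0r.
  by rewrite sub0r; apply: (tree_set_solid Aa); rewrite vabsN; exact: vlexx.
have path n : exists2 w, size w = n & extreme_points (tree_set (fun k => m (n + k)%N) (fun s => v (w ++ s)) M) x.
  elim: n => [|n [w sw hw]]; first by exists [::].
  have [||i im hi] := @tree_set_extreme_child _ _ _ _ _ _ xn0 hw.
  - by move=> s; exact: v0.
  - by move=> s i; rewrite -rcons_cat; exact: vdec.
  exists (rcons w i); first by rewrite size_rcons sw.
  move: hi; rewrite /child.
  have -> : (fun n0 => m (n + n0.+1)%N) = (fun k => m (n.+1 + k)%N) by apply/funext => k; rewrite addnS.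
  by have -> : (fun s => v (w ++ i :: s)) = (fun s => v (rcons w i ++ s)) by apply/funext => s; rewrite cat_rcons.
have inband w k : extreme_points (tree_set k (fun s => v (w ++ s)) M) x -> band (v w) (vabs x).
  by move=> [[b [lam [h <-]]] _]; have := tree_band h [::]; rewrite cats0.
have z0 : vinf (vabs x) u = 0.
  apply: norm_eq0_small => e e0; have [N hN] := half_pow_small 1 e0.
  have [w sw hw] := path N.+1; apply: le_trans (hN N.+1 (leqnSn N)); rewrite mul1r -sw.
  apply: (band_small hL (v0 w) (vabs_ge0 x) u0 _ (inband _ _ hw)) => K.
  by apply: small; rewrite sw.
move/eqP: xn0; apply; apply: norm_eq0_small => e e0.
rewrite -(norm_vabs hL) (band_disjoint_eq0 hL u0 (vabs_ge0 x) z0); first by rewrite normr0 ltW.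
by apply: (band_mono hL vu); apply: (inband [::] m); exact: ext.
Qed.

End TreeSets.

(** * Closedness of the tree sets *)

Section TreeClosed.
Variables (R : realType) (X : completeNormedModType R) (L : vector_lattice X).
Hypothesis hL : lattice_norm L.
Hypothesis kb : KB L.
Local Notation "x ⊑ y" := (vle L x y) (at level 70).
Local Notation vpos := (vpos L).
Local Notation vinf := (vinf L).
Local Notation vabs := (vabs L).
Ltac vlin := vlin_with R X.

Lemma vgap_le a b c : 0 ⊑ c -> a ⊑ c -> b ⊑ c -> vgap L a b ⊑ c.
Proof.
move=> c0 ac bc; have half : 0 <= 2^-1 :> R by lra.
have h1 := vle_scale half (vpos_least ac c0); have h2 := vle_scale half (vpos_least bc c0).
by apply: (vle_by (vleD (vleD h1 h2) (vpos_ge0 (2^-1 *: (a + b))))); rewrite /vgap; vlin.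
Qed.

Lemma pos_form_vgap f C a b : pos_form L f C ->
  f (vgap L a b) = 2^-1 * (f (vpos a) + f (vpos b)) - f (vpos (2^-1 *: (a + b))).
Proof. by move=> [h _ _]; rewrite linear_formB // h.1 !h.2; ring. Qed.

Lemma natr1_gt0 (n : nat) : 0 < n.+1%:R :> R. Proof. by rewrite ltr0n. Qed.

(** [grid_gap] with mesh [a / (n + 1)]; the levels run from 0 to [n + 1], hence [n + 2] terms. *)
Lemma interval_grid a b c (n : nat) : 0 ⊑ b -> 0 ⊑ c -> b ⊑ a -> c ⊑ a ->
  `|b - c| <= 4 * (\sum_(k < n.+2) `|vgap L (b - (k%:R / n.+1%:R) *: a) (c - (k%:R / n.+1%:R) *: a)|)
     + 2 / n.+1%:R * `|a|.
Proof.
move=> b0 c0 ba ca.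
have a0 : 0 ⊑ a by exact: vle_trans ba.
have ni : 0 <= n.+1%:R^-1 :> R by rewrite invr_ge0.
pose h := n.+1%:R^-1 *: a.
have h0 : 0 ⊑ h by exact: vscale_ge0.
have ha : a = n.+1%:R *: h by rewrite /h scalerA mulfV ?scale1r.
have ca' : c ⊑ n.+1%:R *: h by rewrite -ha.
have ba' : b ⊑ n.+1%:R *: h by rewrite -ha.
have H := grid_gap h0 c0 b0 ca' ba'.
have e (k : nat) : k%:R *: h = (k%:R / n.+1%:R) *: a by rewrite /h scalerA.
move: H; under eq_bigr do rewrite e; move=> H.
apply: le_trans (norm_vabs_le hL H) _.
apply: le_trans (ler_normD _ _) _; apply: lerD.
  rewrite normrZ ger0_norm //; apply: ler_wpM2l => //.
  apply: le_trans (ler_norm_sum _ _ _) _; apply: ler_sum => k _.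
  rewrite /vgap [2^-1 *: vpos (c - _) + _]addrC [c - _ + _]addrC; exact: lexx.
by rewrite /h scalerA normrZ ger0_norm // mulr_ge0.
Qed.

(** Trees of approximants to [x] need not converge, so they are chosen by
    [lexicographic_minimization] of countably many functionals: the scalar masses, and a positive
    form of [(b w - k a / (n + 1))^+]. Vanishing midpoint defects of the latter make the forms of
    all gaps small, hence their norms, and [interval_grid] makes the values at every node Cauchy.
    The limits form a tree with root [|x|]. *)
Lemma tree_set_closed m v M : (forall w, 0 ⊑ v w) -> closed (tree_set L m v M).
Proof.
move=> v0 x /closure_near hx.
set a := vabs x; have a0 : 0 ⊑ a by exact: vabs_ge0.
(* The error [(n + 1)^-2] is incurred once for each of the [n + 2] grid levels, so in total it is
   still of order [1 / n]. *)
have fex (n : nat) : {f : X -> R | exists C, pos_form L f C /\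
    forall z, 0 ⊑ z -> z ⊑ a -> `|z| <= (n.+1%:R * n.+1%:R)^-1 + f z}.
  apply: cid; apply: (dominating_form hL kb a0).
  by rewrite invr_gt0 mulr_gt0 ?natr1_gt0.
pose f n := sval (fex n).
pose V := ((seq nat -> X) * (seq nat -> R))%type.
pose mid (b c : V) : V := (fun w => 2^-1 *: b.1 w + 2^-1 *: c.1 w, fun w => 2^-1 * b.2 w + 2^-1 * c.2 w).
pose p (j : nat) (b : V) : R :=
  match (unpickle j : option (seq nat * nat * nat + seq nat)%type) with
  | Some (inl (w, n, k)) => f n (vpos (b.1 w - (k%:R / n.+1%:R) *: a))
  | Some (inr w) => b.2 w
  | None => 0
  end.
pose B := [set b : V | tree L m v M b.1 b.2 /\ b.1 [::] ⊑ a].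
pose D (N : nat) := [set b : V | B b /\ `|a - b.1 [::]| <= 2^-1 ^+ N].
have half : 0 <= 2^-1 :> R by lra.
have Bmid b c : B b -> B c -> B (mid b c).
  move=> [hb ba] [hc ca]; split; first by apply: treeD => //; lra.
  by apply: (vle_by (vleD (vle_scale half ba) (vle_scale half ca))); rewrite /mid /=; vlin.
have k0 (k n : nat) : 0 ⊑ (k%:R / n.+1%:R : R) *: a by apply: vscale_ge0 => //; exact: divr_ge0.
have Ble b w : B b -> 0 ⊑ b.1 w /\ b.1 w ⊑ a.
  by move=> [hb ba]; split; [exact: (tree_ge0 hb)|exact: vle_trans (tree_le_root w hb) ba].
have [|||||||d dD dC] := @lexicographic_minimization _ V mid B p _ _ D.
- move=> j b hb; rewrite /p; case: (unpickle j) => // -[[[w n] k]|w].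
    by have [C [[_ h _] _]] := svalP (fex n); apply: h; exact: vpos_ge0.
  by case: hb => hb _; exact: (tree_lam_ge0 _ hb).
- move=> j; rewrite /p; case: (unpickle j) => [[[[w n] k]|w]|]; last by exists 0.
    exists (f n a) => b /(Ble _ w) [b0 ba].
    have [C [hf _]] := svalP (fex n); apply: (pos_form_mono hf).
    by apply: vpos_least => //; apply: (vle_by (vleD ba (k0 k n))); vlin.
  by exists M => b [hb _]; exact: (tree_lam_le _ hb).
- by move=> N b [].
- move=> N b [hb h]; split=> //; apply: le_trans h _; rewrite exprS.
  by have := half_pow_gt0 (R:=R) N; lra.
- move=> N; have [y [b [lam [h e]]] hy] := hx _ (half_pow_gt0 N).
  (* Cutting at the infimum with [a] puts the root in [[0, a]], where the forms [f n] dominate the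
     norm; it moves the root no farther from [a]. *)
  pose z := vinf a (b [::]).
  have zb : z ⊑ b [::] by exact: vinf_lbr.
  have z0 : 0 ⊑ z by apply: vinf_ge0 => //; exact: (tree_ge0 h).
  exists (tree_cut L m b [::] z, lam); split.
    by split; [exact: (tree_restrict hL h z0 zb)|exact: vinf_lbl].
  rewrite /= /z /vinf subKr; apply: le_trans hy.
  apply: le_trans (norm_vpos hL _) _; rewrite e; exact: norm_vabs_lip.
- move=> N b c [hb b1] [hc c1]; split; first exact: Bmid.
  rewrite /mid /=.
  have -> : a - (2^-1 *: b.1 [::] + 2^-1 *: c.1 [::]) =
    2^-1 *: (a - b.1 [::]) + 2^-1 *: (a - c.1 [::]) by vlin.
  by apply: le_trans (ler_normD _ _) _; rewrite !normrZ !ger0_norm //; lra.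
- move=> j b c hb hc; rewrite /p; case: (unpickle j) => [[[[w n] k]|w]|]; last by lra.
    have [C [hf _]] := svalP (fex n).
    have := pos_form_vgap (b.1 w - (k%:R / n.+1%:R) *: a) (c.1 w - (k%:R / n.+1%:R) *: a) hf.
    rewrite -/(f n).
    have -> : 2^-1 *: (b.1 w - (k%:R / n.+1%:R) *: a + (c.1 w - (k%:R / n.+1%:R) *: a)) =
      (mid b c).1 w - (k%:R / n.+1%:R) *: a by rewrite /mid /=; vlin.
    have : 0 <= f n (vgap L (b.1 w - (k%:R / n.+1%:R) *: a) (c.1 w - (k%:R / n.+1%:R) *: a)).
      by case: hf => _ h _; apply: h; exact: vgap_ge0.
    by lra.
  by rewrite /mid /=; lra.
have DB N : B (d N) by case: (dD N).
have cauchy w : exists l, seqlim (fun N => (d N).1 w) l.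
  apply: cauchy_seqlim => e e0.
  (* In units of [1 / (n + 1)], the errors of the forms contribute at most 8 and the mesh
     contributes [2 |a|]. The gaps below [e'] contribute [8 (n + 1) e' = e / 2]. *)
  pose c := 8 + 2 * `|a|; have c0 : 0 <= c by have := normr_ge0 a; rewrite /c; lra.
  pose n := Num.bound (2 * c / e).
  have hn : c / n.+1%:R <= e / 2.
    have h1 : 0 <= 2 * c / e by apply: divr_ge0; [lra|exact: ltW].
    have := archi_boundP h1; rewrite -/n ltr_pdivrMr // => h2.
    rewrite ler_pdivrMr ?natr1_gt0 // -[n.+1]addn1 natrD; nra.
  pose e' := e / (16 * n.+1%:R).
  have e'0 : 0 < e' by apply: divr_gt0 => //; rewrite mulr_gt0 ?natr1_gt0.
  have Nk (k : nat) : {N0 | forall N M, (N0 <= N)%N -> (N0 <= M)%N ->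
      f n (vgap L ((d N).1 w - (k%:R / n.+1%:R) *: a) ((d M).1 w - (k%:R / n.+1%:R) *: a)) <= e'}.
    apply: cid; have [N0 hN0] := dC (pickle (inl (w, n, k) : (seq nat * nat * nat + seq nat)%type)) e' e'0.
    exists N0 => N N' h1 h2; have [_] := hN0 N N' h1 h2.
    rewrite /p pickleK; have [C [hf _]] := svalP (fex n).
    rewrite (pos_form_vgap (f := f n) _ _ hf).
    have -> // : 2^-1 *: ((d N).1 w - (k%:R / n.+1%:R) *: a + ((d N').1 w - (k%:R / n.+1%:R) *: a)) =
      (mid (d N) (d N')).1 w - (k%:R / n.+1%:R) *: a by rewrite /mid /=; vlin.
  exists (\max_(k < n.+2) sval (Nk k))%N => N N' hN hN'.
  have [b0 ba] := Ble _ w (DB N); have [b0' ba'] := Ble _ w (DB N').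
  apply: le_trans (interval_grid n b0 b0' ba ba') _.
  have [C [hf hz]] := svalP (fex n).
  have gk (k : 'I_n.+2) : `|vgap L ((d N).1 w - (k%:R / n.+1%:R) *: a) ((d N').1 w - (k%:R / n.+1%:R) *: a)|
      <= (n.+1%:R * n.+1%:R)^-1 + e'.
    apply: le_trans (hz _ (vgap_ge0 _ _) _) _.
      by apply: vgap_le => //; [apply: (vle_by (vleD ba (k0 k n)))|apply: (vle_by (vleD ba' (k0 k n)))]; vlin.
    rewrite lerD2l; apply: (svalP (Nk k)).
      by apply: leq_trans hN; exact: (leq_bigmax k).
    by apply: leq_trans hN'; exact: (leq_bigmax k).
  apply: le_trans (_ : 4 * (n.+2%:R * ((n.+1%:R * n.+1%:R)^-1 + e')) + 2 / n.+1%:R * `|a| <= _).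
    rewrite lerD2r; apply: ler_wpM2l => //.
    apply: le_trans (ler_sum _ (fun k _ => gk k)) _.
    by rewrite sumr_const card_ord -[_ *+ n.+2]mulr_natl.
  have n1 := natr1_gt0 n.
  have n2 : n.+2%:R <= 2 * n.+1%:R :> R by rewrite -natrM ler_nat mul2n -addnn addSnnS leq_addl.
  have q0 : 0 <= (n.+1%:R * n.+1%:R)^-1 + e' by apply: addr_ge0; [rewrite invr_ge0 mulr_ge0|exact: ltW].
  apply: le_trans (_ : 4 * (2 * n.+1%:R * ((n.+1%:R * n.+1%:R)^-1 + e')) + 2 / n.+1%:R * `|a| <= _).
    by rewrite lerD2r; apply: ler_wpM2l => //; apply: ler_wpM2r.
  have -> : 4 * (2 * n.+1%:R * ((n.+1%:R * n.+1%:R)^-1 + e')) + 2 / n.+1%:R * `|a| = c / n.+1%:R + e / 2.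
    by rewrite /e' /c; field.
  by apply: le_trans (lerD hn (lexx _)) _; lra.
pose b w := sval (cid (cauchy w)).
have hb w : seqlim (fun N => (d N).1 w) (b w) by exact: svalP (cid (cauchy w)).
have lcauchy w : exists l : R^o, seqlim (fun N => (d N).2 w : R^o) l.
  apply: cauchy_seqlim => e e0.
  have [N0 hN0] := dC (pickle (inr w : (seq nat * nat * nat + seq nat)%type)) e e0.
  exists N0 => N N' h1 h2; have [+ _] := hN0 N N' h1 h2.
  by rewrite /p pickleK.
pose lam w := sval (cid (lcauchy w)).
have hlam w : seqlim (fun N => (d N).2 w : R^o) (lam w) by exact: svalP (cid (lcauchy w)).
have tr N : tree L m v M (d N).1 (d N).2 by case: (DB N).
exists b, lam; split; last first.
  have h1 : seqlim (fun N => (d N).1 [::]) a.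
    move=> e e0; have [N0 hN0] := half_pow_small 1 e0; exists N0 => n Nn.
    by have [_] := dD n; rewrite distrC => h; apply: le_trans h _; have := hN0 n Nn; lra.
  exact: seqlim_uniq (hb [::]) h1.
split.
- by move=> w; apply: (vge0_lim hL (hb w)); exists 0%N => n _; exact: (tree_ge0 (tr n)).
- by move=> w; apply: (band_lim hL (hb w)) => n; exact: (tree_band (tr n)).
- move=> w; apply: seqlim_uniq (hb w) _.
  under eq_fun => N do rewrite (tree_sum (tr N)).
  by apply: seqlim_sum => i; exact: hb.
- move=> w i mi; apply: seqlim_uniq (hb _) _.
  under eq_fun => N do rewrite (tree_out (tr N)) //.
  exact: seqlim_cst.
- move=> w; apply/ler_addgt0Pr => e e0.
  have [N1 h1] := hb w (e / 2) ltac:(lra); have [N2 h2] := hlam w (e / 2) ltac:(lra).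
  set n := maxn N1 N2.
  have := h1 n (leq_maxl _ _); have := h2 n (leq_maxr _ _); have := tree_norm (tr n) w.
  have := ler_normB ((d n).1 w) ((d n).1 w - b w); rewrite subKr.
  have := ler_norm ((d n).2 w - lam w); lra.
- move=> w; have := hlam w.
  under eq_fun => N do rewrite (tree_lam (tr N)).
  move=> h; apply: (seqlim_uniq h).
  by apply: (@seqlim_sum _ R^o) => i; exact: hlam.
- move=> w i mi; have := hlam (rcons w i).
  under eq_fun => N do rewrite (tree_lam_out (tr N)) //.
  move=> h; apply: (seqlim_uniq h); exact: seqlim_cst.
- apply: le_trans (ler_norm _) _; apply: (seqlim_norm_le (hlam [::])).
  by exists 0%N => n _; rewrite ger0_norm; [exact: (tree_mass (tr n))|exact: (tree_lam_ge0 _ (tr n))].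
Qed.
End TreeClosed.

(** * Charges and partitions *)

Section Labels.
Context (d : measure_display) (T : measurableType d).

(* A finite measurable partition, given by the index of the cell of each point. *)
Record label := Label {
  lab :> T -> nat;
  rng : seq nat;
  rng_uniq : uniq rng;
  lab_rng : forall t, lab t \in rng;
  lab_meas : forall k, measurable (lab @^-1` [set k]) }.

Definition cell (p : label) (k : nat) : set T := p @^-1` [set k].

Lemma measurable_cell p k : measurable (cell p k). Proof. exact: lab_meas. Qed.

Lemma label_pred_meas (p : label) (P : pred nat) : measurable [set t | P (p t)].
Proof.
have -> : [set t | P (p t)] = \bigcup_(k in [set k | P k]) cell p k.
  apply/seteqP; split=> [t Pt|t [k Pk]]; first by exists (p t).
  by rewrite /cell /= => ->.
by apply: bigcup_measurable => k _; exact: measurable_cell.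
Qed.

Definition pair_code (a b : nat) : nat := pickle (a, b).

Lemma pair_code_inj a b a' b' : pair_code a b = pair_code a' b' -> a = a' /\ b = b'.
Proof. by move=> /(pcan_inj pickleK) [-> ->]. Qed.

Program Definition pairl (p q : label) : label :=
  @Label (fun t => pair_code (p t) (q t)) [seq pair_code a b | a <- rng p, b <- rng q] _ _ _.
Next Obligation.
move=> p q; apply: allpairs_uniq; [exact: rng_uniq|exact: rng_uniq|].
by move=> [a b] [a' b'] _ _ /= /pair_code_inj [-> ->].
Qed.
Next Obligation.
by move=> p q t; apply: allpairs_f; exact: lab_rng.
Qed.
Next Obligation.
move=> p q k.
have [[a [b <-]]|no] := pselect (exists a b, pair_code a b = k).
  have -> : (fun t => pair_code (p t) (q t)) @^-1` [set pair_code a b] = cell p a `&` cell q b.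
    by apply/seteqP; split=> [t /= /pair_code_inj [<- <-]|t [/= <- <-]].
  by apply: measurableI; exact: measurable_cell.
have -> : (fun t => pair_code (p t) (q t)) @^-1` [set k] = set0.
  by apply/seteqP; split=> // t /= e; apply: no; exists (p t), (q t).
exact: measurable0.
Qed.

Lemma cell_pair p q a b : cell (pairl p q) (pair_code a b) = cell p a `&` cell q b.
Proof.
by apply/seteqP; split=> [t /= /pair_code_inj [<- <-]|t [/= <- <-]].
Qed.

Lemma sum_pair (V : nmodType) p q (f : nat -> V) :
  \sum_(k <- rng (pairl p q)) f k = \sum_(a <- rng p) \sum_(b <- rng q) f (pair_code a b).
Proof. by rewrite /= big_allpairs_dep. Qed.

Program Definition triv_label : label := @Label (fun=> 0%N) [:: 0%N] _ _ _.
Next Obligation. by []. Qed.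
Next Obligation. by []. Qed.
Next Obligation.
case=> [|k].
- by have -> : (fun _ : T => 0%N) @^-1` [set 0%N] = setT by apply/seteqP; split.
- by have -> : (fun _ : T => 0%N) @^-1` [set k.+1] = set0 by apply/seteqP; split.
Qed.

Program Definition ind_label (E : set T) (mE : measurable E) : label :=
  @Label (fun t => if `[< E t >] then 1%N else 0%N) [:: 1%N; 0%N] _ _ _.
Next Obligation. by []. Qed.
Next Obligation. by move=> E mE t /=; case: asboolP. Qed.
Next Obligation.
move=> E mE [|[|k]].
- have -> : (fun t => if `[< E t >] then 1%N else 0%N) @^-1` [set 0%N] = ~` E.
    by apply/seteqP; split=> t /=; case: asboolP.
  exact: measurableC.
- have -> : (fun t => if `[< E t >] then 1%N else 0%N) @^-1` [set 1%N] = E.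
    by apply/seteqP; split=> t /=; case: asboolP.
  by [].
- have -> : (fun t => if `[< E t >] then 1%N else 0%N) @^-1` [set k.+2] = set0.
    by apply/seteqP; split=> t /=; case: asboolP.
  exact: measurable0.
Qed.

Lemma cell_ind1 E mE : cell (@ind_label E mE) 1%N = E.
Proof. by apply/seteqP; split=> t; rewrite /cell /=; case: asboolP. Qed.

Lemma cell_ind0 E mE : cell (@ind_label E mE) 0%N = ~` E.
Proof. by apply/seteqP; split=> t; rewrite /cell /=; case: asboolP. Qed.

Definition fadd (V : nmodType) (D : set T -> V) := forall A B,
  measurable A -> measurable B -> A `&` B = set0 -> D (A `|` B) = D A + D B.

Lemma fadd0 (V : zmodType) (D : set T -> V) : fadd D -> D set0 = 0.
Proof.
move=> h; have := h set0 set0 measurable0 measurable0 (set0I _); rewrite setU0.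
by move/eqP; rewrite -subr_eq0 opprD addrA subrr sub0r oppr_eq0 => /eqP.
Qed.

Lemma fadd_label (V : zmodType) (D : set T -> V) (p : label) E : fadd D -> measurable E ->
  D E = \sum_(k <- rng p) D (E `&` cell p k).
Proof.
move=> hD mE.
have mp (P : pred nat) : measurable (E `&` [set t | P (p t)]).
  by apply: measurableI => //; exact: label_pred_meas.
have key (r : seq nat) : uniq r ->
    D (E `&` [set t | p t \in r]) = \sum_(k <- r) D (E `&` cell p k).
  elim: r => [_|k r IH /= /andP[kr ur]].
    rewrite big_nil; have -> : E `&` [set t | p t \in [::]] = set0.
      by apply/seteqP; split=> t //= [].
    exact: fadd0.
  rewrite big_cons -IH // -hD.
  - congr D; apply/seteqP; split=> [t [Et /=]|t [[Et /= ->]|[Et /= h]]].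
    + by rewrite in_cons => /orP[/eqP e|h]; [left|right]; split.
    + by split=> //=; rewrite in_cons eqxx.
    + by split=> //=; rewrite in_cons h orbT.
  - by apply: measurableI => //; exact: measurable_cell.
  - exact: mp.
  - by apply/seteqP; split=> // t [[_ e] [_ tr]]; move/negP: kr; apply; rewrite -(e : p t = k).
rewrite -key; last exact: rng_uniq.
by congr D; apply/seteqP; split=> [t Et|t []] //; split=> //=; exact: lab_rng.
Qed.

Lemma fadd_pred (V : zmodType) (D : set T -> V) (p : label) (P : pred nat) : fadd D ->
  D [set t | P (p t)] = \sum_(k <- rng p | P k) D (cell p k).
Proof.
move=> hD; rewrite (fadd_label p hD (label_pred_meas p P)) [RHS]big_mkcond.
apply: eq_bigr => k _; case: ifPn => Pk.
  congr D; apply/seteqP; split=> [t []|t] //; rewrite /cell /= => ->; by split.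
rewrite -[RHS](fadd0 hD); congr D; apply/seteqP; split=> // t [] /= + e.
by rewrite e (negbTE Pk).
Qed.

Lemma fadd_total (V : zmodType) (D : set T -> V) (p : label) : fadd D ->
  D setT = \sum_(k <- rng p) D (cell p k).
Proof.
move=> hD; rewrite (fadd_label p hD measurableT); apply: eq_bigr => k _; by rewrite setTI.
Qed.

Lemma faddD (V : zmodType) (D E : set T -> V) : fadd D -> fadd E -> fadd (fun A => D A + E A).
Proof. by move=> hD hE A B mA mB AB; rewrite hD // hE // addrACA. Qed.

Lemma faddN (V : zmodType) (D : set T -> V) : fadd D -> fadd (fun A => - D A).
Proof. by move=> hD A B mA mB AB; rewrite hD // opprD. Qed.

Lemma faddB (V : zmodType) (D E : set T -> V) : fadd D -> fadd E -> fadd (fun A => D A - E A).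
Proof. by move=> hD hE; apply: faddD => //; exact: faddN. Qed.

Lemma fadd_setD (V : zmodType) (D : set T -> V) A B : fadd D -> measurable A -> measurable B ->
  B `<=` A -> D A = D B + D (A `\` B).
Proof.
move=> hD mA mB BA; rewrite -hD //.
- by congr D; apply/seteqP; split=> [t At|t [/BA|[]]] //; have [Bt|nBt] := pselect (B t); [left|right].
- exact: measurableD.
- by apply/seteqP; split=> // t [Bt [_]].
Qed.

End Labels.

(** * Suprema over partitions *)

Section SupMeasure.
Context (d : measure_display) (T : measurableType d).
Variables (R : realType) (X : completeNormedModType R) (L : vector_lattice X).
Hypothesis hL : lattice_norm L.
Hypothesis kb : KB L.
Local Notation "x ⊑ y" := (vle L x y) (at level 70).
Local Notation vpos := (vpos L).
Local Notation vinf := (vinf L).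
Local Notation vabs := (vabs L).
Local Notation label := (label T).
Ltac vlin := vlin_with R X.

Definition subadd (phi : set T -> X) := forall A B,
  measurable A -> measurable B -> A `&` B = set0 -> phi (A `|` B) ⊑ phi A + phi B.

Definition cell_sum (phi : set T -> X) (p : label) (E : set T) : X :=
  \sum_(k <- rng p) phi (E `&` cell p k).

Section Sup.
Variable phi : set T -> X.
Hypothesis phi0 : phi set0 = 0.
Hypothesis phi_ge0 : forall A, measurable A -> 0 ⊑ phi A.
Hypothesis phi_sub : subadd phi.

Lemma subadd_label (p : label) E : measurable E -> phi E ⊑ cell_sum phi p E.
Proof.
move=> mE.
have mp (P : pred nat) : measurable (E `&` [set t | P (p t)]).
  by apply: measurableI => //; exact: label_pred_meas.
have key (r : seq nat) : uniq r ->
    phi (E `&` [set t | p t \in r]) ⊑ \sum_(k <- r) phi (E `&` cell p k).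
  elim: r => [_|k r IH /= /andP[kr ur]].
    rewrite big_nil; have -> : E `&` [set t | p t \in [::]] = set0.
      by apply/seteqP; split=> t //= [].
    by rewrite phi0; exact: vlexx.
  rewrite big_cons.
  have -> : E `&` [set t | p t \in k :: r] = (E `&` cell p k) `|` (E `&` [set t | p t \in r]).
    apply/seteqP; split=> [t [Et /=]|t [[Et /= ->]|[Et /= h]]].
    + by rewrite in_cons => /orP[/eqP e|h]; [left|right]; split.
    + by split=> //=; rewrite in_cons eqxx.
    + by split=> //=; rewrite in_cons h orbT.
  apply: vle_trans (phi_sub _ (mp _) _) _.
  - by apply: measurableI => //; exact: measurable_cell.
  - by apply/seteqP; split=> // t [[_ e] [_ tr]]; move/negP: kr; apply; rewrite -(e : p t = k).
  - by apply: vleD (vlexx _) _; exact: IH.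
apply: vle_trans (key _ (rng_uniq p)).
have -> : E `&` [set t | p t \in rng p] = E; last exact: vlexx.
by apply/seteqP; split=> [t []|t Et] //; split=> //=; exact: lab_rng.
Qed.

Lemma cell_sum_pairl (p q : label) E : measurable E ->
  cell_sum phi p E ⊑ cell_sum phi (pairl p q) E.
Proof.
move=> mE; rewrite /cell_sum sum_pair; apply: vle_sum => a _.
under [X in _ ⊑ X]eq_bigr do rewrite cell_pair setIA.
by apply: subadd_label; apply: measurableI => //; exact: measurable_cell.
Qed.

Lemma cell_sum_pairr (p q : label) E : measurable E ->
  cell_sum phi q E ⊑ cell_sum phi (pairl p q) E.
Proof.
move=> mE; rewrite /cell_sum sum_pair exchange_big; apply: vle_sum => a _.
under [X in _ ⊑ X]eq_bigr do rewrite cell_pair (setIC (cell p _)) setIA.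
by apply: subadd_label; apply: measurableI => //; exact: measurable_cell.
Qed.

Lemma cell_sum_sub (p : label) E (mE : measurable E) :
  cell_sum phi p E ⊑ cell_sum phi (pairl (ind_label mE) p) setT.
Proof.
rewrite /cell_sum sum_pair [rng (ind_label _)]/= !big_cons big_nil addr0.
under [X in X + _]eq_bigr do rewrite cell_pair setTI cell_ind1.
under [X in _ + X]eq_bigr do rewrite cell_pair setTI cell_ind0.
rewrite -[X in X ⊑ _]addr0; apply: vleD (vlexx _) _.
apply: vsum_ge0 => k _; apply: phi_ge0; apply: measurableI.
  exact: measurableC.
exact: measurable_cell.
Qed.

Lemma cell_sumU (p : label) A B : measurable A -> measurable B -> A `&` B = set0 ->
  cell_sum phi p (A `|` B) ⊑ cell_sum phi p A + cell_sum phi p B.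
Proof.
move=> mA mB AB; rewrite /cell_sum -big_split; apply: vle_sum => k _ /=.
rewrite setIUl; apply: phi_sub; try by apply: measurableI => //; exact: measurable_cell.
by rewrite setIACA AB set0I.
Qed.

Lemma cell_sumU_ge (p : label) A B (mA : measurable A) : measurable B -> A `&` B = set0 ->
  cell_sum phi p A + cell_sum phi p B ⊑ cell_sum phi (pairl (ind_label mA) p) (A `|` B).
Proof.
move=> mB AB; rewrite /cell_sum sum_pair [rng (ind_label _)]/= !big_cons big_nil addr0.
under [X in _ ⊑ X + _]eq_bigr do rewrite cell_pair cell_ind1 setIA setUK.
under [X in _ ⊑ _ + X]eq_bigr do rewrite cell_pair cell_ind0 setIA.
have -> : (A `|` B) `&` ~` A = B.
  apply/seteqP; split=> [t [[] // ]|t Bt]; split; first by right.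
  by move=> At; have : (A `&` B) t by []; rewrite AB.
exact: vlexx.
Qed.

(** By subadditivity the cell sums grow under refinement, so they form a bounded directed family,
    which has a limit in a KB-space. With [phi = (D E)^+] this is the positive part of a charge;
    with [phi = |F E|] in the lattice of reals it is the total variation. *)
Lemma sup_measure : (exists M : R, forall p : label, `|cell_sum phi p setT| <= M) ->
  exists P : set T -> X, [/\ fadd P,
    forall p E, measurable E -> cell_sum phi p E ⊑ P E,
    forall E, measurable E -> phi E ⊑ P E &
    forall E (e : R), measurable E -> 0 < e ->
      exists p, forall q, `|P E - cell_sum phi (pairl p q) E| <= e].
Proof.
move=> [M hM].
have S0 p E : measurable E -> 0 ⊑ cell_sum phi p E.
  move=> mE; apply: vsum_ge0 => k _; apply: phi_ge0; apply: measurableI => //; exact: measurable_cell.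
have ex E : {l : X | measurable E -> (forall p, cell_sum phi p E ⊑ l) /\
    (forall e : R, 0 < e -> exists p, `|l - cell_sum phi p E| <= e)}.
  apply: cid; have [mE|nE] := pselect (measurable E); last by exists 0.
  have [|||l [l1 l2]] := KB_directed hL kb (S := range (fun p => cell_sum phi p E)).
  - by exists (cell_sum phi (triv_label T) E); exists (triv_label T).
  - move=> _ _ [p _ <-] [q _ <-]; exists (cell_sum phi (pairl p q) E); split.
    + by exists (pairl p q).
    + exact: cell_sum_pairl.
    + exact: cell_sum_pairr.
  - exists M => _ [p _ <-]; apply: le_trans (hM (pairl (ind_label mE) p)).
    by apply: (norm_vle hL); [exact: S0|exact: cell_sum_sub].
  exists l => _; split=> [p|e e0]; first by apply: l1; exists p.
  by have [_ [p _ <-] hp] := l2 e e0; exists p.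
pose P E := sval (ex E).
have Pub p E : measurable E -> cell_sum phi p E ⊑ P E by move=> mE; have [h _] := svalP (ex E) mE; exact: h.
have Papp E (e : R) : measurable E -> 0 < e -> exists p, forall q, `|P E - cell_sum phi (pairl p q) E| <= e.
  move=> mE e0; have [_ h] := svalP (ex E) mE; have [p hp] := h e e0; exists p => q.
  apply: le_trans hp; apply: (norm_vle hL); first by apply: vsub_ge0; exact: Pub.
  by apply: (vle_by (cell_sum_pairl p q mE)); rewrite /P; vlin.
exists P; split=> //; last first.
  by move=> E mE; apply: vle_trans (subadd_label (triv_label T) mE) (Pub _ _ mE).
move=> A B mA mB AB; have mAB : measurable (A `|` B) by exact: measurableU.
apply/eqP; rewrite -subr_eq0; apply/eqP/norm_eq0_small => e e0.
have e4 : 0 < e / 4 by lra.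
have [pA hA] := Papp A _ mA e4; have [pB hB] := Papp B _ mB e4.
have [pU hU] := Papp (A `|` B) _ mAB e4.
rewrite -(norm_vabs hL).
pose r := pairl pA (pairl pB pU).
have h1 : `|P A - cell_sum phi r A| <= e / 4 by exact: hA.
have [r' hr'] : exists r' : label, [/\ cell_sum phi r A ⊑ cell_sum phi r' A, cell_sum phi r B ⊑ cell_sum phi r' B,
   `|P A - cell_sum phi r' A| <= e / 4, `|P B - cell_sum phi r' B| <= e / 4 &
   `|P (A `|` B) - cell_sum phi r' (A `|` B)| <= e / 4].
  have mono p q E : measurable E -> cell_sum phi p E ⊑ cell_sum phi q E ->
      `|P E - cell_sum phi q E| <= `|P E - cell_sum phi p E|.
    move=> mE h; apply: (norm_vle hL); first by apply: vsub_ge0; exact: Pub.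
    by apply: (vle_by h); vlin.
  exists r; split; try exact: vlexx; first exact: hA.
    apply: le_trans (hB pU); apply: mono => //; exact: cell_sum_pairr.
  apply: le_trans (hU pU); apply: mono => //.
  have h2 : cell_sum phi pU (A `|` B) ⊑ cell_sum phi (pairl pB pU) (A `|` B) by exact: cell_sum_pairr.
  (* [hU] speaks only of partitions [pairl pU q]; taking [q = pU] gives back the sum over [pU]. *)
  have e1 : cell_sum phi (pairl pU pU) (A `|` B) ⊑ cell_sum phi pU (A `|` B).
    rewrite /cell_sum sum_pair; apply: vle_sum_seq => a ar _.
    rewrite (bigD1_seq a) //=; last exact: rng_uniq.
    rewrite cell_pair setIid big1 ?addr0; first exact: vlexx.
    move=> b ba; rewrite cell_pair [cell pU a `&` cell pU b](_ : _ = set0) ?setI0 //.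
    by apply/seteqP; split=> // t [/= ta tb]; move/eqP: ba; apply; rewrite -ta -tb.
  apply: vle_trans e1 (vle_trans h2 _); exact: cell_sum_pairr.
case: hr' => _ _ a1 a2 a3.
have c1 := cell_sumU r' mA mB AB; have c2 := cell_sumU_ge r' mA mB AB.
have c3 := vle_trans c2 (Pub _ _ mAB).
have ub : vabs (P (A `|` B) - (P A + P B)) ⊑
   (P A - cell_sum phi r' A) + (P B - cell_sum phi r' B) + (P (A `|` B) - cell_sum phi r' (A `|` B)).
  have pA0 := vsub_ge0 (Pub r' A mA); have pB0 := vsub_ge0 (Pub r' B mB); have pU0 := vsub_ge0 (Pub r' _ mAB).
  apply: vabs_least.
    by apply: (vle_by (vleD c1 (vaddr_ge0 (vaddr_ge0 pA0 pB0) (vaddr_ge0 pA0 pB0)))); vlin.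
  by apply: (vle_by (vleD c3 pU0)); vlin.
rewrite (norm_vabs hL); apply: le_trans (norm_vabs_le hL ub) _.
by apply: le_trans (ler_normD _ _) _; have := ler_normD (P A - cell_sum phi r' A) (P B - cell_sum phi r' B); lra.
Qed.
End Sup.

Lemma pos_part_measure (D : set T -> X) : fadd D ->
  (exists M : R, forall p : label, `|cell_sum (fun E => vpos (D E)) p setT| <= M) ->
  exists P : set T -> X, [/\ fadd P,
    forall p E, measurable E -> cell_sum (fun E => vpos (D E)) p E ⊑ P E,
    forall E, measurable E -> vpos (D E) ⊑ P E &
    forall E (e : R), measurable E -> 0 < e ->
      exists p, forall q, `|P E - cell_sum (fun E => vpos (D E)) (pairl p q) E| <= e].
Proof.
move=> hD; apply: sup_measure.
- by rewrite fadd0 // vpos_id //; exact: vlexx.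
- by move=> A _; exact: vpos_ge0.
- by move=> A B mA mB AB; rewrite hD //; exact: vpos_subD.
Qed.
End SupMeasure.

(** * Bushes of singular measures *)

Section Bush.
Context (d : measure_display) (T : measurableType d).
Variables (R : realType) (X : completeNormedModType R) (L : vector_lattice X).
Hypothesis hL : lattice_norm L.
Hypothesis kb : KB L.
Local Notation "x ⊑ y" := (vle L x y) (at level 70).
Local Notation vpos := (vpos L).
Local Notation vinf := (vinf L).
Local Notation vabs := (vabs L).
Local Notation label := (label T).
Ltac vlin := vlin_with R X.

Definition abs_cont (mes nu : set T -> R) := forall e : R, 0 < e ->
  exists2 del, 0 < del & forall E, measurable E -> mes E <= del -> nu E <= e.

Variables (mes nu : set T -> R) (F : set T -> X) (u : X).
Hypothesis mes_add : fadd mes.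
Hypothesis mes_ge0 : forall E, measurable E -> 0 <= mes E.
Hypothesis nu_add : fadd nu.
Hypothesis nu_ac : abs_cont mes nu.
Hypothesis F_add : fadd F.
Hypothesis F_ge0 : forall E, measurable E -> 0 ⊑ F E.
Hypothesis F_nu : forall E, measurable E -> `|F E| <= nu E.
Hypothesis F_u : F setT ⊑ u.
Hypothesis F_sing : forall e : R, 0 < e -> exists q : label, forall p : label,
  `|\sum_(k <- rng (pairl p q)) vinf (F (cell (pairl p q) k)) (mes (cell (pairl p q) k) *: u)| <= e.

(** [bush_y] subtracts the multiple [eta * mes] of [u] on such a cell; dividing by this factor turns
    the bound into [del], as [bush_small] requires. *)
Definition good_cell (eta del : R) (r : label) (k : nat) : bool :=
  `|vinf (F (cell r k)) (mes (cell r k) *: u)| <= eta * del * mes (cell r k).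

Lemma u_ge0 : 0 ⊑ u. Proof. apply: vle_trans F_u; exact: F_ge0. Qed.

(** [eta] is small enough for the subtracted multiples of [u] to have total norm at most [beta / 2].
    The bad cells have small total measure by a Chebyshev estimate: singularity makes the norm of
    the sum of the infima small, and [norm_sum_interval] passes to the sum of their norms. Absolute
    continuity then makes their [nu]-mass small. *)
Lemma bush_level (beta del : R) : 0 < beta -> 0 < del ->
  {eq : R * label | [/\ 0 < eq.1, eq.1 <= 1, eq.1 * mes setT * `|u| <= beta / 2 &
    forall p : label, \sum_(k <- rng (pairl p eq.2) | ~~ good_cell eq.1 del (pairl p eq.2) k)
      nu (cell (pairl p eq.2) k) <= beta / 2]}.
Proof.
move=> beta0 del0; apply: cid.
have mT : 0 <= mes setT by apply: mes_ge0.
have D0 : 0 < 2 * (mes setT * `|u| + 1) by have := mulr_ge0 mT (normr_ge0 u); lra.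
pose eta := Num.min 1 (beta / (2 * (mes setT * `|u| + 1))).
have eta0 : 0 < eta by rewrite /eta lt_min ltr01 divr_gt0.
have eta1 : eta <= 1 by rewrite /eta ge_min lexx.
have eta2 : eta * mes setT * `|u| <= beta / 2.
  have h : eta <= beta / (2 * (mes setT * `|u| + 1)) by rewrite /eta ge_min lexx orbT.
  rewrite -mulrA; apply: le_trans (ler_wpM2r _ h) _; first exact: mulr_ge0.
  have h1 := mulr_ge0 mT (normr_ge0 u).
  rewrite mulrAC ler_pdivrMr //; nra.
have b2 : 0 < beta / 2 by lra.
have [th th0 hth] := nu_ac b2.
have ed : 0 < eta * del by exact: mulr_gt0.
(* Both constants are chosen so that the two terms of [norm_sum_interval] are at most
   [eta del th / 2] each; dividing by [eta del] leaves measure [th] for the bad cells. *)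
have e10 : 0 < eta * del * th / (2 * (mes setT + 1)) by apply: divr_gt0; [exact: mulr_gt0|lra].
have [C C0 hC] := norm_sum_interval hL kb u_ge0 e10.
have k0 : 0 < eta * del * th / (2 * (C + 1)) by apply: divr_gt0; [exact: mulr_gt0|lra].
have [q hq] := F_sing k0.
exists (eta, q); split=> //= p; set r := pairl p q.
rewrite -(fadd_pred r (fun k => ~~ good_cell eta del r k)) //.
apply: (hth _ (label_pred_meas r (fun k => ~~ good_cell eta del r k))).
rewrite (fadd_pred r (fun k => ~~ good_cell eta del r k) mes_add).
have mc k : 0 <= mes (cell r k) by apply: mes_ge0; exact: measurable_cell.
pose z k := vinf (F (cell r k)) (mes (cell r k) *: u).
have z0 k : 0 ⊑ z k.
  by apply: vinf_ge0; [apply: F_ge0; exact: measurable_cell|apply: vscale_ge0 => //; exact: u_ge0].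
have h1 : eta * del * (\sum_(k <- rng r | ~~ good_cell eta del r k) mes (cell r k)) <=
    \sum_(k <- rng r) `|z k|.
  rewrite mulr_sumr big_mkcond; apply: ler_sum => k _.
  by case: ifPn => // h; apply: ltW; rewrite ltNge.
have h2 := hC _ (rng r) predT (fun k => mes (cell r k)) z (fun k _ => mc k).
have {}h2 := h2 (fun k _ => conj (z0 k) (vinf_lbr _ _)).
rewrite -(fadd_total r mes_add) in h2.
have h3 : C * `|\sum_(i <- rng r) z i| <= C * (eta * del * th / (2 * (C + 1))).
  by apply: ler_wpM2l => //; exact: hq.
have h4 : eta * del * th / (2 * (mes setT + 1)) * mes setT <= eta * del * th / 2.
  have p0 : 0 <= eta * del * th by apply: mulr_ge0; apply: ltW.
  rewrite mulrAC ler_pdivrMr; last by lra.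
  nra.
have h5 : C * (eta * del * th / (2 * (C + 1))) <= eta * del * th / 2.
  have p0 : 0 <= eta * del * th by apply: mulr_ge0; apply: ltW.
  rewrite mulrA ler_pdivrMr; last by lra.
  nra.
have h6 : eta * del * (\sum_(k <- rng r | ~~ good_cell eta del r k) mes (cell r k)) <= eta * del * th by lra.
by rewrite ler_pM2l in h6.
Qed.

Hypothesis F_neq0 : F setT != 0.

Let f := F setT.
Let f_gt0 : 0 < `|f|. Proof. by rewrite normr_gt0. Qed.
(** The loss allowed at level [n] is [|f| 2^-(n+2)], which sums to [|f| / 2]; the bound [2^-(n+1)]
    is the one required at depth [n + 1]. *)
Let lev (n : nat) := bush_level (mulr_gt0 f_gt0 (half_pow_gt0 n.+2)) (half_pow_gt0 n.+1).
Let eta n := (sval (lev n)).1.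
Let q n := (sval (lev n)).2.
Let del (n : nat) : R := 2^-1 ^+ n.+1.
Let m n := size (rng (q n)).

Fixpoint bush_label (n : nat) : label :=
  if n is k.+1 then pairl (bush_label k) (q k) else triv_label T.
Local Notation p := bush_label.

(** Words list positions in the successive ranges [rng (q n)]; the code is the resulting cell index
    in the accumulated partition. *)
Definition bush_code : seq nat -> nat :=
  word_rec (fun w c i => pair_code c (nth 0%N (rng (q (size w))) i)) [::] 0%N.
(** An index out of range reads the default 0 of [nth], which may be a genuine cell. Validity keeps
    such words from receiving scalar mass. *)
Definition bush_valid : seq nat -> bool :=
  word_rec (fun w c i => c && (i < m (size w))%N) [::] true.
Definition bush_set (w : seq nat) : set T := cell (p (size w)) (bush_code w).

(** The child receives its Riesz part of the parent's vector, minus a small multiple of [u], which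
    makes it nearly disjoint from [u]; bad cells are given up. *)
Definition bush_y : seq nat -> X :=
  word_rec (fun w y i => if (i < m (size w))%N &&
      good_cell (eta (size w)) (del (size w)) (p (size w).+1) (bush_code (rcons w i))
    then vpos (riesz_part L y (fun j => F (bush_set (rcons w j))) i -
               (eta (size w) * mes (bush_set (rcons w i))) *: u)
    else 0) [::] f.
Local Notation code := bush_code.
Local Notation valid := bush_valid.
Local Notation J := bush_set.
Local Notation y := bush_y.

Lemma bush_code_rcons w i : code (rcons w i) = pair_code (code w) (nth 0%N (rng (q (size w))) i).
Proof. exact: word_rec_rcons. Qed.

Lemma bush_valid_rcons w i : valid (rcons w i) = valid w && (i < m (size w))%N.
Proof. exact: word_rec_rcons. Qed.

Lemma bush_y_rcons w i : y (rcons w i) = if (i < m (size w))%N &&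
      good_cell (eta (size w)) (del (size w)) (p (size w).+1) (code (rcons w i))
    then vpos (riesz_part L (y w) (fun j => F (J (rcons w j))) i -
               (eta (size w) * mes (J (rcons w i))) *: u)
    else 0.
Proof. exact: word_rec_rcons. Qed.

Lemma bush_set_rcons w i : J (rcons w i) = J w `&` cell (q (size w)) (nth 0%N (rng (q (size w))) i).
Proof. by rewrite /J size_rcons bush_code_rcons cell_pair. Qed.

Lemma bush_set_meas w : measurable (J w). Proof. exact: measurable_cell. Qed.

Lemma bush_set_nil : J [::] = setT.
Proof. by apply/seteqP; split. Qed.

Lemma bush_sum_codes (V : nmodType) n (h : nat -> V) :
  \sum_(i < m n) h (nth 0%N (rng (q n)) i) = \sum_(b <- rng (q n)) h b.
Proof. by rewrite [RHS](big_nth 0%N) big_mkord. Qed.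

Lemma bush_additive (V : zmodType) (D : set T -> V) w : fadd D ->
  D (J w) = \sum_(i < m (size w)) D (J (rcons w i)).
Proof.
move=> hD; rewrite (fadd_label (q (size w)) hD (bush_set_meas w)) -bush_sum_codes.
by apply: eq_bigr => i _; rewrite bush_set_rcons.
Qed.

Let part w i := riesz_part L (y w) (fun j => F (J (rcons w j))) i.

Lemma bush_y_bounds w : 0 ⊑ y w /\ y w ⊑ F (J w).
Proof.
elim/last_ind: w => [|w i [y0 yF]].
  by rewrite bush_set_nil; split; [exact: F_ge0|exact: vlexx].
rewrite bush_y_rcons; case: ifP => _; last first.
  by split; [exact: vlexx|apply: F_ge0; exact: bush_set_meas].
split; first exact: vpos_ge0.
have F0 : 0 ⊑ F (J (rcons w i)) by apply: F_ge0; exact: bush_set_meas.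
apply: vpos_least => //; apply: vle_trans (riesz_part_le L (y w) (fun j => F (J (rcons w j))) i).
have c0 : 0 ⊑ (eta (size w) * mes (J (rcons w i))) *: u.
  apply: vscale_ge0; last exact: u_ge0.
  apply: mulr_ge0; last by apply: mes_ge0; exact: bush_set_meas.
  by apply: ltW; rewrite /eta; case: (svalP (lev (size w))).
by apply: (vle_by c0); vlin.
Qed.

Lemma bush_part_sum w : \sum_(i < m (size w)) part w i = y w.
Proof.
have [y0 yF] := bush_y_bounds w.
rewrite /part riesz_sum // => [i _|]; first by apply: F_ge0; exact: bush_set_meas.
by rewrite -(bush_additive w F_add).
Qed.

Lemma bush_part_ge0 w i : 0 ⊑ part w i.
Proof.
have [y0 yF] := bush_y_bounds w.
by apply: riesz_part_ge0 => //; apply: F_ge0; exact: bush_set_meas.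
Qed.

Lemma bush_eta_mes_ge0 n k (r : label) : 0 ⊑ (eta n * mes (cell r k)) *: u.
Proof.
apply: vscale_ge0; last exact: u_ge0.
apply: mulr_ge0; last by apply: mes_ge0; exact: measurable_cell.
by apply: ltW; rewrite /eta; case: (svalP (lev n)).
Qed.

Lemma bush_y_le_part w i : y (rcons w i) ⊑ part w i.
Proof.
rewrite bush_y_rcons; case: ifP => _; last exact: bush_part_ge0.
apply: vpos_least; last exact: bush_part_ge0.
by apply: (vle_by (bush_eta_mes_ge0 (size w) (code (rcons w i)) (p (size (rcons w i))))); rewrite /part /J; vlin.
Qed.

Lemma bush_y_dec w i : y (rcons w i) ⊑ y w.
Proof.
have [im|mi] := ltnP i (m (size w)); last first.
  by rewrite bush_y_rcons ltnNge mi; have [] := bush_y_bounds w.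
apply: vle_trans (bush_y_le_part w i) _; rewrite -(bush_part_sum w) (bigD1 (Ordinal im)) //=.
apply: (@vle_by _ _ _ _ _ 0 (\sum_(j < m (size w) | j != Ordinal im) part w j)); last by vlin.
by apply: vsum_ge0 => j _; exact: bush_part_ge0.
Qed.

Lemma bush_y_out w i : (m (size w) <= i)%N -> y (rcons w i) = 0.
Proof. by move=> mi; rewrite bush_y_rcons ltnNge mi. Qed.

Lemma bush_y_invalid w : ~~ valid w -> y w = 0.
Proof.
elim/last_ind: w => // w i IH; rewrite bush_valid_rcons negb_and => /orP[/IH yw|].
  by apply: vle_anti; [rewrite -yw; exact: bush_y_dec|have [] := bush_y_bounds (rcons w i)].
by rewrite -leqNgt; exact: bush_y_out.
Qed.

(** On a good cell the vector is [(part - c u)^+] with [c = eta mes]. By [vpos_scaled_inf] its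
    multiples meet [u] below [c^-1 F], independently of [N]. As [eta <= 1], also [u] is below
    [c^-1 mes u]. What remains is [c^-1] times the infimum in [good_cell], of norm at most [del]. *)
Lemma bush_small w (N : nat) : (0 < size w)%N -> `|vinf (N%:R *: y w) u| <= 2^-1 ^+ size w.
Proof.
have e0 : `|vinf (N%:R *: 0) u| <= 2^-1 ^+ size w.
  by rewrite scaler0 vinf_l ?normr0; [exact: ltW (half_pow_gt0 _)|exact: u_ge0].
case/lastP: w e0 => // w i e0 _; rewrite bush_y_rcons; case: ifP => // /andP[im gd].
have [eta0 eta1 _ _] := svalP (lev (size w)); rewrite -/(eta (size w)) in eta0 eta1.
set n := size w in eta0 eta1 gd *.
have mJ : 0 <= mes (J (rcons w i)) by apply: mes_ge0; exact: bush_set_meas.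
have [z0 zF] : 0 ⊑ part w i /\ part w i ⊑ F (J (rcons w i)).
  by split; [exact: bush_part_ge0|exact: riesz_part_le].
rewrite -/(part w i).
move: gd; rewrite /good_cell.
have -> : cell (p n.+1) (code (rcons w i)) = J (rcons w i) by rewrite /J size_rcons.
(* On a null cell one cannot divide by [c]; there the part vanishes by absolute continuity. *)
move: mJ; rewrite le_eqVlt => /orP[/eqP mJ0|mJ gd].
  move=> _; have -> : part w i = 0.
    apply: norm_eq0_small => e e1; have [dl dl0 h] := nu_ac e1.
    apply: le_trans (norm_vle hL z0 zF) _; apply: le_trans (F_nu (bush_set_meas _)) _.
    by apply: h; [exact: bush_set_meas|rewrite -mJ0 ltW].
  by rewrite -mJ0 mulr0 scale0r subr0 vpos_id //; exact: vlexx.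
pose c := eta n * mes (J (rcons w i)); have c0 : 0 < c by exact: mulr_gt0.
have ci : 0 <= c^-1 by rewrite invr_ge0 ltW.
have cc : c * c^-1 = 1 by rewrite mulfV //; exact: lt0r_neq0.
have Nc : 0 <= N%:R * c by apply: mulr_ge0 => //; exact: ltW.
have -> : N%:R *: vpos (part w i - c *: u) = (N%:R * c) *: vpos (c^-1 *: part w i - u).
  rewrite -scalerA -vposZ; last exact: ltW.
  by rewrite scalerBr scalerA cc scale1r.
apply: le_trans (_ : `|c^-1 *: vinf (F (J (rcons w i))) (mes (J (rcons w i)) *: u)| <= _).
  apply: (norm_vle hL).
    apply: vinf_ge0; last exact: u_ge0.
    by apply: vscale_ge0 => //; exact: vpos_ge0.
  rewrite -(vinfZ L (F (J (rcons w i))) (mes (J (rcons w i)) *: u) ci).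
  apply: vinf_greatest.
    apply: vle_trans (vpos_scaled_inf Nc _ u_ge0) (vle_scale ci zF).
    exact: vscale_ge0.
  apply: vle_trans (vinf_lbr _ _) _; rewrite scalerA -{1}(scale1r u).
  apply: vscale_le; last exact: u_ge0.
  have -> : c^-1 * mes (J (rcons w i)) = (eta n)^-1.
    by rewrite /c; field; rewrite !lt0r_neq0.
  by rewrite invf_ge1.
rewrite normrZ ger0_norm //.
apply: le_trans (ler_wpM2l ci gd) _.
have -> : c^-1 * (eta n * del n * mes (J (rcons w i))) = del n.
  by rewrite /c; field; rewrite !lt0r_neq0.
by rewrite size_rcons.
Qed.

Fixpoint bush_nodes (n : nat) : seq (seq nat) :=
  if n is k.+1 then [seq rcons w i | w <- bush_nodes k, i <- iota 0 (m k)] else [:: [::]].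

Lemma bush_nodes_sum (V : nmodType) n (h : seq nat -> V) :
  \sum_(w <- bush_nodes n.+1) h w = \sum_(w <- bush_nodes n) \sum_(i < m n) h (rcons w i).
Proof.
rewrite /= big_allpairs_dep; apply: eq_bigr => w _.
have -> : iota 0 (m n) = index_iota 0 (m n) by rewrite /index_iota subn0.
by rewrite big_mkord.
Qed.

Lemma bush_nodes_size n w : w \in bush_nodes n -> size w = n.
Proof.
elim: n w => [|n IH] w /=; first by rewrite inE => /eqP->.
by move=> /allpairsP[[w' i] /= [/IH sw _ ->]]; rewrite size_rcons sw.
Qed.

Lemma bush_nodes_codes (V : nmodType) n (h : nat -> V) :
  \sum_(w <- bush_nodes n) h (code w) = \sum_(k <- rng (p n)) h k.
Proof.
elim: n h => [|n IH] h; first by rewrite !big_seq1.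
rewrite bush_nodes_sum [rng (p n.+1)]/= (sum_pair (p n) (q n)) -IH.
rewrite big_seq [RHS]big_seq; apply: eq_bigr => w /bush_nodes_size sw.
rewrite -bush_sum_codes; apply: eq_bigr => i _; by rewrite bush_code_rcons sw.
Qed.

Fixpoint bush_S (n : nat) (w : seq nat) : X :=
  if n is k.+1 then \sum_(i < m (size w)) bush_S k (rcons w i) else y w.
Local Notation S := bush_S.

Lemma bush_S_ge0 n w : 0 ⊑ S n w.
Proof.
elim: n w => [|n IH] w /=; first by have [] := bush_y_bounds w.
by apply: vsum_ge0.
Qed.

Lemma bush_S_dec n w : S n.+1 w ⊑ S n w.
Proof.
elim: n w => [|n IH] w; last by apply: vle_sum => i _; exact: IH.
rewrite /= -(bush_part_sum w); apply: vle_sum => i _; exact: bush_y_le_part.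
Qed.

Lemma bush_S_nodes n k : \sum_(w <- bush_nodes n) S k w = \sum_(w <- bush_nodes (n + k)) y w.
Proof.
elim: k n => [|k IH] n; first by rewrite addn0.
rewrite addnS -addSn -IH bush_nodes_sum big_seq [RHS]big_seq.
by apply: eq_bigr => w /bush_nodes_size sw /=; rewrite sw.
Qed.

(** A good cell loses at most [eta mes u], a bad one at most its whole [F]; [bush_level] bounds the
    total of either kind by half of the right-hand side. *)
Lemma bush_loss n : `|S n [::] - S n.+1 [::]| <= `|f| * 2^-1 ^+ n.+2.
Proof.
have e k : S k [::] = \sum_(w <- bush_nodes k) y w.
  by have := bush_S_nodes 0 k; rewrite big_seq1 add0n.
rewrite !e bush_nodes_sum -sumrB.
have [eta0 eta1 h1 h2] := svalP (lev n).
rewrite -/(eta n) -/(q n) in eta0 eta1 h1 h2.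
have {}h2 := h2 (p n).
pose r := p n.+1; rewrite -[pairl (p n) (q n)]/r in h2.
pose g k := good_cell (eta n) (del n) r k.
pose bd k := if g k then (eta n * mes (cell r k)) *: u else F (cell r k).
have bd0 k : 0 ⊑ bd k.
  by rewrite /bd; case: ifP => _; [exact: bush_eta_mes_ge0|apply: F_ge0; exact: measurable_cell].
have le1 : \sum_(w <- bush_nodes n) (y w - \sum_(i < m n) y (rcons w i)) ⊑
    \sum_(k <- rng r) bd k.
  rewrite -(bush_nodes_codes n.+1) bush_nodes_sum; apply: vle_sum_seq => w /bush_nodes_size sw _.
  rewrite -{1}(bush_part_sum w) sw -sumrB; apply: vle_sum => i _.
  rewrite bush_y_rcons sw ltn_ord /= /bd /g.
  have eJ : J (rcons w i) = cell r (code (rcons w i)) by rewrite /J size_rcons sw.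
  case: ifP => _; last by rewrite subr0 -eJ; exact: riesz_part_le.
  by apply: (vle_by (vpos_ge (part w i - (eta n * mes (J (rcons w i))) *: u))); rewrite eJ /part; vlin.
have ge1 : 0 ⊑ \sum_(w <- bush_nodes n) (y w - \sum_(i < m n) y (rcons w i)).
  rewrite big_seq; apply: vsum_ge0 => w /bush_nodes_size sw; apply: vsub_ge0.
  by rewrite -(bush_part_sum w) sw; apply: vle_sum => i _; exact: bush_y_le_part.
apply: le_trans (norm_vle hL ge1 le1) _.
rewrite (bigID g) /=.
apply: le_trans (ler_normD _ _) _.
have -> : `|f| * 2^-1 ^+ n.+2 = `|f| * 2^-1 ^+ n.+2 / 2 + `|f| * 2^-1 ^+ n.+2 / 2 by lra.
apply: lerD.
  under eq_bigr => k gk do rewrite /bd gk.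
  rewrite -scaler_suml -mulr_sumr normrZ.
  have s0 : 0 <= \sum_(k <- rng r | g k) mes (cell r k).
    by apply: sumr_ge0 => k _; apply: mes_ge0; exact: measurable_cell.
  rewrite ger0_norm; last by apply: mulr_ge0 => //; exact: ltW.
  apply: le_trans h1; apply: ler_wpM2r => //; apply: ler_wpM2l; first exact: ltW.
  rewrite (fadd_total r mes_add) [leRHS](bigID g) /= lerDl.
  by apply: sumr_ge0 => k _; apply: mes_ge0; exact: measurable_cell.
apply: le_trans (ler_norm_sum _ _ _) _; apply: le_trans h2.
apply: ler_sum => k gk; rewrite /bd (negbTE gk); apply: F_nu; exact: measurable_cell.
Qed.

(* The vectors [y w] exceed [eta * mes * u] on their cells and lose little mass at
   each subdivision, so the sums of [y] over the descendants of a node decrease to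
   an additive family, which is nonzero since the total loss is at most [|f| / 2]. *)
Lemma bush_tree : exists m v M a,
  [/\ forall w, 0 ⊑ v w, forall w i, v (rcons w i) ⊑ v w, v [::] ⊑ u,
    forall w (N : nat), (0 < size w)%N -> `|vinf (N%:R *: v w) u| <= 2^-1 ^+ size w &
    tree_set L m v M a /\ a != 0].
Proof.
have ex w : exists l, seqlim (fun n => S n w) l /\ (0 ⊑ l /\ forall n, l ⊑ S n w).
  have [l l1 l2] := KB_decr hL kb (fun n => bush_S_dec n w) (fun n => bush_S_ge0 n w).
  by exists l.
pose b w := sval (cid (ex w)).
have hb w : [/\ seqlim (fun n => S n w) (b w), 0 ⊑ b w & forall n, b w ⊑ S n w].
  by have [h1 [h2 h3]] := svalP (cid (ex w)).
exists m, y, (nu setT), (b [::]); split.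
- by move=> w; have [] := bush_y_bounds w.
- exact: bush_y_dec.
- exact: F_u.
- exact: bush_small.
split; last first.
  apply/eqP => b0.
  have key n : `|f - S n [::]| <= `|f| * (\sum_(0 <= k < n) 2^-1 ^+ k) / 4.
    elim: n => [|n IH]; first by rewrite big_geq // mulr0 mul0r /= subrr normr0.
    rewrite big_nat_recr //=; have := bush_loss n.
    have -> : f - S n.+1 [::] = (f - S n [::]) + (S n [::] - S n.+1 [::]) by vlin.
    move=> h; apply: le_trans (ler_normD _ _) _; move: h IH; rewrite !exprS.
    by set a1 := \sum_(0 <= _ < _) _; set a2 := 2^-1 ^+ n; lra.
  have h : `|f - b [::]| <= `|f| / 2.
    apply: (seqlim_norm_le (seqlimB (seqlim_cst f) (let: And3 h _ _ := hb [::] in h))).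
    exists 0%N => n _; apply: le_trans (key n) _.
    have := sum_half_pow_le (R := R) 0 n; rewrite expr0.
    by have := normr_ge0 f; nra.
  by move: h; rewrite b0 subr0; have := f_gt0; lra.
have by_ w : b w ⊑ y w by have [_ _ h] := hb w; exact: (h 0%N).
have inv0 w : ~~ valid w -> b w = 0.
  move=> iv; have [_ b0 _] := hb w; apply: (vle_anti _ b0).
  by have := by_ w; rewrite (bush_y_invalid iv).
exists b, (fun w => if valid w then nu (J w) else 0); split; last by rewrite vabs_id //; have [] := hb [::].
have nu0 w : 0 <= nu (J w) by apply: le_trans (normr_ge0 _) (F_nu (bush_set_meas w)).
split.
- by move=> w; have [] := hb w.
- by move=> w; apply: (band_le hL (by_ w)); exact: band_refl.
- move=> w; have [h _ _] := hb w; apply: seqlim_uniq (_ : seqlim (fun n => S n.+1 w) _).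
    by have := (seqlim_shift _ _ 1).1 h; under eq_fun do rewrite addn1.
  by apply: seqlim_sum => i; have [] := hb (rcons w i).
- by move=> w i mi; apply: inv0; rewrite bush_valid_rcons negb_and -leqNgt mi orbT.
- move=> w; case: ifPn => [_|/inv0 ->]; last by rewrite normr0.
  have [y0 yF] := bush_y_bounds w.
  apply: le_trans (F_nu (bush_set_meas w)); apply: (norm_vle hL); first by have [] := hb w.
  exact: vle_trans (by_ w) yF.
- move=> w; case: ifPn => vw.
    rewrite (bush_additive w nu_add); apply: eq_bigr => i _.
    by rewrite bush_valid_rcons vw ltn_ord.
  by rewrite big1 // => i _; rewrite bush_valid_rcons (negbTE vw).
- by move=> w i mi; rewrite bush_valid_rcons ltnNge mi andbF.
- by rewrite bush_set_nil.
Qed.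

End Bush.

(** * Singular and order bounded parts of a positive measure *)

Section SingularPart.
Context (d : measure_display) (T : measurableType d).
Variables (R : realType) (X : completeNormedModType R) (L : vector_lattice X).
Hypothesis hL : lattice_norm L.
Hypothesis kb : KB L.
Local Notation "x ⊑ y" := (vle L x y) (at level 70).
Local Notation vpos := (vpos L).
Local Notation vinf := (vinf L).
Local Notation vabs := (vabs L).
Local Notation label := (label T).
Local Notation cell_sum := (cell_sum (T := T)).
Ltac vlin := vlin_with R X.

Lemma vle_approx y z : (forall e : R, 0 < e -> exists2 x, x ⊑ z & `|y - x| <= e) -> y ⊑ z.
Proof.
move=> h; apply: vge0_sub; apply: (vge0_approx hL) => e e0; have [x xz hx] := h e e0.
exists (z - x); first exact: vsub_ge0.
have -> : z - y - (z - x) = - (y - x) by vlin.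
by rewrite normrN.
Qed.

Variables (mes : set T -> R).
Hypothesis mes_add : fadd mes.
Hypothesis mes_ge0 : forall E, measurable E -> 0 <= mes E.

Lemma mes_cell_ge0 (p : label) k : 0 <= mes (cell p k).
Proof. by apply: mes_ge0; exact: measurable_cell. Qed.

Section PosPartSub.
Variables (F : set T -> X) (w : X).
Hypothesis F_add : fadd F.
Hypothesis F_ge0 : forall E, measurable E -> 0 ⊑ F E.
Hypothesis w0 : 0 ⊑ w.

Definition excess (c : R) (E : set T) : X := vpos (F E - (c * mes E) *: w).

Lemma excess_sum_le (c : R) (p : label) E : 0 <= c -> measurable E ->
  cell_sum (excess c) p E ⊑ F E.
Proof.
move=> c0 mE; rewrite (fadd_label p F_add mE); apply: vle_sum => k _.
have mEk : measurable (E `&` cell p k) by apply: measurableI => //; exact: measurable_cell.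
apply: vpos_least; last exact: F_ge0.
have h : 0 ⊑ (c * mes (E `&` cell p k)) *: w by apply: vscale_ge0 => //; apply: mulr_ge0 => //; exact: mes_ge0.
by apply: (vle_by h); vlin.
Qed.

(** The positive part of the charge [F - c mes w]; it stays below [F] because the excess does so on
    every cell. *)
Lemma excess_measure (c : R) : 0 <= c -> exists P : set T -> X, [/\ fadd P,
    forall p E, measurable E -> cell_sum (excess c) p E ⊑ P E,
    forall E, measurable E -> F E - (c * mes E) *: w ⊑ P E,
    forall E (e : R), measurable E -> 0 < e ->
      exists p, forall q, `|P E - cell_sum (excess c) (pairl p q) E| <= e &
    forall E, measurable E -> 0 ⊑ P E /\ P E ⊑ F E].
Proof.
move=> c0.
pose D E := F E - (c * mes E) *: w.
have hD : fadd D.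
  by move=> A B mA mB AB; rewrite /D F_add // mes_add //; vlin.
have [|P [P1 P2 P3 P4]] := pos_part_measure hL kb hD.
  exists `|F setT| => p; apply: (norm_vle hL); last exact: (excess_sum_le p c0 measurableT).
  by apply: vsum_ge0 => k _; exact: vpos_ge0.
exists P; split => //.
  by move=> E mE; apply: vle_trans (vpos_ge _) (P3 E mE).
move=> E mE; split; first by apply: vle_trans (vpos_ge0 _) (P3 E mE).
apply: vle_approx => e e0; have [p hp] := P4 E e mE e0.
by exists (cell_sum (excess c) (pairl p (triv_label T)) E) => //; exact: excess_sum_le.
Qed.
End PosPartSub.

Section Singular.
Variables (F : set T -> X).
Hypothesis F_add : fadd F.
Hypothesis F_ge0 : forall E, measurable E -> 0 ⊑ F E.
Let u := F setT.
Let u0 : 0 ⊑ u. Proof. by apply: F_ge0. Qed.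

(* F' is the part of F disjoint from every multiple of [mes *: u], obtained as
   the decreasing limit of H_k = (F - k mes u)^+. *)
Lemma singular_part : exists (H : nat -> set T -> X) (F' : set T -> X),
  [/\ forall k, fadd (H k) /\ forall E, measurable E ->
        [/\ 0 ⊑ H k E, H k E ⊑ F E, F E - (k%:R * mes E) *: u ⊑ H k E & H k.+1 E ⊑ H k E],
    forall E, measurable E -> seqlim (fun k => H k E) (F' E),
    fadd F',
    forall E, measurable E -> 0 ⊑ F' E /\ F' E ⊑ F E &
    forall e : R, 0 < e -> exists q : label, forall p : label,
  `|\sum_(k <- rng (pairl p q)) vinf (F' (cell (pairl p q) k)) (mes (cell (pairl p q) k) *: u)| <= e].
Proof.
have ex (k : nat) := cid (excess_measure F_add F_ge0 u0 (ler0n R k)).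
pose H k := sval (ex k).
have hH k := svalP (ex k).
have Hdec k E : measurable E -> H k.+1 E ⊑ H k E.
  move=> mE; have [_ _ _ h4 _] := hH k.+1; have [_ h2 _ _ _] := hH k.
  apply: vle_approx => e e0; have [p hp] := h4 E e mE e0.
  exists (cell_sum (excess F u k.+1%:R) (pairl p (triv_label T)) E) => //.
  apply: vle_trans (h2 (pairl p (triv_label T)) E mE); apply: vle_sum => j _; apply: vpos_mono.
  set A := E `&` _; have mA : measurable A by apply: measurableI => //; exact: measurable_cell.
  have h := vscale_ge0 (mes_ge0 mA) u0.
  by apply: (vle_by h); rewrite -[k.+1]addn1 natrD; vlin.
have H0 k E : measurable E -> 0 ⊑ H k E by move=> mE; have [_ _ _ _ h] := hH k; case: (h E mE).
have lim E : {l : X | measurable E -> seqlim (fun k => H k E) l /\ (0 ⊑ l /\ forall k, l ⊑ H k E)}.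
  apply: cid; have [mE|nE] := pselect (measurable E); last by exists 0.
  by have [l l1 l2] := KB_decr hL kb (fun k => Hdec k E mE) (fun k => H0 k E mE); exists l.
pose F' E := sval (lim E).
have hF' E : measurable E -> [/\ seqlim (fun k => H k E) (F' E), 0 ⊑ F' E & forall k, F' E ⊑ H k E].
  by move=> mE; have [h1 [h2 h3]] := svalP (lim E) mE.
have F'add : fadd F'.
  move=> A B mA mB AB; have [h1 _ _] := hF' _ (measurableU _ _ mA mB).
  have [hA _ _] := hF' _ mA; have [hB _ _] := hF' _ mB.
  apply: (seqlim_uniq h1).
  have := seqlimD hA hB; congr (seqlim _ _); apply/funext => k.
  by have [h _ _ _ _] := hH k; rewrite -h.
exists H, F'; split=> //.
- move=> k; have [h1 h2 h3 h4 h5] := hH k; split=> // E mE; have [a b] := h5 E mE; split=> //.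
    exact: h3.
  exact: Hdec.
- by move=> E /hF' [].
- by move=> E mE; have [_ a b] := hF' E mE; split=> //; apply: vle_trans (b 0%N) _; have [_ _ _ _ h5] := hH 0%N; case: (h5 E mE).
move=> e e0; have e2 : 0 < e / 2 by lra.
have [hl l0 ll] := hF' _ (@measurableT _ T).
have [k hk] := hl _ e2; have {}hk := hk k (leqnn k).
have [_ h2 _ h4 _] := hH k.+1; have [q0 hq0] := h4 setT _ measurableT e2.
(* The trivial factor gives the partition the form [pairl q0 _] to which [hq0] applies. *)
exists (pairl q0 (triv_label T)) => p; set q := pairl q0 _; set r := pairl p q.
have csr : cell_sum (excess F u k.+1%:R) q setT ⊑ cell_sum (excess F u k.+1%:R) r setT.
  apply: cell_sum_pairr => //.
  - rewrite /excess (fadd0 F_add) (fadd0 mes_add) mulr0 scale0r subr0 vpos_id //; exact: vlexx.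
  - move=> A B mA mB AB; rewrite /excess F_add // mes_add //.
    have -> : F A + F B - (k.+1%:R * (mes A + mes B)) *: u =
      (F A - (k.+1%:R * mes A) *: u) + (F B - (k.+1%:R * mes B) *: u) by vlin.
    exact: vpos_subD.
have i0 : 0 ⊑ \sum_(j <- rng r) vinf (F' (cell r j)) (mes (cell r j) *: u).
  apply: vsum_ge0 => j _; have [_ h _] := hF' _ (measurable_cell r j).
  by apply: vinf_ge0 => //; apply: vscale_ge0 => //; exact: mes_cell_ge0.
(* On a cell [F - (k+1) mes u] is below [H k - mes u], so its positive part is at most
   [(F' - mes u)^+ + (H k - F')]. Summed, this bounds the infima, which are [F' - (F' - mes u)^+],
   by two differences that are small for this [k] and [q]. *)
have key : \sum_(j <- rng r) vinf (F' (cell r j)) (mes (cell r j) *: u) ⊑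
    (H k.+1 setT - cell_sum (excess F u k.+1%:R) q setT) + (H k setT - F' setT).
  have a1 : \sum_(j <- rng r) vinf (F' (cell r j)) (mes (cell r j) *: u) =
     F' setT - \sum_(j <- rng r) vpos (F' (cell r j) - mes (cell r j) *: u).
    by rewrite (fadd_total r F'add) -sumrB.
  have Hadd : fadd (H k) by case: (hH k).
  have a2 : cell_sum (excess F u k.+1%:R) r setT ⊑
     \sum_(j <- rng r) vpos (F' (cell r j) - mes (cell r j) *: u) + (H k setT - F' setT).
    rewrite (fadd_total r F'add) (fadd_total r Hadd) -sumrB -big_split /=.
    apply: vle_sum => j _; rewrite /excess setTI.
    set A := cell r j; have mA : measurable A by exact: measurable_cell.
    have [_ f1 f2] := hF' A mA; have {}f2 := f2 k.
    apply: vpos_least.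
      have [_ _ h3 _ _] := hH k; have {}h3 := h3 A mA.
      by apply: (vle_by (vleD h3 (vpos_ge (F' A - mes A *: u)))); rewrite -[k.+1]addn1 natrD /H; vlin.
    by apply: vaddr_ge0; [exact: vpos_ge0|exact: vsub_ge0].
  rewrite a1; have a3 := ll k.+1.
  by apply: (vle_by (vleD (vleD a2 csr) a3)); vlin.
apply: le_trans (norm_vle hL i0 key) _.
apply: le_trans (ler_normD _ _) _.
by apply: le_trans (lerD (hq0 (triv_label T)) hk) _; lra.
Qed.
End Singular.

Section OrderBounded.
Variables (G : set T -> X) (w : X).
Hypothesis G_add : fadd G.
Hypothesis G_bnd : forall E, measurable E -> 0 ⊑ G E /\ G E ⊑ mes E *: w.
Hypothesis w0 : 0 ⊑ w.

Let G_ge0 E : measurable E -> 0 ⊑ G E. Proof. by move=> /G_bnd []. Qed.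

(** On a null cell the inverse is 0 by convention; [G] vanishes there too, so [avg_val_mes] holds on
    every cell. *)
Definition avg_val (p : label) (a : nat) : X := (mes (cell p a))^-1 *: G (cell p a).

Lemma avg_val_bnd p a : 0 ⊑ avg_val p a /\ avg_val p a ⊑ w.
Proof.
have [g0 g1] := G_bnd (measurable_cell p a).
have i0 : 0 <= (mes (cell p a))^-1 by rewrite invr_ge0; exact: mes_cell_ge0.
split; first exact: vscale_ge0.
apply: vle_trans (vle_scale i0 g1) _; rewrite scalerA.
have [->|n0] := eqVneq (mes (cell p a)) 0; first by rewrite mulr0 scale0r.
by rewrite mulVf // scale1r; exact: vlexx.
Qed.

Lemma avg_val_mes p a : mes (cell p a) *: avg_val p a = G (cell p a).
Proof.
rewrite /avg_val scalerA.
have [e|n0] := eqVneq (mes (cell p a)) 0; last by rewrite mulfV // scale1r.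
rewrite e mul0r scale0r; have [g0 g1] := G_bnd (measurable_cell p a).
by apply: (vle_anti g0); move: g1; rewrite e scale0r.
Qed.

Lemma excess_subadd (c : R) : subadd L (excess G w c).
Proof.
move=> A B mA mB AB; rewrite /excess G_add // mes_add //.
have -> : G A + G B - (c * (mes A + mes B)) *: w =
  (G A - (c * mes A) *: w) + (G B - (c * mes B) *: w) by vlin.
exact: vpos_subD.
Qed.

Lemma excess_set0 (c : R) : excess G w c set0 = 0.
Proof. by rewrite /excess (fadd0 G_add) (fadd0 mes_add) mulr0 scale0r subr0 vpos_id //; exact: vlexx. Qed.

(** A common refinement nearly attains the first [N] suprema given by [excess_measure], so refining
    it further cannot increase these sums by much. *)
Lemma saturating_label (c : nat -> R) (N : nat) (e : R) : (forall k, 0 <= c k) -> 0 < e ->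
  exists p : label, forall k, (k < N)%N -> forall r : label,
    `|cell_sum (excess G w (c k)) (pairl p r) setT - cell_sum (excess G w (c k)) p setT| <= e.
Proof.
move=> c0 e0.
have ex (k : nat) := cid (excess_measure G_add G_ge0 w0 (c0 k)).
pose P k := sval (ex k).
have hP k := svalP (ex k).
have mono k p q : cell_sum (excess G w (c k)) p setT ⊑ cell_sum (excess G w (c k)) q setT ->
   `|P k setT - cell_sum (excess G w (c k)) q setT| <= `|P k setT - cell_sum (excess G w (c k)) p setT|.
  move=> h; apply: (norm_vle hL).
    by apply: vsub_ge0; have [_ h2 _ _ _] := hP k; apply: h2.
  by apply: (vle_by h); vlin.
have [p hp] : exists p : label, forall k, (k < N)%N ->
    `|P k setT - cell_sum (excess G w (c k)) p setT| <= e.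
  elim: N => [|N [p hp]]; first by exists (triv_label T).
  have [_ _ _ h4 _] := hP N; have [q hq] := h4 setT e measurableT e0.
  exists (pairl q p) => k; rewrite ltnS leq_eqVlt => /orP[/eqP->|kN]; first exact: hq.
  apply: le_trans (hp k kN); apply: mono; apply: cell_sum_pairr => //; [exact: excess_set0|exact: excess_subadd].
exists p => k kN r; apply: le_trans (hp k kN); apply: (norm_vle hL).
  apply: vsub_ge0; apply: cell_sum_pairl => //; [exact: excess_set0|exact: excess_subadd].
by have [_ h2 _ _ _] := hP k; have h := h2 (pairl p r) setT measurableT; apply: (vle_by h); rewrite /P; vlin.
Qed.

(* Total variation of G minus its average on the cells of p; small on all
   refinements once p nearly saturates the convex functionals (G - c w mes)^+. *)
Lemma order_bounded_approx (e : R) : 0 < e -> exists p : label, forall r : label,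
  \sum_(b <- rng r) `|G (cell r b) - \sum_(a <- rng p) mes (cell r b `&` cell p a) *: avg_val p a| <= e.
Proof.
move=> e0.
have mT : 0 <= mes setT by exact: mes_ge0.
pose K := 1 + mes setT * `|w|.
have K1 : 1 <= K by rewrite /K lerDl mulr_ge0.
pose n := Num.bound (4 * K / e).
have n1 := natr1_gt0 R n.
have hn : 2 / n.+1%:R * (mes setT * `|w|) <= e / 2.
  have h1 : 0 <= 4 * K / e by apply: divr_ge0; lra.
  have := archi_boundP h1; rewrite -/n ltr_pdivrMr // => h2.
  rewrite mulrAC ler_pdivrMr // -[n.+1]addn1 natrD.
  have : 0 <= n%:R :> R by []. 
  move: h2; rewrite /K; nra.
pose c (k : nat) : R := k%:R / n.+1%:R.
have c0 k : 0 <= c k by exact: divr_ge0.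
(* [e1] and [tau] make the [n + 2] gap sums total at most [e / 8], hence [e / 2] after the factor 4
   of [interval_grid]. The other [e / 2] is the mesh term. *)
pose e1 := e / (16 * (n.+2%:R * (mes setT + 1))).
have n2 := natr1_gt0 R n.+1.
have e10 : 0 < e1 by apply: divr_gt0 => //; apply: mulr_gt0 => //; apply: mulr_gt0 => //; lra.
have [C C0 hC] := norm_sum_interval hL kb w0 e10.
pose tau := e / (16 * (n.+2%:R * (C + 1))).
have tau0 : 0 < tau by apply: divr_gt0 => //; apply: mulr_gt0 => //; apply: mulr_gt0 => //; lra.
have [p hp] := saturating_label n.+2 c0 tau0.
exists p => r; set s := pairl p r.
pose aJ a b := mes (cell s (pair_code a b)) *: avg_val p a.
pose gJ a b := G (cell s (pair_code a b)).
pose mJ a b := mes (cell s (pair_code a b)).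
have mJ0 a b : 0 <= mJ a b by exact: mes_cell_ge0.
have g_bnd a b : 0 ⊑ gJ a b /\ gJ a b ⊑ mJ a b *: w by exact: (G_bnd (measurable_cell _ _)).
have a_bnd a b : 0 ⊑ aJ a b /\ aJ a b ⊑ mJ a b *: w.
  have [h1 h2] := avg_val_bnd p a.
  by split; [exact: (vscale_ge0 (mJ0 a b) h1)|exact: (vle_scale (mJ0 a b) h2)].
have mes_cellD (D : set T -> R) a : fadd D -> D (cell p a) = \sum_(b <- rng r) D (cell s (pair_code a b)).
  move=> hD; rewrite (fadd_label r hD (measurable_cell p a)); apply: eq_bigr => b _; by rewrite cell_pair.
have G_cellD a : G (cell p a) = \sum_(b <- rng r) gJ a b.
  rewrite (fadd_label r G_add (measurable_cell p a)); apply: eq_bigr => b _; by rewrite /gJ cell_pair.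
apply: le_trans (_ : \sum_(a <- rng p) \sum_(b <- rng r) `|gJ a b - aJ a b| <= _).
  rewrite exchange_big; apply: ler_sum => b _.
  rewrite (fadd_label p G_add (measurable_cell r b)) -sumrB.
  apply: le_trans (ler_norm_sum _ _ _) _; apply: ler_sum => a _.
  by rewrite /gJ /aJ cell_pair (setIC (cell r b)).
pose gam k a b := vgap L (gJ a b - c k *: (mJ a b *: w)) (aJ a b - c k *: (mJ a b *: w)).
(* On a cell of [p] the mean of [G] and of its averaged version has the same total as [G], so its
   excess over the refinement is at least that over [p]. Hence the gaps add up to at most the
   increase of the excess under refinement, whose norm [hp] bounds by [tau]; [hC] turns this into a
   bound for the sum of norms. *)
have gsum k : (k < n.+2)%N -> \sum_(a <- rng p) \sum_(b <- rng r) `|gam k a b| <= e1 * mes setT + C * tau.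
  move=> kn.
  have gle a b : gam k a b ⊑ mJ a b *: w.
    have cw : 0 ⊑ c k *: (mJ a b *: w) by apply: vscale_ge0 => //; apply: vscale_ge0.
    have [g0 g1] := g_bnd a b; have [a0 a1] := a_bnd a b.
    by apply: vgap_le; [exact: vscale_ge0|apply: (vle_by (vleD g1 cw))|apply: (vle_by (vleD a1 cw))]; vlin.
  have h1 := hC _ [seq (a, b) | a <- rng p, b <- rng r] predT (fun ab => mJ ab.1 ab.2) (fun ab => gam k ab.1 ab.2)
     (fun ab _ => mJ0 ab.1 ab.2) (fun ab _ => conj (vgap_ge0 _ _) (gle ab.1 ab.2)).
  rewrite !big_allpairs_dep /= in h1.
  have eM : \sum_(a <- rng p) \sum_(b <- rng r) mJ a b = mes setT.
    by rewrite (fadd_total p mes_add); apply: eq_bigr => a _; rewrite (mes_cellD _ _ mes_add).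
  rewrite eM in h1; apply: le_trans h1 _; rewrite lerD2l; apply: ler_wpM2l => //.
  apply: le_trans (hp k kn r); apply: (norm_vle hL).
    by apply: vsum_ge0 => a _; apply: vsum_ge0 => b _; exact: vgap_ge0.
  rewrite /cell_sum -/s sum_pair -sumrB; apply: vle_sum => a _.
  have ea : \sum_(b <- rng r) vpos (aJ a b - c k *: (mJ a b *: w)) = excess G w (c k) (setT `&` cell p a).
    rewrite /excess setTI -(avg_val_mes p a).
    have -> : mes (cell p a) *: avg_val p a - (c k * mes (cell p a)) *: w =
      mes (cell p a) *: (avg_val p a - c k *: w) by vlin.
    rewrite vposZ; last exact: mes_cell_ge0.
    rewrite (mes_cellD _ _ mes_add) scaler_suml; apply: eq_bigr => b _.
    rewrite -vposZ; last exact: mes_cell_ge0.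
    by congr vpos; rewrite /aJ /mJ; vlin.
  have eg : \sum_(b <- rng r) vpos (gJ a b - c k *: (mJ a b *: w)) =
      \sum_(b <- rng r) excess G w (c k) (setT `&` cell s (pair_code a b)).
    by apply: eq_bigr => b _; rewrite /excess setTI scalerA.
  have em : excess G w (c k) (setT `&` cell p a) ⊑
     \sum_(b <- rng r) vpos (2^-1 *: (gJ a b - c k *: (mJ a b *: w) + (aJ a b - c k *: (mJ a b *: w)))).
    apply: (vle_trans _ (vpos_sum _ _ _ _)); rewrite /excess setTI.
    suff -> : \sum_(b <- rng r) 2^-1 *: (gJ a b - c k *: (mJ a b *: w) + (aJ a b - c k *: (mJ a b *: w))) =
       G (cell p a) - (c k * mes (cell p a)) *: w by exact: vlexx.
    have e2 : \sum_(b <- rng r) aJ a b = G (cell p a).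
      by rewrite -scaler_suml -(mes_cellD _ _ mes_add) avg_val_mes.
    have e3 : \sum_(b <- rng r) c k *: (mJ a b *: w) = (c k * mes (cell p a)) *: w.
      by rewrite -scaler_sumr -scaler_suml -(mes_cellD _ _ mes_add) scalerA.
    rewrite -scaler_sumr big_split /= !sumrB e2 e3 -G_cellD; vlin.
  rewrite /gam /vgap sumrB big_split /= -!scaler_sumr ea eg.
  have half : 0 <= 2^-1 :> R by lra.
  have up : excess G w (c k) (setT `&` cell p a) ⊑ \sum_(b <- rng r) excess G w (c k) (setT `&` cell s (pair_code a b)).
    have := subadd_label (excess_set0 (c k)) (@excess_subadd (c k)) r (measurable_cell p a).
    rewrite setTI /cell_sum; under [X in _ ⊑ X]eq_bigr do rewrite -cell_pair.
    by under [X in _ -> _ ⊑ X]eq_bigr do rewrite setTI.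
  by apply: (vle_by (vleD em (vle_scale half up))); vlin.
apply: le_trans (_ : \sum_(a <- rng p) \sum_(b <- rng r)
   (4 * (\sum_(k < n.+2) `|gam k a b|) + 2 / n.+1%:R * (mJ a b * `|w|)) <= _).
  apply: ler_sum => a _; apply: ler_sum => b _.
  have [g0 g1] := g_bnd a b; have [a0 a1] := a_bnd a b.
  apply: le_trans (interval_grid hL n g0 a0 g1 a1) _.
  by rewrite normrZ (ger0_norm (mJ0 a b)).
have -> : \sum_(a <- rng p) \sum_(b <- rng r)
   (4 * (\sum_(k < n.+2) `|gam k a b|) + 2 / n.+1%:R * (mJ a b * `|w|)) =
   4 * (\sum_(k < n.+2) \sum_(a <- rng p) \sum_(b <- rng r) `|gam k a b|) + 2 / n.+1%:R * (mes setT * `|w|).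
  rewrite exchange_big /=.
  under [in RHS]eq_bigr do rewrite exchange_big /=.
  rewrite [in RHS]exchange_big /= (fadd_total p mes_add).
  under [X in _ = _ + _ * (X * _)]eq_bigr => a _ do rewrite (mes_cellD _ _ mes_add).
  rewrite [X in _ = _ + _ * (X * _)]exchange_big /=.
  rewrite mulr_suml !mulr_sumr -big_split /=; apply: eq_bigr => b _.
  rewrite [X in _ = 4 * X + _]exchange_big /= mulr_suml !mulr_sumr -big_split /=.
  by apply: eq_bigr => a _.
have h1 : \sum_(k < n.+2) \sum_(a <- rng p) \sum_(b <- rng r) `|gam k a b| <= n.+2%:R * (e1 * mes setT + C * tau).
  apply: le_trans (ler_sum _ (fun (k : 'I_n.+2) _ => gsum k (ltn_ord k))) _.
  by rewrite sumr_const card_ord mulr_natl.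
have h2 : n.+2%:R * (e1 * mes setT) <= e / 16.
  have -> : n.+2%:R * (e1 * mes setT) = e / 16 * (mes setT / (mes setT + 1)).
    by rewrite /e1; field; apply/andP; split; rewrite lt0r_neq0 //; lra.
  have : mes setT / (mes setT + 1) <= 1 by rewrite ler_pdivrMr; lra.
  by nra.
have h3 : n.+2%:R * (C * tau) <= e / 16.
  have -> : n.+2%:R * (C * tau) = e / 16 * (C / (C + 1)).
    by rewrite /tau; field; apply/andP; split; rewrite lt0r_neq0 //; lra.
  have : C / (C + 1) <= 1 by rewrite ler_pdivrMr; lra.
  by nra.
rewrite mulrDr in h1.
apply: le_trans (lerD (ler_wpM2l _ h1) hn) _ => //; lra.
Qed.
End OrderBounded.
End SingularPart.

(** * Bochner densities *)

Section SimpleFunctions.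
Context (d : measure_display) (T : measurableType d).
Variables (R : realType) (X : completeNormedModType R).
Variable mu : {finite_measure set T -> \bar R}.
Local Notation label := (label T).
Ltac vlin := vlin_with R X.

Definition mes (E : set T) : R := fine (mu E).

Lemma mesE E : measurable E -> mu E = (mes E)%:E.
Proof. by move=> mE; rewrite /mes fineK //; exact: fin_num_measure. Qed.

Lemma mes_ge0 E : 0 <= mes E. Proof. by apply: fine_ge0; exact: measure_ge0. Qed.

Lemma mes_add : fadd mes.
Proof.
move=> A B mA mB AB; apply: EFin_inj.
by rewrite EFinD -!mesE //; [rewrite measureU|exact: measurableU].
Qed.

Lemma mes0 : mes set0 = 0. Proof. by rewrite /mes measure0. Qed.

Lemma mes_le A B : measurable A -> measurable B -> A `<=` B -> mes A <= mes B.
Proof. by move=> mA mB AB; rewrite -lee_fin -!mesE //; apply: le_measure; rewrite ?inE. Qed.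

Lemma measurable_label_fun (p : label) (h : nat -> R) : measurable_fun setT (fun t => h (p t)).
Proof.
move=> _ B mB; rewrite setTI.
have -> : (fun t => h (p t)) @^-1` B = [set t | (fun k => `[< B (h k) >]) (p t)].
  by apply/seteqP; split=> t /=; [move=> ?; apply/asboolP|move/asboolP].
exact: (label_pred_meas p (fun k => `[< B (h k) >])).
Qed.

Lemma integral_label_fun (p : label) (h : nat -> R) : (forall k, 0 <= h k) ->
  (\int[mu]_t (h (p t))%:E = (\sum_(k <- rng p) mes (cell p k) * h k)%:E)%E.
Proof.
move=> h0.
have eT : \big[setU/set0]_(i <- rng p) cell p i = setT.
  rewrite -bigcup_seq; apply/seteqP; split=> // t _; exists (p t) => //=; exact: lab_rng.
rewrite -[X in (\int[mu]_(x in X) _)%E]eT ge0_integral_bigsetU //.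
- rewrite -sumEFin; apply: eq_bigr => k _.
  rewrite (eq_integral (cst (h k)%:E)); last by move=> t; rewrite inE /cell /= => ->.
  rewrite (mulrC (mes _)) EFinM -(mesE (measurable_cell p k)).
  exact: (integral_cst mu (measurable_cell p k) (h k)%:E).
- by move=> k; exact: measurable_cell.
- exact: rng_uniq.
- by apply/trivIsetP => i j _ _ ij; apply/seteqP; split=> // t [ti tj]; move/eqP: ij; apply; rewrite -(ti : p t = i) -(tj : p t = j).
- rewrite eT; apply/measurable_EFinP; exact: measurable_label_fun.
- by move=> t _; rewrite lee_fin.
Qed.

Implicit Types s : seq (X * set T).

Lemma simple_repr_cat s s' : simple_repr s -> simple_repr s' -> simple_repr (s ++ s').
Proof. by move=> h h' p; rewrite mem_cat => /orP[/h|/h']. Qed.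

Definition simple_opp s := [seq (- x.1, x.2) | x <- s].

Lemma simple_repr_opp s : simple_repr s -> simple_repr (simple_opp s).
Proof. by move=> h p /mapP[q qs ->] /=; exact: h. Qed.

Lemma simple_eval_cat s s' t : simple_eval (s ++ s') t = simple_eval s t + simple_eval s' t.
Proof. by rewrite /simple_eval big_cat. Qed.

Lemma simple_eval_opp s t : simple_eval (simple_opp s) t = - simple_eval s t.
Proof. by rewrite /simple_eval big_map -sumrN; apply: eq_bigr => p _; rewrite scalerN. Qed.

Lemma simple_int_cat s s' E : simple_int mu (s ++ s') E = simple_int mu s E + simple_int mu s' E.
Proof. by rewrite /simple_int big_cat. Qed.

Lemma simple_int_opp s E : simple_int mu (simple_opp s) E = - simple_int mu s E.
Proof. by rewrite /simple_int big_map -sumrN; apply: eq_bigr => p _; rewrite scalerN. Qed.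

Lemma simple_int_add s : simple_repr s -> fadd (simple_int mu s).
Proof.
move=> hs A B mA mB AB; rewrite /simple_int -big_split /= big_seq [RHS]big_seq.
apply: eq_bigr => p /hs mp; rewrite -scalerDl; congr (_ *: _).
rewrite setIUl; apply: mes_add; try exact: measurableI.
by rewrite setIACA AB set0I.
Qed.

(** The sets in [s] may overlap; refining by the indicator of each makes the function constant on
    the cells of one partition. *)
Lemma simple_label s : simple_repr s -> exists (p : label) (e : nat -> X),
  (forall t, simple_eval s t = e (p t)) /\
  forall E k, measurable E -> simple_int mu s (E `&` cell p k) = mes (E `&` cell p k) *: e k.
Proof.
elim: s => [_|[x A] s IH hs].
  exists (triv_label T), (fun=> 0); split=> [t|E k mE]; first by rewrite /simple_eval big_nil.
  by rewrite /simple_int big_nil scaler0.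
have [|p [e [he hi]]] := IH; first by move=> q qs; apply: hs; rewrite inE qs orbT.
have mA : measurable A by apply: (hs (x, A)); rewrite inE eqxx.
pose g (k : nat) : X := match (unpickle k : option (nat * nat)) with
  | Some (a, b) => (if a == 1%N then x else 0) + e b | None => 0 end.
have gE a b : g (pair_code a b) = (if a == 1%N then x else 0) + e b by rewrite /g /pair_code pickleK.
exists (pairl (ind_label mA) p), g; split=> [t|E k mE].
  rewrite /= gE -he /simple_eval big_cons /=; congr (_ + _).
  by rewrite indicE; case: asboolP => At; [rewrite mem_set // scale1r|rewrite memNset // scale0r].
(* If the intersection is empty both sides vanish, whatever [g k] is; otherwise one of its points
   shows that [k] is the code of a pair. *)
have [[t [Et kt]]|no] := pselect (E `&` cell (pairl (ind_label mA) p) k !=set0); last first.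
  have -> : E `&` cell (pairl (ind_label mA) p) k = set0 by apply/seteqP; split=> // t tE; apply: no; exists t.
  by rewrite mes0 scale0r fadd0 //; exact: simple_int_add.
have ek : pair_code (ind_label mA t) (p t) = k by exact: kt.
rewrite -{}ek cell_pair gE {kt}.
have mcA : measurable (E `&` cell (ind_label mA) (ind_label mA t)) by apply: measurableI => //; exact: measurable_cell.
rewrite setIA scalerDr -hi // /simple_int big_cons /=; congr (_ + _).
case: asboolP => At.
  rewrite cell_ind1 /= ; congr (_ *: _); congr (fine (mu _)).
  by apply/seteqP; split=> [z [[[? ?] ?] ?]|z [[? ?] ?]].
rewrite cell_ind0 /= scaler0.
have -> : E `&` ~` A `&` cell p (p t) `&` A = set0 by apply/seteqP; split=> // z [[[_ nA] _]].
by rewrite measure0 scale0r.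
Qed.

Definition norm_int s : R := fine (\int[mu]_t (`|simple_eval s t|)%:E).

Lemma measurable_norm_simple s : simple_repr s -> measurable_fun setT (fun t => `|simple_eval s t|).
Proof.
move=> /simple_label [p [e [he _]]]; under eq_fun do rewrite he.
exact: (measurable_label_fun p (fun k => `|e k|)).
Qed.

Lemma norm_int_label s : simple_repr s -> exists (p : label) (e : nat -> X),
  [/\ forall E k, measurable E -> simple_int mu s (E `&` cell p k) = mes (E `&` cell p k) *: e k,
    (\int[mu]_t (`|simple_eval s t|)%:E = (norm_int s)%:E)%E &
    norm_int s = \sum_(k <- rng p) mes (cell p k) * `|e k|].
Proof.
move=> /simple_label [p [e [he hi]]]; exists p, e.
have h : (\int[mu]_t (`|simple_eval s t|)%:E = (\sum_(k <- rng p) mes (cell p k) * `|e k|)%:E)%E.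
  under eq_integral => t _ do rewrite he.
  exact: (integral_label_fun p (h := fun k => `|e k|)).
by split=> //; rewrite /norm_int h.
Qed.

Lemma norm_intE s : simple_repr s -> (\int[mu]_t (`|simple_eval s t|)%:E = (norm_int s)%:E)%E.
Proof. by move=> /norm_int_label [p [e []]]. Qed.

Lemma simple_int_variation s (r : label) : simple_repr s ->
  \sum_(b <- rng r) `|simple_int mu s (cell r b)| <= norm_int s.
Proof.
move=> hs; have [p [e [hi _ ->]]] := norm_int_label hs.
have hb k : mes (cell p k) = \sum_(b <- rng r) mes (cell r b `&` cell p k).
  by rewrite (fadd_label r mes_add (measurable_cell p k)); apply: eq_bigr => b _; rewrite setIC.
under [X in _ <= X]eq_bigr do rewrite hb mulr_suml.
rewrite exchange_big; apply: ler_sum => b _.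
rewrite (fadd_label p (simple_int_add hs) (measurable_cell r b)).
apply: le_trans (ler_norm_sum _ _ _) _; apply: ler_sum => k _.
by rewrite hi ?normrZ ?ger0_norm ?mes_ge0 //; exact: measurable_cell.
Qed.

(** With the preceding inequality, the L^1 norm of a simple function is the total variation of its
    integral, so L^1 estimates can be made on charges. *)
Lemma simple_int_variation_eq s : simple_repr s ->
  exists r : label, norm_int s = \sum_(b <- rng r) `|simple_int mu s (cell r b)|.
Proof.
move=> hs; have [p [e [hi _ ->]]] := norm_int_label hs; exists p; apply: eq_bigr => k _.
by have := hi setT k measurableT; rewrite setTI => ->; rewrite normrZ ger0_norm ?mes_ge0.
Qed.

Definition simple_cat (s : nat -> seq (X * set T)) (m n : nat) := flatten [seq s i | i <- index_iota m n].

Lemma simple_repr_scat (s : nat -> seq (X * set T)) m n : (forall i, simple_repr (s i)) -> simple_repr (simple_cat s m n).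
Proof. by move=> hs p /flattenP [_ /mapP[i _ ->]]; exact: hs. Qed.

Lemma simple_eval_scat (s : nat -> seq (X * set T)) m n t : simple_eval (simple_cat s m n) t = \sum_(m <= i < n) simple_eval (s i) t.
Proof.
rewrite /simple_cat; elim: (index_iota m n) => [|i l IH].
  by rewrite big_nil /simple_eval big_nil.
by rewrite big_cons /= simple_eval_cat IH.
Qed.

Lemma simple_int_scat (s : nat -> seq (X * set T)) m n E : simple_int mu (simple_cat s m n) E = \sum_(m <= i < n) simple_int mu (s i) E.
Proof.
rewrite /simple_cat; elim: (index_iota m n) => [|i l IH].
  by rewrite big_nil /simple_int big_nil.
by rewrite big_cons /= simple_int_cat IH.
Qed.

Local Open Scope ereal_scope.

Lemma series_integrable (a : nat -> T -> R) (M : R) :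
  (forall i, measurable_fun setT (a i)) -> (forall i t, (0 <= a i t)%R) ->
  (forall n, \sum_(0 <= i < n) \int[mu]_t (a i t)%:E <= M%:E) ->
  let w t := \sum_(i <oo) (a i t)%:E in
  [/\ measurable_fun setT w, mu.-integrable setT w, forall t, 0 <= w t &
      forall n t, (\sum_(0 <= i < n) a i t)%R%:E <= w t].
Proof.
move=> ma a0 hM w.
have mw : measurable_fun setT w.
  apply: ge0_emeasurable_sum => [k x _ _|k _]; first by rewrite lee_fin.
  by apply/measurable_EFinP; exact: ma.
have w0 t : 0 <= w t by apply: nneseries_ge0 => n _ _; rewrite lee_fin.
have iw : \int[mu]_t w t = \sum_(i <oo) \int[mu]_t (a i t)%:E.
  apply: integral_nneseries => // [n|n x _]; last by rewrite lee_fin.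
  by apply/measurable_EFinP; exact: ma.
split => //; last first.
  move=> n t; rewrite -sumEFin; apply: nneseries_lim_ge => k _ _; by rewrite lee_fin.
apply/integrableP; split => //.
under eq_integral => t _ do rewrite gee0_abs //.
rewrite iw; apply: le_lt_trans (ltry M).
apply: lime_le; last by apply: nearW => n; exact: hM.
apply: is_cvg_nneseries => n _ _; apply: integral_ge0 => t _; by rewrite lee_fin.
Qed.

Lemma integrable_finite_ae (w : T -> \bar R) : mu.-integrable setT w -> (forall t, 0 <= w t) ->
  mu [set t | w t = +oo] = 0.
Proof.
move=> iw w0.
have mw := measurable_int mu iw.
have mS : measurable [set t | w t = +oo].
  have := emeasurable_fun_c_infty measurableT mw +oo; rewrite setTI.
  by congr measurable; apply/seteqP; split=> t /=; rewrite leye_eq => /eqP.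
have [N [mN N0 h]] := integrable_ae measurableT iw.
apply: (subset_measure0 mS mN _ N0); apply: subset_trans h.
by move=> t /= wt; move=> /(_ I); rewrite wt.
Qed.

End SimpleFunctions.

(** * Approximation in variation and convergence of simple functions *)

Section Convergence.
Context (d : measure_display) (T : measurableType d).
Variables (R : realType) (X : completeNormedModType R).
Variable mu : {finite_measure set T -> \bar R}.
Local Notation label := (label T).
Local Notation mes := (mes mu).
Local Notation norm_int := (norm_int mu).
Ltac vlin := vlin_with R X.

Lemma dominated_to0 (u : nat -> T -> R) (w : T -> \bar R) :
  (forall n, measurable_fun setT (u n)) -> (forall n t, 0 <= u n t) ->
  (forall n t, ((u n t)%:E <= w t)%E) -> mu.-integrable setT w ->
  (forall t, w t != +oo%E -> seqlim (fun n => u n t : R^o) 0) ->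
  ((fun n => \int[mu]_t (u n t)%:E)%E @ \oo --> 0%E).
Proof.
move=> mu_ u0 uw iw lim.
have w0 t : (0 <= w t)%E by apply: le_trans (uw 0%N t); rewrite lee_fin.
have wfin := integrable_finite_ae iw w0.
have mw : measurable [set t | w t = +oo%E].
  have := emeasurable_fun_c_infty measurableT (measurable_int mu iw) +oo%E; rewrite setTI.
  by congr measurable; apply/seteqP; split=> t /=; rewrite leye_eq => /eqP.
have [|||||_ _] := @dominated_convergence _ T R mu setT measurableT (fun n t => (u n t)%:E) (cst 0%E) w.
- by move=> n; apply/measurable_EFinP.
- exact: measurable_cst.
- exists [set t | w t = +oo%E]; split => // t /= h; apply: contrapT => wt; apply: h => _.
  by apply: cvg_EFin; [exact: nearW|apply/seqlim_cvg; apply: lim; exact/eqP].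
- exact: iw.
- by apply: aeW => t n _; rewrite gee0_abs ?lee_fin //; exact: uw.
by rewrite integral_cst // mul0e; apply.
Qed.

Lemma simple_diff_repr (s s' : seq (X * set T)) : simple_repr s -> simple_repr s' ->
  simple_repr (s ++ simple_opp s').
Proof. by move=> hs hs'; apply: simple_repr_cat => //; exact: simple_repr_opp. Qed.

Lemma simple_diff_eval (s s' : seq (X * set T)) t :
  simple_eval (s ++ simple_opp s') t = simple_eval s t - simple_eval s' t.
Proof. by rewrite simple_eval_cat simple_eval_opp. Qed.

Lemma simple_diff_int (s s' : seq (X * set T)) E :
  simple_int mu (s ++ simple_opp s') E = simple_int mu s E - simple_int mu s' E.
Proof. by rewrite simple_int_cat simple_int_opp. Qed.

(** Bounds the total variation of the difference between [D] and the integral of [s]; this stands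
    for L^1 distance when [D] has no density yet. *)
Definition approximates (D : set T -> X) (s : seq (X * set T)) (e : R) :=
  forall r : label, \sum_(b <- rng r) `|D (cell r b) - simple_int mu s (cell r b)| <= e.

Definition approximable (D : set T -> X) := forall e : R, 0 < e ->
  exists s, simple_repr s /\ approximates D s e.

Lemma approximates_norm_int D s s' e e' : simple_repr s -> simple_repr s' ->
  approximates D s e -> approximates D s' e' -> norm_int (s ++ simple_opp s') <= e + e'.
Proof.
move=> hs hs' h h'; have [r ->] := simple_int_variation_eq mu (simple_diff_repr hs hs').
apply: le_trans (lerD (h r) (h' r)); rewrite -big_split /=; apply: ler_sum => b _.
rewrite simple_diff_int.
have -> : simple_int mu s (cell r b) - simple_int mu s' (cell r b) =
  (D (cell r b) - simple_int mu s' (cell r b)) - (D (cell r b) - simple_int mu s (cell r b)) by vlin.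
by rewrite addrC; apply: le_trans (ler_normB _ _) _; rewrite addrC.
Qed.

Lemma approximates_cell D s e E : approximates D s e -> measurable E ->
  `|D E - simple_int mu s E| <= e.
Proof.
move=> h mE; apply: le_trans (h (ind_label mE)).
by rewrite /= !big_cons big_nil addr0 cell_ind1 lerDl.
Qed.

(* Bochner density from a fast L^1-Cauchy sequence of simple functions, set to
   zero where the sum of the increments diverges. *)
Lemma approximable_density (F : set T -> X) : approximable F ->
  exists g : T -> X, bochner_density mu F g.
Proof.
move=> ap.
pose s n := sval (cid (ap _ (half_pow_gt0 n))).
have sr n : simple_repr (s n) by case: (svalP (cid (ap _ (half_pow_gt0 n)))).
have sa n : approximates F (s n) (2^-1 ^+ n) by case: (svalP (cid (ap _ (half_pow_gt0 n)))).
pose a i t := `|simple_eval (s i) t - simple_eval (s i.+1) t|.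
have aE i t : a i t = `|simple_eval (s i ++ simple_opp (s i.+1)) t| by rewrite simple_diff_eval.
have ma i : measurable_fun setT (a i).
  have -> : a i = (fun t => `|simple_eval (s i ++ simple_opp (s i.+1)) t|) by apply/funext => t; exact: aE.
  exact: (measurable_norm_simple mu (simple_diff_repr (sr _) (sr _))).
have ai i : (\int[mu]_t (a i t)%:E <= (2 * 2^-1 ^+ i)%:E)%E.
  under eq_integral => t _ do rewrite aE.
  rewrite (norm_intE mu (simple_diff_repr (sr _) (sr _))).
  rewrite lee_fin; apply: le_trans (approximates_norm_int (sr i) (sr i.+1) (sa i) (sa i.+1)) _.
  by rewrite exprS; have := half_pow_gt0 (R := R) i; lra.
pose w t := (\sum_(i <oo) (a i t)%:E)%E.
have [mw iw w0 wa] : [/\ measurable_fun setT w, mu.-integrable setT w, forall t, (0 <= w t)%E &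
    forall n t, ((\sum_(0 <= i < n) a i t)%R%:E <= w t)%E].
  apply: (@series_integrable _ T R mu a 4 ma); first by move=> i t; exact: normr_ge0.
  move=> n; apply: le_trans (_ : (\sum_(0 <= i < n) (2 * 2^-1 ^+ i)%:E <= _)%E).
    by apply: lee_sum => i _; exact: ai.
  rewrite sumEFin lee_fin -mulr_sumr; have := sum_half_pow_le (R := R) 0 n; rewrite expr0; lra.
pose fin t := w t != +oo%E.
have tail t n m : fin t -> (n <= m)%N ->
    `|simple_eval (s n) t - simple_eval (s m) t| <= fine (w t) - \sum_(0 <= i < n) a i t.
  move=> ft nm.
  have wf : w t = (fine (w t))%:E by rewrite fineK // ge0_fin_numE ?w0 // lt_neqAle (ft : w t != +oo%E) leey.
  have h := wa m t; rewrite wf lee_fin (big_cat_nat (leq0n n) nm) //= in h.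
  apply: le_trans (_ : \sum_(n <= i < m) a i t <= _); last by lra.
  rewrite distrC -(telescope_sumr (fun k => simple_eval (s k) t) nm); apply: le_trans (ler_norm_sum _ _ _) _.
  by apply: ler_sum => i _; rewrite distrC.
have sumcv t : fin t -> forall e : R, 0 < e -> exists N, forall n, (N <= n)%N ->
    fine (w t) - \sum_(0 <= i < n) a i t <= e.
  move=> ft e e0.
  have wf : w t = (fine (w t))%:E by rewrite fineK // ge0_fin_numE ?w0 // lt_neqAle (ft : w t != +oo%E) leey.
  have : (fun n => \sum_(0 <= i < n) (a i t)%:E)%E @ \oo --> (fine (w t))%:E.
    by rewrite -wf; apply: is_cvg_nneseries => n _ _; rewrite lee_fin; exact: normr_ge0.
  move=> /fine_cvgP [_] /cvgrPdist_le /(_ e e0) [N _ hN]; exists N => n Nn.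
  have := hN n Nn; rewrite /= sumEFin /=; exact: le_trans (ler_norm _).
have lim t : {l : X | fin t -> seqlim (fun n => simple_eval (s n) t) l}.
  apply: cid; have [ft|nf] := pselect (fin t); last by exists 0.
  have [|l hl] := @cauchy_seqlim R X (fun n => simple_eval (s n) t); last by exists l.
  move=> e e0; have [N hN] := sumcv t ft (e / 2) ltac:(lra); exists N => m n Nm Nn.
  have h1 := tail t N m ft Nm; have h2 := tail t N n ft Nn; have h3 := hN N (leqnn N).
  have -> : simple_eval (s m) t - simple_eval (s n) t =
    (simple_eval (s N) t - simple_eval (s n) t) - (simple_eval (s N) t - simple_eval (s m) t) by vlin.
  by apply: le_trans (ler_normB _ _) _; lra.
pose g t := if `[< fin t >] then sval (lim t) else 0.
have gl t : fin t -> seqlim (fun n => simple_eval (s n) t) (g t).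
  by move=> ft; rewrite /g asboolT //; exact: (svalP (lim t)).
have mS : measurable [set t | w t = +oo%E].
  have := emeasurable_fun_c_infty measurableT mw +oo%E; rewrite setTI.
  by congr measurable; apply/seteqP; split=> t /=; rewrite leye_eq => /eqP.
have mfin : measurable [set t | fin t].
  have -> : [set t | fin t] = ~` [set t | w t = +oo%E].
    by apply/seteqP; split=> t /= => [/eqP|] // h; exact/eqP.
  exact: measurableC.
have mg n : measurable_fun setT (fun t => `|simple_eval (s n) t - g t|).
  (* The function is a pointwise limit of measurable real functions: on the convergence set [g t] is
     replaced by [simple_eval (s m) t], and elsewhere [g t] is 0. *)
  pose h m t := `|simple_eval (s n) t - simple_eval (s m) t| * \1_[set t | fin t] t
     + `|simple_eval (s n) t| * \1_(~` [set t | fin t]) t.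
  apply: (@measurable_fun_cvg _ _ _ _ h).
    move=> m; apply: measurable_funD; apply: measurable_funM.
    - under eq_fun do rewrite -simple_diff_eval.
      exact: (measurable_norm_simple mu (simple_diff_repr (sr _) (sr _))).
    - exact: measurable_indic.
    - exact: (measurable_norm_simple mu).
    - apply: measurable_indic; exact: measurableC.
  move=> t _; apply/(@seqlim_cvg _ R^o); have [ft|nf] := boolP (fin t).
    have -> : h ^~ t = (fun m => `|simple_eval (s n) t - simple_eval (s m) t|).
      have h1 : t \in [set t | fin t] by exact: mem_set.
      by apply/funext => m; rewrite /h !indicE in_setC h1 /= mulr1 mulr0 addr0.
    move=> e e0; have [N hN] := gl t ft e e0; exists N => m Nm.
    apply: le_trans (ler_dist_dist _ _) _.
    have -> : simple_eval (s n) t - simple_eval (s m) t - (simple_eval (s n) t - g t) =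
       - (simple_eval (s m) t - g t) by vlin.
    by rewrite normrN; exact: hN.
  have -> : g t = 0 by rewrite /g asboolF //; exact/negP.
  have -> : h ^~ t = (fun m => `|simple_eval (s n) t|).
    have h1 : (t \in [set t | fin t]) = false by apply: memNset; exact/negP.
    by apply/funext => m; rewrite /h !indicE in_setC h1 /= mulr1 mulr0 add0r.
  rewrite subr0; exact: (@seqlim_cst _ R^o).
exists g, s; split=> //.
- exists [set t | w t = +oo%E]; split => //; first exact: integrable_finite_ae.
  move=> t /= h; apply: contrapT => wt; apply: h; apply/seqlim_cvg; apply: gl; exact/eqP.
- have := @dominated_to0 (fun n t => `|simple_eval (s n) t - g t| * \1_[set t | fin t] t) w.
  have ind01 t : 0 <= \1_[set t | fin t] t :> R by rewrite indicE.
  move=> H; have {}H := H _ _ _ iw _.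
  have e1 : (fun n => \int[mu]_t (`|simple_eval (s n) t - g t|)%:E)%E =
    (fun n => \int[mu]_t (`|simple_eval (s n) t - g t| * \1_[set t | fin t] t)%:E)%E.
    apply/funext => n; apply: ge0_ae_eq_integral => //.
    + apply/measurable_EFinP; exact: mg.
    + by apply/measurable_EFinP; apply: measurable_funM; [exact: mg|exact: measurable_indic].
    + exists [set t | w t = +oo%E]; split => //; first exact: integrable_finite_ae.
      move=> t /= h; apply: contrapT => wt; apply: h => _.
      by rewrite indicE mem_set ?mulr1 //=; exact/eqP.
  rewrite e1; apply: H.
  + by move=> n; apply: measurable_funM; [exact: mg|exact: measurable_indic].
  + by move=> n t; rewrite mulr_ge0.
  + move=> n t; have [ft|nf] := boolP (fin t); last first.
      by rewrite indicE memNset ?mulr0 ?w0 //; exact/negP.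
    rewrite indicE mem_set // mulr1.
    have wf : w t = (fine (w t))%:E by rewrite fineK // ge0_fin_numE ?w0 // lt_neqAle (ft : w t != +oo%E) leey.
    rewrite wf lee_fin.
    apply: (@seqlim_norm_le _ _ (fun m => simple_eval (s n) t - simple_eval (s m) t)).
      by apply: seqlimB; [exact: seqlim_cst|exact: gl].
    exists n => m nm; apply: le_trans (tail t n m ft nm) _.
    by rewrite gerBl; apply: sumr_ge0 => i _; exact: normr_ge0.
  + move=> t ft e e0; have [N hN] := gl t ft e e0; exists N => n Nn.
    by rewrite subr0 indicE mem_set // mulr1 normr_id; exact: hN.
- move=> E mE; apply/seqlim_cvg => e e0; have [N hN] := half_pow_small 1 e0; exists N => n Nn.
  rewrite distrC; apply: le_trans (approximates_cell (sa n) mE) _.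
  by have := hN n Nn; rewrite mul1r.
Qed.

Section Monotone.
Variable L : vector_lattice X.
Hypothesis hL : lattice_norm L.
Hypothesis kb : KB L.
Local Notation "x ⊑ y" := (vle L x y) (at level 70).

(* Pointwise the partial sums increase and are bounded a.e., hence converge by
   the KB property. *)
Lemma simple_monotone (s : nat -> seq (X * set T)) (M : R) :
  (forall i, simple_repr (s i)) -> (forall i t, 0 ⊑ simple_eval (s i) t) ->
  (forall n, norm_int (simple_cat s 0 n) <= M) ->
  forall e : R, 0 < e -> exists n0, forall n, (n0 <= n)%N -> norm_int (simple_cat s n0 n) <= e.
Proof.
move=> sr s0 hM e e0; apply: contrapT => no.
pose S n t := \sum_(0 <= i < n) simple_eval (s i) t.
have SE n t : simple_eval (simple_cat s 0 n) t = S n t by exact: simple_eval_scat.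
have Sinc n t : S n t ⊑ S n.+1 t.
  by rewrite /S big_nat_recr //=; apply: (vle_by (s0 n t)); vlin.
have S0 n t : 0 ⊑ S n t by apply: vsum_ge0 => i _.
have Smono n m t : (n <= m)%N -> S n t ⊑ S m t by move=> nm; apply: (incr_le (s := fun k => S k t)).
have Sdiff n m t : (n <= m)%N -> simple_eval (simple_cat s n m) t = S m t - S n t.
  by move=> nm; rewrite simple_eval_scat /S (big_cat_nat (leq0n n) nm) //=; vlin.
pose a i t := `|S i.+1 t| - `|S i t|.
have asum n t : \sum_(0 <= i < n) a i t = `|S n t|.
  rewrite /a (telescope_sumr (fun k => `|S k t|) (leq0n n)).
  by rewrite [X in _ - `|X|](_ : _ = 0) ?normr0 ?subr0 // /S big_geq.
have mS n : measurable_fun setT (fun t => `|S n t|).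
  under eq_fun do rewrite -SE; apply: (measurable_norm_simple mu); exact: simple_repr_scat.
have ma i : measurable_fun setT (a i) by apply: measurable_funB.
have a0 i t : 0 <= a i t by rewrite subr_ge0; apply: (norm_vle hL).
pose w t := (\sum_(i <oo) (a i t)%:E)%E.
have [mw iw w0 wa] : [/\ measurable_fun setT w, mu.-integrable setT w, forall t, (0 <= w t)%E &
    forall n t, ((\sum_(0 <= i < n) a i t)%R%:E <= w t)%E].
  apply: (@series_integrable _ T R mu a M ma a0).
  move=> n; rewrite -ge0_integral_sum //; last first.
  - by move=> i t _; rewrite lee_fin.
  - by move=> i; apply/measurable_EFinP.
  under eq_integral => t _ do rewrite sumEFin asum -SE.
  by rewrite norm_intE ?lee_fin //; exact: simple_repr_scat.
have ex n0 : {n | (n0 <= n)%N /\ e < norm_int (simple_cat s n0 n)}.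
  apply: cid; apply: contrapT => no2; apply: no; exists n0 => n nn; rewrite leNgt; apply/negP => h.
  by apply: no2; exists n.
pose k n := sval (ex n).
have kn n : (n <= k n)%N by case: (svalP (ex n)).
suff : ((fun n => \int[mu]_t (`|S (k n) t - S n t|)%:E)%E @ \oo --> 0%E).
  move=> /fine_cvgP [_] /cvgrPdist_le /(_ e e0) [N _ hN].
  have := hN N (leqnn N); rewrite /= sub0r normrN.
  have e1 : (\int[mu]_t (`|S (k N) t - S N t|)%:E)%E = (norm_int (simple_cat s N (k N)))%:E.
    rewrite -norm_intE; last exact: simple_repr_scat.
    by apply: eq_integral => t _; rewrite Sdiff.
  rewrite e1 /= => h; have [_] := svalP (ex N); rewrite -/(k N) => h2.
  by have := le_trans (ler_norm _) h; rewrite leNgt h2.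
apply: (@dominated_to0 (fun n t => `|S (k n) t - S n t|) w) => //.
- move=> n; under eq_fun do rewrite -Sdiff //; apply: (measurable_norm_simple mu); exact: simple_repr_scat.
- move=> n t; apply: le_trans (wa (k n) t); rewrite lee_fin asum; apply: (norm_vle hL).
    by apply: vsub_ge0; exact: Smono.
  by apply: (vle_by (S0 n t)); vlin.
- move=> t ft.
  have wf : w t = (fine (w t))%:E by rewrite fineK // ge0_fin_numE ?w0 // lt_neqAle (ft : w t != +oo%E) leey.
  have [l hl] : exists l, seqlim (fun n => S n t) l.
    apply: kb => [n|]; first exact: Sinc.
    by exists (fine (w t)) => n; have := wa n t; rewrite asum wf lee_fin.
  move=> d0 d0_; have [N hN] := hl (d0 / 2) ltac:(lra); exists N => n Nn.
  have h1 := hN n Nn; have h2 := hN (k n) (leq_trans Nn (kn n)).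
  rewrite subr0 normr_id.
  have -> : S (k n) t - S n t = (S (k n) t - l) - (S n t - l) by vlin.
  by apply: le_trans (ler_normB _ _) _; lra.
Qed.
End Monotone.
End Convergence.

Section RealLattice.
Variable R : realType.

Lemma real_lattice_subproof :
  [/\ forall x y z : R^o, x <= y -> x + z <= y + z,
      forall (a : R) (x y : R^o), 0 <= a -> x <= y -> a *: x <= a *: y,
      forall x y : R^o, x <= Num.max x y,
      forall x y : R^o, y <= Num.max x y &
      forall x y z : R^o, x <= z -> y <= z -> Num.max x y <= z].
Proof.
split=> [x y z|a x y a0 xy|x y|x y|x y z xz yz].
- by rewrite lerD2r.
- exact: ler_wpM2l.
- by rewrite le_max lexx.
- by rewrite le_max lexx orbT.
- by rewrite ge_max xz yz.
Qed.

(** The reals as a Banach lattice, so that [sup_measure] also produces the variation of a vector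
    measure. *)
Definition real_lattice : vector_lattice R^o :=
  let: And5 h1 h2 h3 h4 h5 := real_lattice_subproof in
  @VectorLattice R R^o (fun x y => x <= y) (fun x y => Num.max x y)
    (fun x => lexx x) (fun x y h h' => le_anti (introT andP (conj h h')))
    (fun x y z => @le_trans _ R y x z) h1 h2 h3 h4 h5.

Lemma real_vle (x y : R^o) : vle real_lattice x y = (x <= y).
Proof. by rewrite /real_lattice; case: real_lattice_subproof. Qed.

Lemma real_vabs (x : R^o) : vabs real_lattice x = `|x|.
Proof. by rewrite /vabs /real_lattice; case: real_lattice_subproof => *; rewrite /= maxrN. Qed.

Lemma real_lattice_norm : lattice_norm (X := R^o) real_lattice.
Proof. by move=> x y; rewrite !real_vabs real_vle. Qed.

Lemma real_KB : KB (X := R^o) real_lattice.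
Proof.
move=> s inc [M hM]; have nd : {homo s : n m / (n <= m)%N >-> n <= m}.
  by apply: homo_leq => [x|y x z|n]; [exact: lexx|exact: le_trans|rewrite -real_vle; exact: inc].
have : cvgn (s : nat -> R).
  apply: nondecreasing_is_cvgn => //; exists M => _ [n _ <-]; exact: le_trans (ler_norm _) (hM n).
by move=> /cvg_ex[l hl]; exists l; apply/(@seqlim_cvg _ R^o).
Qed.
End RealLattice.

(** * Densities of vector measures of bounded variation *)

Section VectorMeasures.
Context (d : measure_display) (T : measurableType d).
Variables (R : realType) (X : completeNormedModType R).
Variable mu : {finite_measure set T -> \bar R}.
Local Notation label := (label T).
Local Notation mes := (mes mu).
Ltac vlin := vlin_with R X.

Lemma vector_measure0 (F : set T -> X) : vector_measure F -> F set0 = 0.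
Proof.
move=> hF; have /seqlim_cvg h := hF (fun=> set0) (fun=> measurable0) (@trivIset_set0 _ _ setT).
rewrite bigcup0 // in h.
apply/norm_eq0_small => e e0; have [N hN] := h (e / 2) ltac:(lra).
have h1 := hN _ (leqnSn N); have h2 := hN _ (leqnn N).
have -> : F set0 = (\sum_(k < N.+1) F set0 - F set0) - (\sum_(k < N) F set0 - F set0).
  by rewrite big_ord_recr /=; vlin.
by apply: le_trans (ler_normB _ _) _; lra.
Qed.

Lemma vector_measure_fadd (F : set T -> X) : vector_measure F -> fadd F.
Proof.
move=> hF A B mA mB AB; have F0 := vector_measure0 hF.
pose C (n : nat) := if n is k.+1 then if k is 0%N then B else set0 else A.
have mC n : measurable (C n) by case: n => [|[|n]] //; exact: measurable0.
have tC : trivIset setT C.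
  apply/trivIsetP => i j _ _; case: i => [|[|i]]; case: j => [|[|j]] //= _; rewrite ?setI0 ?set0I //.
  by rewrite setIC.
have eC : \bigcup_n C n = A `|` B.
  apply/seteqP; split=> [t [[|[|n]] _]|t [At|Bt]] //=; [by left|by right|by exists 0%N|by exists 1%N].
have /seqlim_cvg h := hF C mC tC; rewrite eC in h.
apply: (seqlim_uniq h) => e e0; exists 2%N => n n2.
rewrite -(subnK n2) addn2 !big_ord_recl /= big1 => [|i _]; last by rewrite /= F0.
by rewrite addr0 subrr normr0 ltW.
Qed.

Lemma vector_measure_continuous (F : set T -> X) (A : nat -> set T) : vector_measure F ->
  (forall n, measurable (A n)) -> (forall n, A n.+1 `<=` A n) -> F (\bigcap_n A n) = 0 ->
  seqlim (fun n => F (A n)) 0.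
Proof.
move=> hF mA dA F0; have hadd := vector_measure_fadd hF.
have dA' n m : (n <= m)%N -> A m `<=` A n.
  by move=> /subnK <-; elim: (m - n)%N => [|k IH] //=; exact: subset_trans (dA _) IH.
pose B n := A n `\` A n.+1.
have mB n : measurable (B n) by exact: measurableD.
have tB : trivIset setT B.
  suff key i j : (i < j)%N -> B i `&` B j = set0.
    apply/trivIsetP => i j _ _; rewrite neq_ltn => /orP[/key //|/key]; by rewrite setIC.
  by move=> ij; apply/seteqP; split=> // t [[_ nA] [At _]]; apply: nA; exact: dA' At.
have eB : \bigcup_n B n = A 0%N `\` \bigcap_n A n.
  apply/seteqP; split=> [t [n _ [At nA]]|t [At nA]].
    by split; [exact: dA' (leq0n n) _ At|move=> /(_ n.+1 I)].
  apply: contrapT => no; apply: nA => n _; elim: n => // n IH.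
  by apply: contrapT => nAn; apply: no; exists n.
have mcap : measurable (\bigcap_n A n) by exact: bigcap_measurableType.
have sumB n : \sum_(k < n) F (B k) = F (A 0%N) - F (A n).
  elim: n => [|n IH]; first by rewrite big_ord0 subrr.
  by rewrite big_ord_recr /= IH (fadd_setD hadd (mA n) (mA n.+1) (dA n)) /B; vlin.
have /seqlim_cvg h := hF B mB tB; rewrite eB in h.
have e1 : F (A 0%N `\` \bigcap_n A n) = F (A 0%N).
  by rewrite (fadd_setD hadd (mA 0%N) mcap) ?F0 ?add0r // => t; apply.
rewrite e1 in h; have := seqlimB (seqlim_cst (F (A 0%N))) h; rewrite subrr.
by under eq_fun => n do rewrite sumB subKr.
Qed.

Lemma bounded_variation_label (F : set T -> X) : vector_measure F -> bounded_variation F ->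
  exists M : R, forall p : label, \sum_(k <- rng p) `|F (cell p k)| <= M.
Proof.
move=> hF [M hM]; exists M => p.
pose A i := if (i < size (rng p))%N then cell p (nth 0%N (rng p) i) else set0.
have := hM (size (rng p)) A.
have -> : \sum_(k < size (rng p)) `|F (A k)| = \sum_(k <- rng p) `|F (cell p k)|.
  by rewrite [RHS](big_nth 0%N) big_mkord; apply: eq_bigr => i _; rewrite /A ltn_ord.
apply.
  by move=> i; rewrite /A; case: ifP => _ //; exact: measurable_cell.
apply/trivIsetP => i j _ _ ij; rewrite /A; case: ifP => hi; last by rewrite set0I.
case: ifP => hj; last by rewrite setI0.
apply/seteqP; split=> // t [ti tj]; move/eqP: ij; apply; apply/eqP.
rewrite -(nth_uniq 0%N hi hj (rng_uniq p)); apply/eqP.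
by rewrite -(ti : p t = _) -(tj : p t = _).
Qed.

Lemma variation_measure (F : set T -> X) : vector_measure F -> bounded_variation F ->
  exists nu : set T -> R, [/\ fadd nu,
    forall p E, measurable E -> \sum_(k <- rng p) `|F (E `&` cell p k)| <= nu E,
    forall E, measurable E -> `|F E| <= nu E &
    forall E (e : R), measurable E -> 0 < e ->
      exists p : label, nu E - e <= \sum_(k <- rng p) `|F (E `&` cell p k)|].
Proof.
move=> hF hv; have hadd := vector_measure_fadd hF.
have [M hM] := bounded_variation_label hF hv.
have [|||| nu [n1 n2 n3 n4]] := @sup_measure _ T R R^o (real_lattice R) (@real_lattice_norm R) (@real_KB R)
   (fun E => `|F E| : R^o).
- by rewrite (fadd0 hadd) normr0.
- by move=> A _; rewrite real_vle.
- by move=> A B mA mB AB; rewrite real_vle hadd //; exact: ler_normD.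
- exists M => p; rewrite /cell_sum ger0_norm; last by apply: sumr_ge0.
  by under eq_bigr do rewrite setTI; exact: hM.
exists nu; split=> //.
- by move=> p E mE; have := n2 p E mE; rewrite real_vle.
- by move=> E mE; have := n3 E mE; rewrite real_vle.
move=> E e mE e0; have [p hp] := n4 E e mE e0; exists (pairl p (triv_label T)).
have := le_trans (ler_norm _) (hp (triv_label T)); rewrite /cell_sum /=; lra.
Qed.

Lemma fadd_mono (nu : set T -> R) A B : fadd nu -> (forall E, measurable E -> 0 <= nu E) ->
  measurable A -> measurable B -> A `<=` B -> nu A <= nu B.
Proof.
move=> h n0 mA mB AB; rewrite (fadd_setD h mB mA AB) lerDl; apply: n0; exact: measurableD.
Qed.

(* If nu (E_n) > e with mes (E_n) <= 2^-n, the tails W_N of the union carry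
   nu-mass above e, and disjoint differences of the W_N exhaust the variation. *)
Lemma variation_abs_cont (F : set T -> X) (nu : set T -> R) : vector_measure F ->
  vabs_continuous F mu -> fadd nu ->
  (forall p E, measurable E -> \sum_(k <- rng p) `|F (E `&` cell p k)| <= nu E) ->
  (forall E, measurable E -> `|F E| <= nu E) ->
  (forall E (e : R), measurable E -> 0 < e ->
      exists p : label, nu E - e <= \sum_(k <- rng p) `|F (E `&` cell p k)|) ->
  abs_cont mes nu.
Proof.
move=> hF ac nadd nub nF nad e e0; apply: contrapT => no.
have nu0 E : measurable E -> 0 <= nu E by move=> mE; apply: le_trans (nF E mE).
have ex (n : nat) : {E | [/\ measurable E, mes E <= 2^-1 ^+ n & e < nu E]}.
  apply: cid; apply: contrapT => no2; apply: no; exists (2^-1 ^+ n); first exact: half_pow_gt0.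
  by move=> E mE hE; rewrite leNgt; apply/negP => h; apply: no2; exists E.
pose E n := sval (ex n).
have hE n : [/\ measurable (E n), mes (E n) <= 2^-1 ^+ n & e < nu (E n)] by exact: (svalP (ex n)).
have mE n : measurable (E n) by case: (hE n).
pose W N := \bigcup_(n in [set n | (N <= n)%N]) E n.
have mW N : measurable (W N) by apply: bigcup_measurable => k _.
have dW N : W N.+1 `<=` W N by move=> t [n /= Nn Et]; exists n => //=; exact: ltnW.
have muW N : (mu (W N) <= (2 * 2^-1 ^+ N)%:E)%E.
  have h := @measure_sigma_subadditive _ R T mu (W N) (fun n => E (n + N)%N).
  apply: le_trans (h _ _ _) _ => //.
  - by move=> t [n /= Nn Et]; exists (n - N)%N => //=; rewrite subnK.
  - apply: lime_le; first by apply: is_cvg_nneseries => n _ _; exact: measure_ge0.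
    apply: nearW => n; apply: le_trans (_ : (\sum_(0 <= i < n) (2^-1 ^+ N * 2^-1 ^+ i)%:E <= _)%E).
      apply: lee_sum => i _. rewrite [X in (X <= _)%E](mesE mu (mE (i + N)%N)) lee_fin -exprD addnC.
      have [_ h1 _] := hE (N + i)%N; exact: h1.
    rewrite sumEFin lee_fin -mulr_sumr mulrC; apply: ler_wpM2r; first exact: ltW (half_pow_gt0 N).
    by have := sum_half_pow_le (R := R) 0 n; rewrite expr0 mulr1.
have mcap : measurable (\bigcap_n W n) by exact: bigcap_measurableType.
have mu0 A : measurable A -> A `<=` \bigcap_n W n -> mu A = 0%E.
  move=> mA AW; apply/eqP; rewrite eq_le measure_ge0 andbT (mesE mu mA) lee_fin.
  apply/ler_addgt0Pr => c c0; have [N hN] := half_pow_small 2 c0; rewrite add0r.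
  apply: le_trans (hN N (leqnn N)); rewrite -lee_fin -(mesE mu mA).
  apply: le_trans (muW N); apply: le_measure; rewrite ?inE // => t At; exact: (AW t At N I).
have nuW N : e < nu (W N).
  have [_ _ h] := hE N; apply: lt_le_trans h _; apply: fadd_mono => // t Et; exists N => //=; exact: leqnn.
(* A partition [p] attains [nu (W N)] up to [e / 4]. Since the [W M] shrink to a null set, removing
   a late one changes the finite sum over [p] by at most [e / 4]. More than [e / 2] of the variation
   is thus carried by [W N] without [W M]. *)
have step N : {M | (N <= M)%N /\ e / 2 < nu (W N `\` W M)}.
  apply: cid; have [p hp] := nad (W N) (e / 4) (mW N) ltac:(lra).
  have lim : seqlim (fun M => \sum_(k <- rng p) `|F ((W N `&` cell p k) `\` W M)| : R^o)
     (\sum_(k <- rng p) `|F (W N `&` cell p k)| : R^o).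
    apply: (@seqlim_sum _ R^o) => k.
    set A := W N `&` cell p k; have mA : measurable A by apply: measurableI => //; exact: measurable_cell.
    have mAW M : measurable (A `&` W M) by exact: measurableI.
    have h0 : seqlim (fun M => F (A `&` W M)) 0.
      apply: vector_measure_continuous => // [M t [At Wt]|]; first by split=> //; exact: dW.
      apply: ac; first exact: bigcap_measurableType.
      apply: mu0; first exact: bigcap_measurableType.
      by move=> t At n _; have [] := At n I.
    move=> c c0; have [K hK] := h0 c c0; exists K => n Kn.
    apply: le_trans (ler_dist_dist _ _) _; rewrite distrC.
    have hadd := vector_measure_fadd hF.
    rewrite (fadd_setD hadd mA (mAW n)); last by move=> t [].
    have -> : A `\` (A `&` W n) = A `\` W n.
      by apply/seteqP; split=> t [At nW]; split=> // h; apply: nW; [split|case: h].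
    by rewrite addrK; have := hK n Kn; rewrite subr0.
  have [K hK] := lim (e / 4) ltac:(lra).
  exists (maxn N K); split; first exact: leq_maxl.
  have h1 := hK _ (leq_maxr N K); set M := maxn N K in h1 *.
  have mD : measurable (W N `\` W M) by exact: measurableD.
  have h2 := nub p _ mD.
  have e1 : \sum_(k <- rng p) `|F ((W N `\` W M) `&` cell p k)| = \sum_(k <- rng p) `|F ((W N `&` cell p k) `\` W M)|.
    apply: eq_bigr => k _; congr (`|F _|); apply/seteqP; split=> [t [[? ?] ?]|t [[? ?] ?]]; by split.
  rewrite e1 in h2.
  have := ler_norm (- (\sum_(k <- rng p) `|F ((W N `&` cell p k) `\` W M)| - \sum_(k <- rng p) `|F (W N `&` cell p k)|)).
  rewrite normrN => h3; have := nuW N; have := le_trans h3 h1; lra.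
pose N (i : nat) := iter i (fun n => sval (step n)) 0%N.
have hN i : (N i <= N i.+1)%N /\ e / 2 < nu (W (N i) `\` W (N i.+1)).
  by rewrite /N /=; exact: (svalP (step _)).
have dW' n m : (n <= m)%N -> W m `<=` W n.
  by move=> /subnK <-; elim: (m - n)%N => [|k IH] //=; exact: subset_trans (dW _) IH.
have key i : i%:R * (e / 2) + nu (W (N i)) <= nu (W 0%N).
  elim: i => [|i IH]; first by rewrite mul0r add0r.
  have [h1 h2] := hN i.
  rewrite (fadd_setD nadd (mW (N i)) (mW (N i.+1)) (dW' _ _ h1)) in IH.
  by rewrite -natr1 mulrDl mul1r; lra.
pose K := Num.bound (nu (W 0%N) / (e / 2)).
have h1 : 0 <= nu (W 0%N) / (e / 2) by apply: divr_ge0; [exact: nu0|lra].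
have := archi_boundP h1; rewrite -/K ltr_pdivrMr; last by lra.
by have := key K; have := nu0 _ (mW (N K)); lra.
Qed.

Variable L : vector_lattice X.
Hypothesis hL : lattice_norm L.
Hypothesis star : solid_extreme_property L.
Let kb := solid_extreme_KB hL star.
Local Notation "x ⊑ y" := (vle L x y) (at level 70).

Lemma seqlim_norm (u : nat -> X) l : seqlim u l -> seqlim (fun n => `|u n| : R^o) (`|l| : R^o).
Proof.
by move=> h e e0; have [N hN] := h e e0; exists N => n /hN; apply: le_trans; exact: ler_dist_dist.
Qed.

Lemma no_singular_part (nu : set T -> R) (F : set T -> X) u : fadd nu -> abs_cont mes nu -> fadd F ->
  (forall E, measurable E -> 0 ⊑ F E) -> (forall E, measurable E -> `|F E| <= nu E) ->
  F setT ⊑ u ->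
  (forall e : R, 0 < e -> exists q : label, forall p : label,
  `|\sum_(k <- rng (pairl p q)) vinf L (F (cell (pairl p q) k)) (mes (cell (pairl p q) k) *: u)| <= e) ->
  F setT = 0.
Proof.
move=> nadd nac Fadd F0 Fnu Fu Fs; apply: contrapT => /eqP Fn0.
have [m [v [M [a [v0 vdec vu small [Aa an0]]]]]] :=
  bush_tree hL kb (mes_add mu) (fun E _ => mes_ge0 mu E) nadd nac Fadd F0 Fnu Fu Fs Fn0.
have [|||||x] := star (A := tree_set L m v M).
- exact: tree_set_closed.
- exact: tree_set_bounded.
- exact: tree_set_solid.
- exact: tree_set_convex.
- by exists a.
by rewrite (tree_set_no_extreme hL v0 vdec vu small Aa an0).
Qed.

(** The differences [H i - H (i+1)] are order bounded by multiples of [mes u], hence close to step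
    functions with positive values. The partial sums of these are bounded in L^1, so their tails are
    small by [simple_monotone]. As [H n] tends to the singular part, which is 0, the tail [H n0] is
    small in variation: [3 c], plus [2 c] for the step approximations, is below [e]. *)
Lemma positive_approximable (nu : set T -> R) (F : set T -> X) : fadd nu -> abs_cont mes nu -> fadd F ->
  (forall E, measurable E -> 0 ⊑ F E) -> (forall E, measurable E -> `|F E| <= nu E) ->
  approximable mu F.
Proof.
move=> nadd nac Fadd F0 Fnu e e0.
have [H [F' [hH limH F'add F'b F's]]] := singular_part hL kb (mes_add mu) (fun E _ => mes_ge0 mu E) Fadd F0.
have u0 : 0 ⊑ F setT by apply: F0.
have F'T : F' setT = 0.
  apply: (no_singular_part nadd nac F'add _ _ _ F's).
  - by move=> E /F'b [].
  - by move=> E mE; have [h1 h2] := F'b E mE; apply: le_trans (norm_vle hL h1 h2) (Fnu E mE).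
  - by have [] := F'b setT measurableT.
have F'0 E : measurable E -> F' E = 0.
  move=> mE; have [h1 _] := F'b E mE; apply: (vle_anti _ h1).
  rewrite -F'T (fadd_setD F'add measurableT mE) //.
  have [h2 _] := F'b _ (measurableD measurableT mE).
  by apply: (vle_by h2); vlin.
pose c := e / 8; have c0 : 0 < c by rewrite /c; lra.
pose D i E := H i E - H i.+1 E.
have Dadd i : fadd (D i) by apply: faddB; [case: (hH i)|case: (hH i.+1)].
have Db i E : measurable E -> 0 ⊑ D i E /\ D i E ⊑ mes E *: (i.+1%:R *: F setT).
  move=> mE; have [_ h1] := hH i; have [_ h2] := hH i.+1.
  have [a1 a2 a3 a4] := h1 E mE; have [b1 b2 b3 b4] := h2 E mE.
  split; first exact: vsub_ge0.
  by apply: (vle_by (vleD a2 b3)); rewrite /D; vlin.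
have w0 i : 0 ⊑ i.+1%:R *: F setT by exact: vscale_ge0.
have ex i : {p : label | forall r : label, \sum_(b <- rng r)
    `|D i (cell r b) - \sum_(a <- rng p) mes (cell r b `&` cell p a) *: avg_val mes (D i) p a| <= c * 2^-1 ^+ i}.
  apply: cid; apply: (order_bounded_approx hL kb (mes_add mu) (fun E _ => mes_ge0 mu E) (Dadd i) (Db i) (w0 i)).
  by apply: mulr_gt0 => //; exact: half_pow_gt0.
pose p i := sval (ex i).
pose s i : seq (X * set T) := [seq (avg_val mes (D i) (p i) a, cell (p i) a) | a <- rng (p i)].
have sr i : simple_repr (s i) by move=> q /mapP [a _ ->] /=; exact: measurable_cell.
have sint i E : simple_int mu (s i) E = \sum_(a <- rng (p i)) mes (E `&` cell (p i) a) *: avg_val mes (D i) (p i) a.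
  by rewrite /simple_int big_map.
have sa i : approximates mu (D i) (s i) (c * 2^-1 ^+ i).
  by move=> r; under eq_bigr do rewrite sint; exact: (svalP (ex i)).
have s0 i t : 0 ⊑ simple_eval (s i) t.
  rewrite /simple_eval big_map; apply: vsum_ge0 => a _ /=; apply: vscale_ge0; first by rewrite indicE.
  by have [] := avg_val_bnd (fun E _ => mes_ge0 mu E) (Db i) (w0 i) (p i) a.
have csum m n : \sum_(m <= i < n) c * 2^-1 ^+ i <= 2 * c.
  rewrite -mulr_sumr; have := sum_half_pow_le (R := R) m n.
  have : 2^-1 ^+ m <= 1 :> R by apply: exprn_ile1; lra.
  by nra.
have tele m n E : (m <= n)%N -> \sum_(m <= i < n) D i E = H m E - H n E.
  by move=> mn; rewrite -(opprB (H n E)) -(telescope_sumr (fun i => H i E) mn) -sumrN; apply: eq_bigr => i _; rewrite opprB.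
have err m n (r : label) : (m <= n)%N ->
    \sum_(b <- rng r) `|(H m (cell r b) - H n (cell r b)) - simple_int mu (simple_cat s m n) (cell r b)| <= 2 * c.
  move=> mn; apply: le_trans (csum m n).
  apply: le_trans (_ : \sum_(m <= i < n) \sum_(b <- rng r) `|D i (cell r b) - simple_int mu (s i) (cell r b)| <= _).
    rewrite exchange_big; apply: ler_sum => b _ /=.
    by rewrite -tele // simple_int_scat -sumrB; exact: ler_norm_sum.
  by apply: ler_sum => i _; exact: sa.
have Hdec i E : measurable E -> H i.+1 E ⊑ H i E by move=> mE; have [_ h] := hH i; case: (h E mE).
have HF i E : measurable E -> 0 ⊑ H i E /\ H i E ⊑ F E by move=> mE; have [_ h] := hH i; case: (h E mE).
have hM n : norm_int mu (simple_cat s 0 n) <= nu setT + 2 * c.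
  have [r ->] := simple_int_variation_eq mu (simple_repr_scat (m := 0%N) (n := n) sr).
  rewrite (fadd_total r nadd); apply: le_trans (lerD (lexx _) (err 0%N n r (leq0n n))).
  rewrite -big_split /=; apply: ler_sum => b _.
  set A := H 0%N _ - _; set B := simple_int _ _ _.
  have -> : B = A - (A - B) by vlin.
  apply: le_trans (ler_normB _ _) _; rewrite subKr lerD2r.
  apply: le_trans (Fnu _ (measurable_cell r b)); have mb := measurable_cell r b.
  have [k1 k2] := HF 0%N _ mb; have [k3 k4] := HF n _ mb.
  apply: (norm_vle hL); last by apply: (vle_by (vleD k2 k3)); rewrite /A; vlin.
  apply: vsub_ge0; elim: (n) => [|k IH]; first exact: vlexx.
  exact: vle_trans (Hdec k _ mb) IH.
have [n0 hn0] := simple_monotone hL kb sr s0 hM c0.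
exists (simple_cat s 0 n0); split; first exact: simple_repr_scat.
move=> r.
have H0 E : measurable E -> H 0%N E = F E.
  move=> mE; have [_ h] := hH 0%N; have [_ h1 h2 _] := h E mE; apply: (vle_anti h1).
  by move: h2; rewrite mul0r scale0r subr0.
have tailH : \sum_(b <- rng r) `|H n0 (cell r b)| <= 3 * c.
  have lim : seqlim (fun n => \sum_(b <- rng r) `|H n0 (cell r b) - H n (cell r b)| : R^o)
      (\sum_(b <- rng r) `|H n0 (cell r b)| : R^o).
    apply: (@seqlim_sum _ R^o) => b; apply: seqlim_norm.
    have h := limH _ (measurable_cell r b); rewrite F'0 in h; last exact: measurable_cell.
    by have := seqlimB (seqlim_cst (H n0 (cell r b))) h; rewrite subr0.
  apply: le_trans (ler_norm _) _; apply: (@seqlim_norm_le _ R^o _ _ _ lim).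
  exists n0 => n nn; rewrite ger0_norm; last exact: sumr_ge0.
  have h1 := err n0 n r nn; have h2 := simple_int_variation mu r (simple_repr_scat (m := n0) (n := n) sr).
  have h3 := hn0 n nn.
  apply: le_trans (_ : 2 * c + c <= _); last by lra.
  apply: le_trans (lerD h1 (le_trans h2 h3)); rewrite -big_split /=; apply: ler_sum => b _.
  set A := H n0 _ - _; set B := simple_int _ _ _.
  by rewrite -{1}(subrK B A); exact: ler_normD.
apply: le_trans (_ : 3 * c + 2 * c <= e); last by rewrite /c; lra.
apply: le_trans (lerD tailH (err 0%N n0 r (leq0n n0))); rewrite -big_split /=; apply: ler_sum => b _.
rewrite -(H0 _ (measurable_cell r b)).
set A := H 0%N _; set B := H n0 _; set C := simple_int _ _ _.
have -> : A - C = B + (A - B - C) by vlin.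
exact: ler_normD.
Qed.

(** [F] is the difference of its positive part [P] and of [P - F], both positive; the latter is
    bounded by twice the variation, hence [nu2]. *)
Lemma vector_measure_density (F : set T -> X) : vector_measure F -> bounded_variation F ->
  vabs_continuous F mu -> exists g : T -> X, bochner_density mu F g.
Proof.
move=> hF hv hc; have hadd := vector_measure_fadd hF.
have [nu [n1 n2 n3 n4]] := variation_measure hF hv.
have nac := variation_abs_cont hF hc n1 n2 n3 n4.
have nu0 E : measurable E -> 0 <= nu E by move=> mE; apply: le_trans (n3 E mE).
have csle (p : label) E : measurable E -> `|cell_sum (fun A => vpos L (F A)) p E| <= nu E.
  move=> mE; apply: le_trans (n2 p E mE); apply: le_trans (ler_norm_sum _ _ _) _.
  by apply: ler_sum => k _; exact: norm_vpos.
have [|P [p1 p2 p3 p4]] := pos_part_measure hL kb hadd.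
  by exists (nu setT) => p; exact: csle.
have Pnu E : measurable E -> `|P E| <= nu E.
  move=> mE; apply/ler_addgt0Pr => e e0; have [p hp] := p4 E e mE e0.
  have h := hp (triv_label T); rewrite -[P E](subrK (cell_sum (fun A => vpos L (F A)) (pairl p (triv_label T)) E)).
  by apply: le_trans (ler_normD _ _) _; rewrite addrC; apply: lerD => //; exact: csle.
pose nu2 E := nu E + nu E.
have nadd2 : fadd nu2 by exact: faddD.
have nac2 : abs_cont mes nu2.
  move=> e e0; have [dl dl0 h] := nac (e / 2) ltac:(lra); exists dl => // E mE hE.
  by have := h E mE hE; rewrite /nu2; lra.
pose Q E := P E - F E.
have P0 E : measurable E -> 0 ⊑ P E by move=> mE; apply: vle_trans (vpos_ge0 _) (p3 E mE).
have aP : approximable mu P.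
  apply: (positive_approximable nadd2 nac2 p1 P0) => E mE.
  by apply: le_trans (Pnu E mE) _; rewrite /nu2 lerDl; exact: nu0.
have aQ : approximable mu Q.
  apply: (positive_approximable nadd2 nac2 (faddB p1 hadd)) => E mE.
    by apply: vsub_ge0; apply: vle_trans (vpos_ge _) (p3 E mE).
  by apply: le_trans (ler_normB _ _) _; apply: lerD; [exact: Pnu|exact: n3].
apply: approximable_density => e e0; have e2 : 0 < e / 2 by lra.
have [s [sr sa]] := aP _ e2; have [s' [sr' sa']] := aQ _ e2.
exists (s ++ simple_opp s'); split; first exact: simple_diff_repr.
move=> r; apply: le_trans (_ : e / 2 + e / 2 <= e); last by lra.
apply: le_trans (lerD (sa r) (sa' r)); rewrite -big_split /=; apply: ler_sum => b _.
rewrite simple_diff_int /Q.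
have -> : F (cell r b) - (simple_int mu s (cell r b) - simple_int mu s' (cell r b)) =
  (P (cell r b) - simple_int mu s (cell r b)) - (P (cell r b) - F (cell r b) - simple_int mu s' (cell r b)) by vlin.
exact: ler_normB.
Qed.
End VectorMeasures.

Lemma solid_extreme_RNP (R : realType) (X : completeNormedModType R) (L : vector_lattice X) :
  lattice_norm L -> solid_extreme_property L -> RNP X.
Proof.
move=> hL star d T mu F hF hv hc; exact: (vector_measure_density hL star hF hv hc).
Qed.

(** * Dyadic martingales *)

Section Density.
Context (d : measure_display) (T : measurableType d).
Variables (R : realType) (X : completeNormedModType R).
Variable mu : {finite_measure set T -> \bar R}.
Local Notation label := (label T).
Local Notation mes := (mes mu).
Ltac vlin := vlin_with R X.

(** Converse to [approximable_density]: on a partition, the variation of [F - s n0] is the limit of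
    those of [s m - s n0], which are bounded by L^1 distances through [g]. *)
Lemma density_approximable (F : set T -> X) g : bochner_density mu F g -> approximable mu F.
Proof.
case=> s [sr _ ms sg sF] e e0.
have /fine_cvgP [fin /cvgrPdist_le h] := sg.
have [N _ hN] := h (e / 2) ltac:(lra); have [N' _ hN'] := fin.
pose a n := (\int[mu]_t (`|simple_eval (s n) t - g t|)%:E)%E.
have ha n : (N <= n)%N -> (N' <= n)%N -> (a n <= (e / 2)%:E)%E.
  move=> Nn N'n; rewrite -[a n](fineK (hN' n N'n)) lee_fin.
  by have := hN n Nn; rewrite /= sub0r normrN; exact: le_trans (ler_norm _).
set n0 := maxn N N'.
have hn0 := ha n0 (leq_maxl _ _) (leq_maxr _ _).
exists (s n0); split=> // r.
have lim : seqlim (fun m => \sum_(b <- rng r) `|simple_int mu (s m) (cell r b) - simple_int mu (s n0) (cell r b)| : R^o)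
    (\sum_(b <- rng r) `|F (cell r b) - simple_int mu (s n0) (cell r b)| : R^o).
  apply: (@seqlim_sum _ R^o) => b; apply: seqlim_norm.
  by apply: seqlimB; [apply/seqlim_cvg; apply: sF; exact: measurable_cell|exact: seqlim_cst].
apply: le_trans (ler_norm _) _; apply: (@seqlim_norm_le _ R^o _ _ _ lim).
exists n0 => m nm; rewrite ger0_norm; last exact: sumr_ge0.
under eq_bigr do rewrite -simple_diff_int.
have dr := simple_diff_repr (sr m) (sr n0).
apply: le_trans (simple_int_variation mu r dr) _.
rewrite -lee_fin -(norm_intE mu dr).
apply: le_trans (_ : (a m + a n0 <= _)%E); last first.
  have -> : e%:E = ((e / 2)%:E + (e / 2)%:E)%E by rewrite -EFinD -splitr.
  apply: leeD => //; apply: ha; [exact: leq_trans (leq_maxl _ _) nm|exact: leq_trans (leq_maxr _ _) nm].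
rewrite /a -ge0_integralD //=; try by move=> t _; rewrite lee_fin.
- apply: ge0_le_integral => //=.
  + by apply/measurable_EFinP; exact: (measurable_norm_simple mu dr).
  + by apply: emeasurable_funD; apply/measurable_EFinP.
  + move=> t _; rewrite -EFinD lee_fin simple_diff_eval.
    have -> : simple_eval (s m) t - simple_eval (s n0) t =
      (simple_eval (s m) t - g t) - (simple_eval (s n0) t - g t) by vlin.
    exact: ler_normB.
- by apply/measurable_EFinP.
- by apply/measurable_EFinP.
Qed.


Lemma mes_vector_measure : vector_measure (X := R^o) mes.
Proof.
move=> A mA tA; have mU : measurable (\bigcup_n A n) by exact: bigcup_measurable.
have h := @measure_sigma_additive _ R T mu A mA tA.
suff : (fun n => (\sum_(k < n) mes (A k))%:E) @ \oo --> (mes (\bigcup_n A n))%:E by exact: fine_cvg.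
have -> : (fun n => (\sum_(k < n) mes (A k))%:E) = (fun n => (\sum_(0 <= k < n) mu (A k))%E).
  by apply/funext => n; rewrite big_mkord -sumEFin; apply: eq_bigr => k _; rewrite [RHS](mesE mu (mA k)).
have e : mu (\bigcup_n A n) = (mes (\bigcup_n A n))%:E := mesE mu mU.
rewrite -e; exact: h.
Qed.

Lemma sum_mes_le (A : nat -> set T) n : (forall k, measurable (A k)) -> trivIset setT A ->
  \sum_(k < n) mes (A k) <= mes setT.
Proof.
move=> mA tA; have mU k : measurable (\big[setU/set0]_(i < k) A i) by exact: bigsetU_measurable.
suff -> : \sum_(k < n) mes (A k) = mes (\big[setU/set0]_(k < n) A k) by exact: mes_le.
elim: n => [|n IH]; first by rewrite !big_ord0 mes0.
rewrite !big_ord_recr /= IH (mes_add mu (mU n) (mA n)) //; apply/seteqP; split=> // t [].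
rewrite -bigcup_mkord => -[i /= ilt Ai] An.
by have e := tA i n I I (ex_intro _ t (conj Ai An)); rewrite e ltnn in ilt.
Qed.

Lemma dominated_vector_measure (F : set T -> X) B : fadd F ->
  (forall E, measurable E -> `|F E| <= B * mes E) -> vector_measure F.
Proof.
move=> hF hB A mA tA; apply/seqlim_cvg.
have mU k : measurable (\big[setU/set0]_(i < k) A i) by exact: bigsetU_measurable.
have mV : measurable (\bigcup_n A n) by exact: bigcup_measurable.
have sub k : \big[setU/set0]_(i < k) A i `<=` \bigcup_n A n.
  by rewrite -bigcup_mkord => t [i _ Ai]; exists i.
have key (V : zmodType) (G : set T -> V) n : fadd G -> \sum_(k < n) G (A k) = G (\big[setU/set0]_(k < n) A k).
  move=> hG; elim: n => [|n IH]; first by rewrite !big_ord0 fadd0.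
  rewrite !big_ord_recr /= IH (hG _ _ (mU n) (mA n)) //; apply/seteqP; split=> // t [].
  rewrite -bigcup_mkord => -[i /= ilt Ai] An.
  by have e := tA i n I I (ex_intro _ t (conj Ai An)); rewrite e ltnn in ilt.
have tail n : F (\bigcup_n A n) - \sum_(k < n) F (A k) = F (\bigcup_n A n `\` \big[setU/set0]_(k < n) A k).
  by rewrite key // (fadd_setD hF mV (mU n) (sub n)); vlin.
have tailm n : mes (\bigcup_n A n) - \sum_(k < n) mes (A k) = mes (\bigcup_n A n `\` \big[setU/set0]_(k < n) A k).
  by rewrite (key R) //; [rewrite (fadd_setD (mes_add mu) mV (mU n) (sub n)); lra|exact: mes_add].
have /seqlim_cvg h := mes_vector_measure mA tA.
move=> e e0; have B0 : 0 < `|B| + 1 by have := normr_ge0 B; lra.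
have [N hN] := h (e / (`|B| + 1)) (divr_gt0 e0 B0).
exists N => n Nn; rewrite distrC tail; apply: le_trans (hB _ (measurableD mV (mU n))) _.
have := hN n Nn; rewrite distrC tailm ger0_norm ?mes_ge0 // => h1.
apply: le_trans (_ : (`|B| + 1) * (e / (`|B| + 1)) <= _); last by rewrite mulrC divfK // gt_eqF.
have B1 : B <= `|B| + 1 by have := ler_norm B; lra.
apply: le_trans (ler_wpM2r (mes_ge0 mu _) B1) _; exact: (ler_wpM2l (ltW B0) h1).
Qed.
End Density.

Lemma sum_blocks (V : nmodType) (a b : nat) (f : nat -> V) :
  \sum_(0 <= k < a * b) f k = \sum_(0 <= i < a) \sum_(0 <= j < b) f (i * b + j)%N.
Proof.
elim: a => [|a IH]; first by rewrite mul0n !big_geq.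
rewrite mulSnr (big_cat_nat (n := (a * b)%N)) ?leq_addr //= IH big_nat_recr //=; congr (_ + _).
by rewrite -{1}[(a * b)%N]addn0 addnC big_addn addKn; apply: eq_bigr => j _; rewrite addnC.
Qed.

Section Dyadic.
Context (d : measure_display) (T : measurableType d) (R : realType).
Variable mu : {finite_measure set T -> \bar R}.
Local Notation label := (label T).
Local Notation mes := (mes mu).

(** Abstract dyadic filtration of a probability space: dropping the last [m] binary digits of an
    index of level [n + m] gives the index of level [n]. *)
Record dyadic_system := DyadicSystem {
  dyadic :> nat -> label;
  dyadic_rng : forall n, rng (dyadic n) = index_iota 0 (2 ^ n);
  dyadic_parent : forall n m t, dyadic n t = (dyadic (n + m)%N t %/ 2 ^ m)%N;
  dyadic_mes : forall n k, (k < 2 ^ n)%N -> mes (cell (dyadic n) k) = 2^-1 ^+ n;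
  dyadic_dense : forall E (e : R), measurable E -> 0 < e -> exists n (P : pred nat),
    mes (E `\` [set t | P (dyadic n t)]) <= e /\ mes ([set t | P (dyadic n t)] `\` E) <= e }.

Variable dl : dyadic_system.

Lemma dyadic_level n m (P : pred nat) : [set t | P (dl n t)] = [set t | P (dl (n + m)%N t %/ 2 ^ m)%N].
Proof. by apply/seteqP; split=> t /=; rewrite -dyadic_parent. Qed.

Lemma cell_dyadic n m k : cell (dl n) k = [set t | (dl (n + m)%N t %/ 2 ^ m)%N == k].
Proof.
by apply/seteqP; split=> t /=; rewrite -dyadic_parent => /eqP.
Qed.

Section Limit.
Variables (X : completeNormedModType R) (s : nat -> set T -> X) (B : R).
Hypothesis s_add : forall i, fadd (s i).
Hypothesis s_bnd : forall i E, measurable E -> `|s i E| <= B * mes E.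
Hypothesis s_lim : forall n k, (k < 2 ^ n)%N -> exists l, seqlim (fun i => s i (cell (dl n) k)) l.
Ltac vlin := vlin_with R X.

(** [E] is replaced by a union of dyadic cells of one level; the domination by [B mes] makes the
    error uniform in the index of the sequence. *)
Lemma dyadic_limit_ex E : measurable E -> exists l, seqlim (fun i => s i E) l.
Proof.
move=> mE; apply: cauchy_seqlim => e e0.
have B0 : 0 < `|B| + 1 by have := normr_ge0 B; lra.
have [n [P [h1 h2]]] := dyadic_dense dl mE (divr_gt0 (divr_gt0 e0 (ltr0n R 8)) B0).
set A := [set t | P (dl n t)] in h1 h2.
have mA : measurable A by exact: (label_pred_meas (dl n) P).
have [l hl] : exists l, seqlim (fun i => s i A) l.
  have ex k : exists l, (k < 2 ^ n)%N -> seqlim (fun i => s i (cell (dl n) k)) l.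
    by case: (ltnP k (2 ^ n)) => [/s_lim [l hl]|_]; [exists l|exists 0].
  have [g hg] := choice ex.
  exists (\sum_(k <- rng (dl n) | P k) (if (k < 2 ^ n)%N then g k else 0)).
  have -> : (fun i => s i A) = (fun i => \sum_(k <- rng (dl n) | P k) (if (k < 2 ^ n)%N then s i (cell (dl n) k) else 0)).
    apply/funext => i; rewrite (fadd_pred (dl n) P (s_add i)) big_seq_cond [RHS]big_seq_cond.
    by apply: eq_bigr => k /andP[]; rewrite dyadic_rng mem_index_iota /= => ->.
  rewrite big_mkcond; under eq_fun do rewrite big_mkcond.
  apply: seqlim_sum => k; case: ifP => _; last exact: seqlim_cst.
  by case: ifP => h; [exact: hg|exact: seqlim_cst].
have bnd C : measurable C -> mes C <= e / 8 / (`|B| + 1) -> forall i, `|s i C| <= e / 8.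
  move=> mC hC i; apply: le_trans (s_bnd i mC) _.
  have B1 : B <= `|B| + 1 by have := ler_norm B; lra.
  apply: le_trans (ler_wpM2r (mes_ge0 mu C) B1) _.
  by apply: le_trans (ler_wpM2l (ltW B0) hC) _; rewrite mulrC divfK // gt_eqF.
have near i : `|s i E - s i A| <= e / 4.
  have mI : measurable (E `&` A) by exact: measurableI.
  rewrite (fadd_setD (s_add i) mE mI); last by move=> t [].
  rewrite (fadd_setD (s_add i) mA mI); last by move=> t [].
  have -> : E `\` (E `&` A) = E `\` A by rewrite setDIr setDv set0U.
  have -> : A `\` (E `&` A) = A `\` E by rewrite setDIr setDv setU0.
  have -> : s i (E `&` A) + s i (E `\` A) - (s i (E `&` A) + s i (A `\` E)) = s i (E `\` A) - s i (A `\` E) by vlin.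
  apply: le_trans (ler_normB _ _) _.
  have := bnd _ (measurableD mE mA) h1 i; have := bnd _ (measurableD mA mE) h2 i; lra.
have [N hN] := hl (e / 4) ltac:(lra); exists N => i j Ni Nj.
have -> : s i E - s j E = (s i E - s i A) + (s i A - l) - (s j E - s j A) - (s j A - l) by vlin.
have := hN i Ni; have := hN j Nj; have := near i; have := near j => a1 a2 a3 a4.
apply: le_trans (ler_normB _ _) _; apply: le_trans (lerD (ler_normB _ _) (lexx _)) _.
by apply: le_trans (lerD (lerD (ler_normD _ _) (lexx _)) (lexx _)) _; lra.
Qed.

Lemma dyadic_limit : exists F : set T -> X, [/\ fadd F,
  forall E, measurable E -> seqlim (fun i => s i E) (F E) &
  forall E, measurable E -> `|F E| <= B * mes E].
Proof.
have ex E : exists l, measurable E -> seqlim (fun i => s i E) l.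
  by have [/dyadic_limit_ex[l hl]|no] := pselect (measurable E); [exists l|exists 0].
have [F hF] := choice ex; exists F; split=> // [A C mA mC AC|E mE].
- apply: (seqlim_uniq (hF _ (measurableU _ _ mA mC))).
  by under eq_fun do rewrite s_add //; apply: seqlimD; exact: hF.
- by apply: (seqlim_norm_le (hF E mE)); exists 0%N => i _; exact: s_bnd.
Qed.

Lemma step_approx (r : seq (X * set T)) : simple_repr r -> forall e : R, 0 < e ->
  exists n0, forall n, (n0 <= n)%N -> exists v : nat -> X, forall q : label,
    \sum_(b <- rng q) `|simple_int mu r (cell q b) -
       \sum_(a <- rng (dl n)) mes (cell q b `&` cell (dl n) a) *: v a| <= e.
Proof.
elim: r => [_ e e0|[x A] r IH hr e e0].
  exists 0%N => n _; exists (fun=> 0) => q.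
  by rewrite big1 ?ltW // => b _; rewrite /simple_int big_nil big1 ?subrr ?normr0 // => a _; rewrite scaler0.
have mA : measurable A by apply: (hr (x, A)); rewrite mem_head.
have [n1 h1] := IH (fun p pr => hr p (mem_behead (s := _ :: _) pr)) (e / 2) ltac:(lra).
have x0 : 0 < `|x| + 1 by have := normr_ge0 x; lra.
have [n2 [P [h2 h3]]] := dyadic_dense dl mA (divr_gt0 (divr_gt0 e0 (ltr0n R 4)) x0).
exists (maxn n1 n2) => n nn.
have [v hv] := h1 n (leq_trans (leq_maxl _ _) nn).
have n2n : (n2 <= n)%N := leq_trans (leq_maxr _ _) nn.
rewrite (dyadic_level n2 (n - n2) P) (subnKC n2n) in h2 h3.
set C := [set t | _] in h2 h3.
have mC : measurable C by exact: (label_pred_meas (dl n) (fun k => P (k %/ 2 ^ (n - n2))%N)).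
exists (fun a => v a + (if P (a %/ 2 ^ (n - n2))%N then x else 0)) => q.
have key E : measurable E -> \sum_(a <- rng (dl n)) mes (E `&` cell (dl n) a) *:
    (v a + (if P (a %/ 2 ^ (n - n2))%N then x else 0)) =
    \sum_(a <- rng (dl n)) mes (E `&` cell (dl n) a) *: v a + mes (E `&` C) *: x.
  move=> mE; under eq_bigr do rewrite scalerDr; rewrite big_split /=; congr (_ + _).
  have hadd : fadd (fun D => mes (E `&` D)).
    move=> D D' mD mD' DD; rewrite setIUr (mes_add mu) //; try exact: measurableI.
    by rewrite setIACA DD setI0.
  rewrite (fadd_pred (dl n) (fun k => P (k %/ 2 ^ (n - n2))%N) hadd) scaler_suml [RHS]big_mkcond.
  by apply: eq_bigr => a _; case: ifP => _ //; rewrite scaler0.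
apply: le_trans (_ : \sum_(b <- rng q) (`|simple_int mu r (cell q b) -
     \sum_(a <- rng (dl n)) mes (cell q b `&` cell (dl n) a) *: v a| +
     (mes ((A `\` C) `&` cell q b) + mes ((C `\` A) `&` cell q b)) * `|x|) <= _).
  apply: ler_sum => b _; have mb := measurable_cell q b.
  rewrite key // /simple_int big_cons /= -/(simple_int mu r _) -/(mes _).
  set U := simple_int mu r _; set V := \sum_(a <- _) _.
  have -> : mes (cell q b `&` A) *: x + U - (V + mes (cell q b `&` C) *: x) =
     (U - V) + (mes (cell q b `&` A) - mes (cell q b `&` C)) *: x by vlin.
  apply: le_trans (ler_normD _ _) _; rewrite lerD2l normrZ; apply: ler_wpM2r => //.
  have mI : measurable (cell q b `&` A `&` C) by apply: measurableI => //; exact: measurableI.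
  rewrite (fadd_setD (mes_add mu) (measurableI _ _ mb mA) mI); last by move=> t [].
  rewrite (fadd_setD (mes_add mu) (measurableI _ _ mb mC) mI); last by move=> t [[]].
  have -> : (cell q b `&` A) `\` (cell q b `&` A `&` C) = (A `\` C) `&` cell q b.
    by apply/seteqP; split=> [t [[tb tA] nI]|t [[tA nC] tb]]; [split=> //; split=> // tC; exact: nI|split=> // -[]].
  have -> : (cell q b `&` C) `\` (cell q b `&` A `&` C) = (C `\` A) `&` cell q b.
    by apply/seteqP; split=> [t [[tb tA] nI]|t [[tA nC] tb]]; [split=> //; split=> // tC; exact: nI|split=> // -[[]]].
  have := mes_ge0 mu ((A `\` C) `&` cell q b); have := mes_ge0 mu ((C `\` A) `&` cell q b).
  by set a1 := mes _; set a2 := mes (_ `&` cell q b) => p1 p2; rewrite ler_norml; apply/andP; split; lra.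
rewrite big_split /= -mulr_suml big_split /=.
rewrite -(fadd_label q (mes_add mu) (measurableD mA mC)) -(fadd_label q (mes_add mu) (measurableD mC mA)).
apply: le_trans (lerD (hv q) (ler_wpM2r (normr_ge0 x) (lerD h2 h3))) _.
have : e / 4 / (`|x| + 1) * (`|x| + 1) = e / 4 by rewrite divfK // gt_eqF.
have : 0 <= e / 4 / (`|x| + 1) by apply: divr_ge0; lra.
by set c := e / 4 / _; nra.
Qed.

(** The sum is the L^1 distance between the averages of [F] at levels [n] and [N]. A step function
    of level [N] lies within [e / 2] of [F] in variation; it is its own average, and averaging does
    not increase the distance, which gives [e / 2] twice. *)
Lemma dyadic_density (F : set T -> X) : fadd F -> approximable mu F -> forall e : R, 0 < e -> exists N, forall n, (N <= n)%N ->
  \sum_(0 <= k < 2 ^ n) `|F (cell (dl n) k) -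
     2^-1 ^+ (n - N) *: F (cell (dl N) (k %/ 2 ^ (n - N)))| <= e.
Proof.
move=> hF ap e e0; have [r [hr ar]] := ap (e / 4) ltac:(lra).
have [N h] := step_approx hr (e := e / 4) ltac:(lra).
have [v hv] := h N (leqnn N); exists N => n Nn.
pose V (E : set T) := \sum_(a <- rng (dl N)) mes (E `&` cell (dl N) a) *: v a.
have hV (q : label) : \sum_(b <- rng q) `|F (cell q b) - V (cell q b)| <= e / 2.
  apply: le_trans (_ : e / 4 + e / 4 <= _); last lra.
  apply: le_trans (lerD (ar q) (hv q)); rewrite -big_split /=; apply: ler_sum => b _.
  set a1 := F _; set a2 := simple_int _ _ _; rewrite -/(V (cell q b)).
  have -> : a1 - V (cell q b) = (a1 - a2) + (a2 - V (cell q b)) by vlin.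
  exact: ler_normD.
have Vn m k : (k < 2 ^ (N + m))%N -> V (cell (dl (N + m)%N) k) = 2^-1 ^+ (N + m) *: v (k %/ 2 ^ m)%N.
  move=> kn; have kN : (k %/ 2 ^ m < 2 ^ N)%N by rewrite ltn_divLR ?expn_gt0 // -expnD.
  rewrite /V (bigD1_seq (k %/ 2 ^ m)%N) /=; first last.
  - exact: rng_uniq.
  - by rewrite dyadic_rng mem_index_iota.
  rewrite big1 ?addr0 => [|a ak].
    rewrite -(dyadic_mes dl kn); congr (mes _ *: _); apply/seteqP; split=> [t []|t tk] //; split=> //.
    by rewrite (cell_dyadic N m) /= (tk : dl _ t = k).
  rewrite [X in mes X](_ : _ = set0) ?mes0 ?scale0r //; apply/seteqP; split=> // t [/= tk].
  by rewrite (cell_dyadic N m) /= (tk : dl _ t = k) => /eqP ka; rewrite ka eqxx in ak.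
pose m := (n - N)%N; have nE : n = (N + m)%N by rewrite /m subnKC.
rewrite -/m nE.
have V0 K : (K < 2 ^ N)%N -> V (cell (dl N) K) = 2^-1 ^+ N *: v K.
  by move=> KN; have := Vn 0%N K; rewrite addn0 expn0 divn1; apply.
apply: le_trans (_ : \sum_(0 <= k < 2 ^ (N + m)) (`|F (cell (dl (N + m)%N) k) - V (cell (dl (N + m)%N) k)| +
   2^-1 ^+ m * `|F (cell (dl N) (k %/ 2 ^ m)) - V (cell (dl N) (k %/ 2 ^ m))|) <= _).
  rewrite big_nat_cond [leRHS]big_nat_cond; apply: ler_sum => k /andP[/andP[_ kn] _].
  have kN : (k %/ 2 ^ m < 2 ^ N)%N by rewrite ltn_divLR ?expn_gt0 // -expnD.
  have p0 := half_pow_gt0 (R := R) m.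
  rewrite -(ger0_norm (ltW p0)) -normrZ (ger0_norm (ltW p0)).
  set a1 := F _; set a2 := F _; set a3 := V (cell (dl (N + m)%N) k).
  have e3 : a3 = 2^-1 ^+ m *: V (cell (dl N) (k %/ 2 ^ m)).
    by rewrite /a3 Vn // V0 // scalerA exprD mulrC.
  have -> : a1 - 2^-1 ^+ m *: a2 = (a1 - a3) - 2^-1 ^+ m *: (a2 - V (cell (dl N) (k %/ 2 ^ m))).
    by rewrite scalerBr -e3; vlin.
  exact: ler_normB.
rewrite big_split /= -mulr_sumr.
have hS q : \sum_(0 <= b < 2 ^ q) `|F (cell (dl q) b) - V (cell (dl q) b)| <= e / 2.
  by have := hV (dl q); rewrite dyadic_rng.
have -> : \sum_(0 <= k < 2 ^ (N + m)) `|F (cell (dl N) (k %/ 2 ^ m)) - V (cell (dl N) (k %/ 2 ^ m))| =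
   2 ^+ m * \sum_(0 <= K < 2 ^ N) `|F (cell (dl N) K) - V (cell (dl N) K)|.
  rewrite expnD sum_blocks mulr_sumr; apply: eq_bigr => K _.
  rewrite big_nat_cond (eq_bigr (fun=> `|F (cell (dl N) K) - V (cell (dl N) K)|)); last first.
    by move=> j /andP[/andP[_ jm] _]; rewrite divnMDl ?expn_gt0 // divn_small // addn0.
  by rewrite -big_nat_cond sumr_const_nat subn0 -[LHS]mulr_natl natrX.
rewrite mulrA -exprMn mulVf ?pnatr_eq0 // expr1n mul1r.
have := hS (N + m)%N; have := hS N; lra.
Qed.

(* The limit of uniformly dominated charges converging on dyadic cells is a
   vector measure; its density makes the martingale of its averages L^1-Cauchy. *)
Lemma RNP_dyadic : RNP X -> exists F : set T -> X, [/\ fadd F,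
  forall E, measurable E -> seqlim (fun i => s i E) (F E),
  forall E, measurable E -> `|F E| <= B * mes E &
  forall e : R, 0 < e -> exists N, forall n, (N <= n)%N ->
  \sum_(0 <= k < 2 ^ n) `|F (cell (dl n) k) -
     2^-1 ^+ (n - N) *: F (cell (dl N) (k %/ 2 ^ (n - N)))| <= e].
Proof.
move=> rnp; have [F [F1 F2 F3]] := dyadic_limit; exists F; split=> //.
have [||| g hg] := rnp _ _ mu F.
- exact: dominated_vector_measure F3.
- exists (`|B| * mes setT) => n A mA tA.
  apply: le_trans (_ : \sum_(k < n) `|B| * mes (A k) <= _); last first.
    rewrite -mulr_sumr; apply: ler_wpM2l => //; exact: sum_mes_le.
  apply: ler_sum => k _; apply: le_trans (F3 _ (mA k)) _.
  apply: ler_wpM2r; [exact: mes_ge0|exact: ler_norm].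
- move=> E mE E0; apply/eqP; rewrite -normr_eq0 eq_le normr_ge0 andbT.
  by apply: le_trans (F3 E mE) _; rewrite /mes E0 mulr0.
exact: (dyadic_density F1 (density_approximable hg)).
Qed.
End Limit.
End Dyadic.

(** * Approximation of measurable sets by dyadic ones *)

Section DyadicDense.
Context (d : measure_display) (T : measurableType d) (R : realType).
Variable mu : {finite_measure set T -> \bar R}.
Local Notation mes := (mes mu).
Variable dl : nat -> label T.
Hypothesis dl_parent : forall n m t, dl n t = (dl (n + m)%N t %/ 2 ^ m)%N.

Lemma mes_subadd A B C : measurable A -> measurable B -> measurable C -> C `<=` A `|` B ->
  mes C <= mes A + mes B.
Proof.
move=> mA mB mC CAB; apply: le_trans (_ : mes (A `|` (B `\` A)) <= _).
  apply: mes_le => //; first by apply: measurableU => //; exact: measurableD.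
  move=> t /CAB [At|Bt]; first by left.
  by have [At|nA] := pselect (A t); [left|right].
rewrite (mes_add mu mA (measurableD mB mA)); last by apply/seteqP; split=> // t [At [_ nA]].
by rewrite lerD2l; apply: (mes_le mu (measurableD mB mA) mB) => t [].
Qed.

Definition dyadic_approx (E : set T) := measurable E /\ forall e : R, 0 < e -> exists n (P : pred nat),
  mes (E `\` [set t | P (dl n t)]) <= e /\ mes ([set t | P (dl n t)] `\` E) <= e.

Lemma dyadic_approx0 : dyadic_approx set0.
Proof.
split=> // e e0; exists 0%N, pred0; rewrite set0D.
have -> : [set t | pred0 (dl 0%N t)] = set0 by apply/seteqP; split.
by rewrite set0D mes0; split; exact: ltW.
Qed.

Lemma dyadic_approxC E : dyadic_approx E -> dyadic_approx (~` E).
Proof.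
case=> mE h; split; first exact: measurableC.
move=> e e0; have [n [P [h1 h2]]] := h e e0; exists n, (fun k => ~~ P k).
have eq : [set t | ~~ P (dl n t)] = ~` [set t | P (dl n t)] by apply/seteqP; split=> t /negP.
have eD (A B : set T) : ~` A `\` ~` B = B `\` A by rewrite setDE setCK setIC -setDE.
by rewrite eq !eD.
Qed.

Lemma dyadic_approxU A B : dyadic_approx A -> dyadic_approx B -> dyadic_approx (A `|` B).
Proof.
move=> [mA hA] [mB hB]; split; first exact: measurableU.
move=> e e0; have [n [P [a1 a2]]] := hA (e / 2) ltac:(lra); have [m [Q [b1 b2]]] := hB (e / 2) ltac:(lra).
exists (n + m)%N, (fun k => P (k %/ 2 ^ m)%N || Q (k %/ 2 ^ n)%N).
have -> : [set t | P (dl (n + m)%N t %/ 2 ^ m)%N || Q (dl (n + m)%N t %/ 2 ^ n)%N] =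
   [set t | P (dl n t)] `|` [set t | Q (dl m t)].
  apply/seteqP; split=> t /=; rewrite -dl_parent addnC -dl_parent.
    by move=> /orP.
  by move=> h; apply/orP.
have mP := label_pred_meas (dl n) P; have mQ := label_pred_meas (dl m) Q.
set A' := [set t | _] in a1 a2 mP *; set B' := [set t | _] in b1 b2 mQ *.
have dm (C D : set T) : measurable C -> measurable D -> measurable (C `\` D) by exact: measurableD.
have um (C D : set T) : measurable C -> measurable D -> measurable (C `|` D) by exact: measurableU.
split.
  apply: le_trans (_ : mes (A `\` A') + mes (B `\` B') <= _); last by lra.
  apply: mes_subadd; try by [exact: dm|apply: dm; exact: um].
  by move=> t [[At|Bt] nAB]; [left|right]; split=> // h; apply: nAB; [left|right].
apply: le_trans (_ : mes (A' `\` A) + mes (B' `\` B) <= _); last by lra.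
apply: mes_subadd; try by [exact: dm|apply: dm; exact: um].
by move=> t [[At|Bt] nAB]; [left|right]; split=> // h; apply: nAB; [left|right].
Qed.

(** By continuity of the measure a finite union misses at most [e / 2], and finite unions are
    already covered. *)
Lemma dyadic_approx_bigcup (E : nat -> set T) : (forall i, dyadic_approx (E i)) -> dyadic_approx (\bigcup_i E i).
Proof.
move=> hE; have mE i : measurable (E i) by case: (hE i).
have mU : measurable (\bigcup_i E i) by exact: bigcup_measurable.
split=> // e e0.
pose U n := \big[setU/set0]_(i < n) E i.
have hU n : dyadic_approx (U n).
  elim: n => [|n IH]; first by rewrite /U big_ord0; exact: dyadic_approx0.
  by rewrite /U big_ord_recr /=; exact: dyadic_approxU.
have mUn n : measurable (U n) by case: (hU n).
have UE n : U n `<=` \bigcup_i E i by rewrite /U -bigcup_mkord => t [i _ Et]; exists i.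
have [||| N hN] := vector_measure_continuous (A := fun n => \bigcup_i E i `\` U n) (@mes_vector_measure _ _ _ mu) _ _ _ (divr_gt0 e0 (ltr0n R 2)).
- by move=> n; exact: measurableD.
- by move=> n t [Et nU]; split=> // Ut; apply: nU; rewrite /U big_ord_recr /=; left.
- have -> : \bigcap_n (\bigcup_i E i `\` U n) = set0; last exact: mes0.
  apply/seteqP; split=> // t h; have [[i _ Ei] _] := h 0%N I.
  by have [_] := h i.+1 I; apply; rewrite /U big_ord_recr /=; right.
have {}hN := hN N (leqnn N); rewrite subr0 ger0_norm ?mes_ge0 // in hN.
have [n [P [h1 h2]]] := (hU N).2 (e / 2) ltac:(lra).
have mP := label_pred_meas (dl n) P; exists n, P; set A := [set t | _] in h1 h2 mP *; split.
  apply: le_trans (_ : mes (\bigcup_i E i `\` U N) + mes (U N `\` A) <= _); last by lra.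
  apply: mes_subadd; try exact: measurableD.
  by move=> t [Et nA]; have [Ut|nU] := pselect (U N t); [right|left].
apply: le_trans (mes_le mu _ _ _) (_ : mes (A `\` U N) <= e); last by lra.
- exact: measurableD.
- exact: measurableD.
by move=> t [At nE]; split=> // /UE.
Qed.

Lemma dyadic_approx_sigma (G : set (set T)) : G `<=` dyadic_approx -> <<s G >> `<=` dyadic_approx.
Proof.
move=> GA; apply: smallest_sub => //; split.
- exact: dyadic_approx0.
- by move=> A hA; rewrite setTD; exact: dyadic_approxC.
- exact: dyadic_approx_bigcup.
Qed.
End DyadicDense.

(** * The dyadic filtration of the unit interval *)

Section UnitInterval.
Variable R : realType.
Local Notation Ty := (measurableTypeR R).

Lemma unit_interval_fin : (@lebesgue_measure R (`[0%R, 1%R[%classic : set R) < +oo)%E.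
Proof. by rewrite lebesgue_measure_itv /= lte_fin ltr01 sube0 ltry. Qed.

Definition unit_measure : {finite_measure set Ty -> \bar R} :=
  @mfrestr _ Ty R _ (@lebesgue_measure R) (measurable_itv `[0%R, 1%R[) unit_interval_fin.

(** The measurable space is the whole line; points outside [[0, 1[] receive index 0, and
    [unit_measure] does not charge them. *)
Definition dyadic_index (n : nat) (t : Ty) : nat :=
  if (t : R) \in `[0%R, 1%R[ then Num.truncn (2 ^+ n * (t : R)) else 0%N.

Lemma dyadic_index_lt n t : (dyadic_index n t < 2 ^ n)%N.
Proof.
rewrite /dyadic_index; case: ifP => [|_]; last by rewrite expn_gt0.
rewrite in_itv /= => /andP[t0 t1].
have p0 : 0 < 2 ^+ n :> R by exact: exprn_gt0.
by rewrite truncn_lt_nat ?mulr_ge0 // ?ltW // natrX gtr_pMr.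
Qed.

Lemma dyadic_index_cell n k : (k < 2 ^ n)%N -> [set t : Ty | dyadic_index n t = k] `&` `[0%R, 1%R[%classic =
  (`[k%:R * 2^-1 ^+ n, k.+1%:R * 2^-1 ^+ n[%classic : set R).
Proof.
move=> kn; have p0 : 0 < 2 ^+ n :> R by exact: exprn_gt0.
have e1 (t : R) : (k%:R * 2^-1 ^+ n <= t) = (k%:R <= 2 ^+ n * t).
  by rewrite exprVn ler_pdivrMr // mulrC.
have e2 (t : R) : (t < k.+1%:R * 2^-1 ^+ n) = (2 ^+ n * t < k.+1%:R).
  by rewrite exprVn ltr_pdivlMr // mulrC.
apply/seteqP; split=> t /=; rewrite /dyadic_index !in_itv /= e1 e2.
  by case=> + h; rewrite h; case/andP: h => t0 t1 /eqP; rewrite truncn_eq // mulr_ge0 // ltW.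
move=> h; have t0 : 0 <= (t : R).
  by rewrite -(pmulr_rge0 _ p0); case/andP: h => h _; apply: le_trans h; exact: ler0n.
have t1 : (t : R) < 1.
  rewrite -(gtr_pMr _ p0); case/andP: h => _ h; apply: lt_le_trans h _.
  by rewrite -natrX ler_nat.
by rewrite t0 t1 /=; split=> //; apply/eqP; rewrite truncn_eq // mulr_ge0 // ltW.
Qed.

Lemma measurable_dyadic_index n k : measurable (dyadic_index n @^-1` [set k]).
Proof.
have [kn|nk] := ltnP k (2 ^ n); last first.
  have -> : dyadic_index n @^-1` [set k] = set0; last exact: measurable0.
  by apply/seteqP; split=> // t /= e; have := dyadic_index_lt n t; rewrite e ltnNge nk.
have -> : dyadic_index n @^-1` [set k] = (`[k%:R * 2^-1 ^+ n, k.+1%:R * 2^-1 ^+ n[%classic : set R) `|`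
   (if k == 0%N then ~` (`[0%R, 1%R[%classic : set R) else set0).
  rewrite -dyadic_index_cell //; apply/seteqP; split=> [t /= e|t [[]//|]].
    have [t1|t1] := boolP ((t : R) \in `[0%R, 1%R[); first by left; split.
    by right; move: e; rewrite /dyadic_index (negbTE t1) => <-; rewrite eqxx /=; exact/negP.
  by case: eqP => // -> /= /negP/negbTE h; rewrite /dyadic_index h.
apply: measurableU; first exact: measurable_itv.
by case: ifP => _; [apply: measurableC; exact: measurable_itv|exact: measurable0].
Qed.

Program Definition dyadic_label (n : nat) : label Ty :=
  @Label _ Ty (dyadic_index n) (index_iota 0 (2 ^ n)) _ _ _.
Next Obligation. by move=> n; exact: iota_uniq. Qed.
Next Obligation. by move=> n t; rewrite mem_index_iota dyadic_index_lt. Qed.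
Next Obligation. exact: measurable_dyadic_index. Qed.

Lemma dyadic_index_parent n m t : dyadic_index n t = (dyadic_index (n + m) t %/ 2 ^ m)%N.
Proof.
rewrite /dyadic_index; case: ifP => [|_]; last by rewrite div0n.
rewrite in_itv /= => /andP[t0 t1].
have pn : 0 <= 2 ^+ n * t :> R by rewrite mulr_ge0 // exprn_ge0.
have pm : 0 <= 2 ^+ (n + m) * t :> R by rewrite mulr_ge0 // exprn_ge0.
have p0 : 0 < 2 ^+ m :> R by exact: exprn_gt0.
apply/eqP; rewrite truncn_eq //; have /andP[h1 h2] := truncn_itv pm; set k := Num.truncn _ in h1 h2 *.
rewrite exprD mulrAC in h1 h2.
rewrite -(ler_pM2r p0) -(ltr_pM2r p0) -natrX -!natrM.
apply/andP; split; first by apply: le_trans (_ : k%:R <= _); rewrite ?natrX // ler_nat leq_trunc_div.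
rewrite natrX; apply: lt_le_trans h2 _; rewrite ler_nat.
by rewrite ltn_ceil // expn_gt0.
Qed.

Lemma unit_measure_cell n k : (k < 2 ^ n)%N -> mes unit_measure (cell (dyadic_label n) k) = 2^-1 ^+ n.
Proof.
move=> kn; rewrite /mes /unit_measure /= /mfrestr /mrestr.
rewrite [X in lebesgue_measure X](_ : _ = (`[k%:R * 2^-1 ^+ n, k.+1%:R * 2^-1 ^+ n[%classic : set R)); last exact: dyadic_index_cell.
have p0 := half_pow_gt0 (R := R) n.
rewrite lebesgue_measure_itv /= lte_fin ltr_pM2r // ltr_nat ltnSn -EFinB /=.
by rewrite -mulrBl -natr1 addrAC subrr add0r mul1r.
Qed.

(** Take the cells whose left endpoint exceeds [x]. In the unit interval they lie in the ray and
    miss only part of an interval of length [2^-n] to the right of [x]. *)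
Lemma ray_dyadic_approx (x : R) : dyadic_approx unit_measure dyadic_label (`]x, +oo[%classic : set R).
Proof.
split; first exact: measurable_itv.
move=> e e0; have [n hn] := half_pow_small 1 e0; have {}hn := hn n (leqnn n); rewrite mul1r in hn.
have p0 : 0 < 2 ^+ n :> R by exact: exprn_gt0.
pose P (k : nat) := 2 ^+ n * x < k%:R; exists n, P.
have mP := label_pred_meas (dyadic_label n) P; set A := [set t | _] in mP *.
have mI : measurable (`]x, +oo[%classic : set R) by exact: measurable_itv.
have z0 : mes unit_measure (A `\` (`]x, +oo[%classic : set R)) = 0.
  rewrite /mes /unit_measure /= /mfrestr /mrestr [X in lebesgue_measure X](_ : _ = set0) ?measure0 //.
  apply/seteqP; split=> // t [[At nx] /= t01]; apply: nx; move: At; rewrite /A /P /= /dyadic_index t01 => h.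
  move: t01; rewrite !in_itv /= andbT => /andP[t0 t1].
  rewrite -(ltr_pM2l p0); apply: lt_le_trans h _; rewrite truncn_le; exact: mulr_ge0 (ltW p0) t0.
split; last by rewrite z0 ltW.
apply: le_trans hn.
have le1 : (lebesgue_measure (((`]x, +oo[%classic : set R) `\` A) `&` (`[0%R, 1%R[%classic : set R)) <=
   lebesgue_measure (`]x, (x + 2^-1 ^+ n)%R]%classic : set R))%E.
  apply: le_measure; rewrite ?inE.
  - by apply: measurableI; [exact: measurableD|exact: measurable_itv].
  - exact: measurable_itv.
  move=> t [[/= + nA] t01]; rewrite !in_itv /= andbT => xt; rewrite xt /=.
  move: nA; rewrite /A /P /= /dyadic_index t01 => /negP; rewrite -leNgt => h.
  move: t01; rewrite in_itv /= => /andP[t0 t1].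
  have /andP[_ h2] := truncn_itv (mulr_ge0 (ltW p0) t0).
  rewrite -(ler_pM2l p0) mulrDr exprVn mulfV ?gt_eqF //.
  by apply: ltW (lt_le_trans h2 _); rewrite -natr1 lerD2r.
have pn := half_pow_gt0 (R := R) n.
rewrite lebesgue_measure_itv /= lte_fin ltrDl pn -EFinB addrAC subrr add0r in le1.
rewrite -lee_fin -(mesE unit_measure); last exact: measurableD.
exact: le1.
Qed.

Lemma unit_dyadic_dense (E : set Ty) : measurable E -> dyadic_approx unit_measure dyadic_label E.
Proof.
have h : @RGenOInfty.G R `<=` dyadic_approx unit_measure dyadic_label.
  by move=> _ [x ->]; exact: ray_dyadic_approx.
move=> mE; apply: (@dyadic_approx_sigma _ Ty R unit_measure dyadic_label dyadic_index_parent _ h).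
have : (@RGenOInfty.G R).-sigma.-measurable E by rewrite -RGenOInfty.measurableE; exact: mE.
exact.
Qed.

Definition unit_dyadic : dyadic_system unit_measure :=
  DyadicSystem (dyadic := dyadic_label) (fun=> erefl) dyadic_index_parent unit_measure_cell
    (fun E e mE e0 => (unit_dyadic_dense mE).2 e e0).
End UnitInterval.

(** * Extreme points for a domination order *)

Section Average.
Variables (R : realType).

Section Module.
Variable X : lmodType R.
Ltac vlin := vlin_with R X.

Definition avg (n : nat) (f : nat -> X) : X := 2^-1 ^+ n *: \sum_(0 <= k < 2 ^ n) f k.

Definition mid (x y : X) : X := 2^-1 *: (x + y).

Lemma avg0 f : avg 0 f = f 0%N.
Proof. by rewrite /avg expr0 scale1r expn0 big_nat1. Qed.

Lemma eq_avg n f g : (forall k, (k < 2 ^ n)%N -> f k = g k) -> avg n f = avg n g.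
Proof.
move=> h; rewrite /avg big_nat_cond [in RHS]big_nat_cond; congr (_ *: _).
by apply: eq_bigr => k /andP[/andP[_ kn] _]; exact: h.
Qed.

Lemma avg_split n m f : avg (n + m) f = avg n (fun i => avg m (fun j => f (i * 2 ^ m + j)%N)).
Proof. by rewrite /avg expnD sum_blocks exprD -scalerA scaler_sumr. Qed.

Lemma avg_cst n (x : X) : avg n (fun=> x) = x.
Proof.
rewrite /avg sumr_const_nat subn0 -[x *+ _]scaler_nat scalerA natrX -exprMn mulVf ?expr1n ?scale1r // pnatr_eq0.
Qed.

Lemma avgB n f g : avg n (fun k => f k - g k) = avg n f - avg n g.
Proof. by rewrite /avg sumrB scalerBr. Qed.

Lemma avg_mid f g n : avg n.+1 (fun k => if (k < 2 ^ n)%N then f k else g (k - 2 ^ n)%N) = mid (avg n f) (avg n g).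
Proof.
rewrite -add1n avg_split {1}/avg expn1 expr1 big_nat_recr //= big_nat1 /mid; congr (_ *: (_ + _)).
  by apply: eq_avg => k kn; rewrite mul0n add0n kn.
by apply: eq_avg => k kn; rewrite mul1n ltnNge leq_addr /= addKn.
Qed.

Lemma avg_pad n p f : avg (n + p) (fun k => f (k %/ 2 ^ p)%N) = avg n f.
Proof.
rewrite avg_split; apply: eq_avg => k _; rewrite -[RHS](avg_cst p); apply: eq_avg => j jp.
by rewrite divnMDl ?expn_gt0 // divn_small // addn0.
Qed.

Lemma avg_closed (S : set X) : (forall x y, S x -> S y -> S (mid x y)) ->
  forall n f, (forall k, (k < 2 ^ n)%N -> S (f k)) -> S (avg n f).
Proof.
move=> hS; elim=> [|n IH] f hf; first by rewrite avg0; exact: hf.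
have e : avg n.+1 f = mid (avg n f) (avg n (fun k => f (k + 2 ^ n)%N)).
  rewrite -avg_mid; apply: eq_avg => k kn; case: ltnP => // h; by rewrite subnK.
rewrite e; apply: hS; apply: IH => k kn; apply: hf; first by rewrite expnS mul2n -addnn ltn_addr.
by rewrite expnS mul2n -addnn ltn_add2r.
Qed.
End Module.

Lemma avg_le n (f g : nat -> R) : (forall k, (k < 2 ^ n)%N -> f k <= g k) ->
  avg (X := R^o) n f <= avg (X := R^o) n g.
Proof.
move=> h; apply: ler_wpM2l; first exact: ltW (half_pow_gt0 n).
rewrite big_nat_cond [leRHS]big_nat_cond; apply: ler_sum => k /andP[/andP[_ kn] _]; exact: h.
Qed.

End Average.

Section SetDistance.
Variables (R : realType) (X : normedModType R).
Ltac vlin := vlin_with R X.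

(* With the value [1] for empty [D] the convexity and Lipschitz properties hold without exception. *)
Definition sdist (D : set X) (x : X) : R :=
  if `[< D !=set0 >] then inf [set `|x - y| | y in D] else 1.

Lemma sdist_le D x y : D y -> sdist D x <= `|x - y|.
Proof.
move=> Dy; rewrite /sdist asboolT; last by exists y.
by apply: ge_inf; [exists 0 => _ [z _ <-]|exists y].
Qed.

Lemma sdist_ge D x a : D !=set0 -> (forall y, D y -> a <= `|x - y|) -> a <= sdist D x.
Proof.
move=> Dn h; rewrite /sdist asboolT //; apply: lb_le_inf; first by case: Dn => y Dy; exists `|x - y|, y.
by move=> _ [y Dy <-]; exact: h.
Qed.

Lemma sdist_ge0 D x : 0 <= sdist D x.
Proof.
have [Dn|no] := pselect (D !=set0); first by apply: sdist_ge.
by rewrite /sdist asboolF.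
Qed.

Lemma sdist_near D x (e : R) : D !=set0 -> 0 < e -> exists2 y, D y & `|x - y| <= sdist D x + e.
Proof.
move=> Dn e0; apply: contrapT => no.
have : sdist D x + e <= sdist D x; last by lra.
apply: sdist_ge => // y Dy; apply/ltW; rewrite ltNge; apply/negP => h; by apply: no; exists y.
Qed.

Lemma sdist_gt0 D x : ~ closure D x -> 0 < sdist D x.
Proof.
move=> nx; rewrite lt_neqAle sdist_ge0 andbT; apply/eqP => e.
apply: nx; apply/closureP => c c0.
have Dn : D !=set0 by apply: contrapT => no; move: e; rewrite /sdist asboolF //; lra.
by have [y Dy h] := sdist_near x Dn c0; exists y => //; rewrite -e add0r in h.
Qed.

Lemma sdist_eq0 D x : D x -> sdist D x = 0.
Proof.
by move=> Dx; apply/eqP; rewrite eq_le sdist_ge0 andbT; have := sdist_le x Dx; rewrite subrr normr0.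
Qed.

Lemma sdist_compare D x x' (a : R) : 0 <= a ->
  (forall y, D y -> exists2 y', D y' & `|x - y'| <= `|x' - y| + a) -> sdist D x <= sdist D x' + a.
Proof.
move=> a0 h; have [Dn|no] := pselect (D !=set0); last by rewrite /sdist asboolF //; lra.
have : sdist D x - a <= sdist D x'; last by lra.
apply: sdist_ge => // y /h [y' Dy' h']; have := sdist_le x Dy'; lra.
Qed.

Lemma sdist_lip D x x' : sdist D x <= sdist D x' + `|x - x'|.
Proof.
apply: sdist_compare => // y Dy; exists y => //.
have -> : x - y = (x' - y) + (x - x') by vlin.
exact: ler_normD.
Qed.

Lemma sdist_mid D x y : (forall a b, D a -> D b -> D (mid a b)) ->
  sdist D (mid x y) <= 2^-1 * (sdist D x + sdist D y).
Proof.
move=> hD; have [Dn|no] := pselect (D !=set0); last by rewrite /sdist asboolF //; lra.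
apply/ler_addgt0Pr => e e0.
have [a Da ha] := sdist_near x Dn e0; have [b Db hb] := sdist_near y Dn e0.
apply: le_trans (sdist_le _ (hD a b Da Db)) _.
have -> : mid x y - mid a b = 2^-1 *: ((x - a) + (y - b)) by rewrite /mid; vlin.
rewrite normrZ ger0_norm; last by lra.
have := ler_normD (x - a) (y - b); lra.
Qed.
End SetDistance.

Section DominatedExtreme.
Variables (R : realType) (X : completeNormedModType R).
Variables (K : set X) (dom : X -> X -> Prop).
Ltac vlin := vlin_with R X.

(** The consequence of RNP on which the extreme point argument rests: a process in [K] that is
    dominated, up to [c 2^-i], by the average of its successors has arbitrarily small L^1
    increments. For equality it is a quasi-martingale, for the lattice order a quasi-submartingale.
    Levels may jump by any [m i > 0], since one step may need a deep tree. *)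
Definition dyadic_convergence := forall (N m : nat -> nat) (f : nat -> nat -> X) (c : R),
  (forall i, (0 < m i)%N) -> (forall i, N i.+1 = (N i + m i)%N) -> (forall i k, K (f i k)) ->
  (forall i k, (k < 2 ^ N i)%N -> exists y, [/\ K y, `|f i k - y| <= c * 2^-1 ^+ i &
     dom y (avg (m i) (fun j => f i.+1 (k * 2 ^ m i + j)%N))]) ->
  forall e : R, 0 < e -> exists i,
    avg (X := R^o) (N i.+1) (fun k => `|f i.+1 k - f i (k %/ 2 ^ m i)%N|) <= e.

Hypothesis K_closed : closed K.
Hypothesis K_bounded : norm_bounded K.
Hypothesis K_mid : forall x y, K x -> K y -> K (mid x y).
Hypothesis dom_refl : forall x, dom x x.
Hypothesis dom_trans : forall x y z, dom x y -> dom y z -> dom x z.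
Hypothesis dom_mid : forall x x' y y', dom x x' -> dom y y' -> dom (mid x y) (mid x' y').
(** For the lattice order [w'] is the infimum of [y] and [w]. This makes [sdist D] monotone along
    [dom]. *)
Hypothesis dom_near : forall y z w, K y -> K z -> K w -> dom y z ->
  exists w', [/\ K w', dom w' w & `|y - w'| <= `|z - w|].
Hypothesis dom_half : forall a x, dom a (mid a x) -> dom a x.
Hypothesis conv : dyadic_convergence.

Definition dom_ideal (D : set X) := [/\ D `<=` K, forall x y, D x -> D y -> D (mid x y) &
  forall x y, K x -> dom x y -> D y -> D x].

Lemma sdist_mono D y z : dom_ideal D -> K y -> K z -> dom y z -> sdist D y <= sdist D z.
Proof.
move=> [DK Dm Dd] Ky Kz yz; have := @sdist_compare _ _ D y z 0 (lexx 0); rewrite addr0; apply.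
move=> w Dw; have [w' [Kw' w'w h]] := dom_near Ky Kz (DK _ Dw) yz; exists w'; last by rewrite addr0.
exact: Dd Kw' w'w Dw.
Qed.

(** Jensen's inequality: [avg_closed] is applied to the epigraph of [sdist D] in [X * R^o]. *)
Lemma sdist_avg D : dom_ideal D -> forall n f, sdist D (avg n f) <= avg (X := R^o) n (fun k => sdist D (f k) : R^o).
Proof.
move=> [DK Dm Dd] n f.
pose S (p : X * R^o) := sdist D p.1 <= (p.2 : R).
have [f1 f2] : (avg n (fun k => (f k, sdist D (f k) : R^o))).1 = avg n f /\
   (avg n (fun k => (f k, sdist D (f k) : R^o))).2 = avg n (fun k => sdist D (f k) : R^o).
  by rewrite /avg /=; split; congr (_ *: _); rewrite raddf_sum.
have := @avg_closed R (X * R^o)%type S _ n (fun k => (f k, sdist D (f k) : R^o)) _.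
rewrite /S f1 f2 /=; apply=> // x y hx hy; apply: le_trans (sdist_mid _ _ Dm) _.
by rewrite /mid /=; apply: ler_wpM2l; [lra|exact: lerD].
Qed.

Lemma sdist_bounded D : exists2 B, 0 < B & forall x, K x -> sdist D x <= B.
Proof.
have [M hM] := K_bounded; exists (sdist D 0 + `|M| + 1).
  by have := sdist_ge0 D 0; have := normr_ge0 M; lra.
move=> x Kx; have := sdist_lip D x 0; rewrite subr0.
have := hM x Kx; have := ler_norm M; lra.
Qed.

Section Step.
Variables (D : set X) (c : R).
Hypothesis hD : dom_ideal D.
Hypothesis c0 : 0 <= c.

Definition low_or_far (x : X) (e : R) (z : X) := sdist D z <= c \/ e <= `|z - x|.

(** A point of [K] off this set is itself neither low nor far, so it lies at distance above [c] from
    [D] and within [e] of [x]. Once [x] is off the closure, this is the next ideal in the nested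
    construction. *)
Definition avoiding (x : X) (e : R) : set X := [set y | K y /\ exists m f,
  (forall j, K (f j) /\ low_or_far x e (f j)) /\ dom y (avg m f)].

Lemma avoiding_ideal x e : dom_ideal (avoiding x e).
Proof.
split=> [y []|y z [Ky [m [f [hf yf]]]] [Kz [n [g [hg zg]]]]|y z Ky yz [Kz [m [f [hf zf]]]]] //.
- split; first exact: K_mid.
  exists (m + n).+1, (fun k => if (k < 2 ^ (m + n))%N then f (k %/ 2 ^ n)%N else g ((k - 2 ^ (m + n)) %/ 2 ^ m)%N).
  split; first by move=> j; case: ifP.
  have -> := avg_mid (fun k => f (k %/ 2 ^ n)%N) (fun k => g (k %/ 2 ^ m)%N) (m + n).
  by rewrite avg_pad addnC avg_pad; exact: dom_mid.
- by split=> //; exists m, f; split=> //; exact: dom_trans yz zf.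
Qed.

Definition tree_step (e dl : R) (x : X) (m : nat) (f : nat -> X) :=
  [/\ forall j, K (f j), forall j, (j < 2 ^ m)%N -> low_or_far x e (f j) &
  exists y, [/\ K y, `|x - y| <= dl & dom y (avg m f)]].

Lemma tree_step_pad e dl x m p f : tree_step e dl x m f -> tree_step e dl x (m + p) (fun k => f (k %/ 2 ^ p)%N).
Proof.
move=> [h h' [y [h1 h2 h3]]]; split=> // [j jm|]; last by exists y; split=> //; rewrite avg_pad.
by apply: h'; rewrite ltn_divLR ?expn_gt0 // -expnD.
Qed.

Lemma tree_step_ex e dl x : 0 < dl -> K x -> (c < sdist D x -> closure (avoiding x e) x) ->
  exists p, tree_step e dl x p.1 p.2.
Proof.
move=> dl0 Kx hx; have [lt|ge] := ltP c (sdist D x).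
  have [y [Ky [m [f [hf yf]]]] xy] := closure_near (hx lt) dl0.
  by exists (m, f); split=> [j|j _|] /=; [case: (hf j)|case: (hf j)|exists y].
(* A node already within [c] of [D] is not split. *)
exists (0%N, fun=> x); split=> //= [j _|]; first by left.
by exists x; rewrite subrr normr0 avg0; split=> //; exact: ltW.
Qed.

Definition state := {s : nat * (nat -> X) | forall k, K (s.2 k)}.

Definition refines (e dl : R) (s s' : state) := exists m, [/\ (0 < m)%N, (sval s').1 = ((sval s).1 + m)%N &
  forall k, (k < 2 ^ (sval s).1)%N ->
    tree_step e dl ((sval s).2 k) m (fun j => (sval s').2 (k * 2 ^ m + j)%N)].

Lemma refines_ex e dl (s : state) : 0 < dl ->
  (forall x, K x -> c < sdist D x -> closure (avoiding x e) x) -> exists s', refines e dl s s'.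
Proof.
move=> dl0 hx; case: s => [[N f] /= Kf].
have ex k := tree_step_ex dl0 (Kf k) (hx (f k) (Kf k)).
have [p hp] := choice ex.
(* A depth common to all nodes, positive so that the levels increase; shallower trees are padded by
   repeating their leaves. *)
pose M := (\sum_(k < 2 ^ N) (p k).1).+1%N.
pose f' q := (p (q %/ 2 ^ M)%N).2 ((q %% 2 ^ M) %/ 2 ^ (M - (p (q %/ 2 ^ M)%N).1))%N.
have Kf' q : K (f' q) by rewrite /f'; case: (hp (q %/ 2 ^ M)%N).
exists (exist _ ((N + M)%N, f') Kf'), M; split=> //= k kN.
have pM : ((p k).1 <= M)%N by rewrite /M (bigD1 (Ordinal kN)) //= -addnS leq_addr.
have [h1 h2 [y [y1 y2 y3]]] := tree_step_pad (M - (p k).1) (hp k).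
rewrite subnKC // in h2 y3.
have e' j : (j < 2 ^ M)%N -> f' (k * 2 ^ M + j)%N = (p k).2 (j %/ 2 ^ (M - (p k).1))%N.
  by move=> jM; rewrite /f' divnMDl ?expn_gt0 // divn_small // addn0 modnMDl modn_small.
split=> [j|j jM|]; first exact: Kf'.
  by rewrite e' //; exact: h2.
by exists y; split=> //; rewrite (eq_avg e').
Qed.

(* Otherwise every node with [sdist D > c] splits; the average of [sdist D] stays
   above [c + g / 2] while the nodes above [c] move by at least [e] at each step. *)
Lemma avoiding_gap e x0 : 0 < e -> K x0 -> c < sdist D x0 ->
  exists x, [/\ K x, c < sdist D x & ~ closure (avoiding x e) x].
Proof.
move=> e0 Kx0 cx0; apply: contrapT => no.
have hx x : K x -> c < sdist D x -> closure (avoiding x e) x.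
  by move=> Kx cx; apply: contrapT => nx; apply: no; exists x.
pose g := sdist D x0 - c; have g0 : 0 < g by rewrite /g; lra.
have d0 i : 0 < g / 4 * 2^-1 ^+ i by apply: mulr_gt0; [lra|exact: half_pow_gt0].
pose s0 : state := exist (fun s : nat * (nat -> X) => forall k, K (s.2 k)) (0%N, fun=> x0) (fun=> Kx0).
pose nxt i (s : state) := sval (cid (refines_ex s (d0 i) hx)).
pose s := fix s i := if i is j.+1 then nxt j (s j) else s0.
have hs i : refines e (g / 4 * 2^-1 ^+ i) (s i) (s i.+1) by exact: (svalP (cid (refines_ex (s i) (d0 i) hx))).
pose N i := (sval (s i)).1; pose f i := (sval (s i)).2.
have [m hm] := choice hs.
have Kf i k : K (f i k) by exact: (svalP (s i)).
have NS i : N i.+1 = (N i + m i)%N by case: (hm i).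
have m0 i : (0 < m i)%N by case: (hm i).
have step i k : (k < 2 ^ N i)%N -> tree_step e (g / 4 * 2^-1 ^+ i) (f i k) (m i) (fun j => f i.+1 (k * 2 ^ m i + j)%N).
  by case: (hm i) => _ _; apply.
pose A i := avg (X := R^o) (N i) (fun k => sdist D (f i k)) : R.
have A0 : A 0%N = sdist D x0 by rewrite /A avg0.
have AS i : A i - g / 4 * 2^-1 ^+ i <= A i.+1.
  rewrite /A NS avg_split -[X in _ - X](avg_cst (X := R^o) (N i)) -[leLHS]avgB.
  apply: avg_le => k kN; have [_ _ [y [Ky xy yf]]] := step i k kN.
  apply: le_trans (sdist_avg hD _ _).
  have Ka : K (avg (m i) (fun j => f i.+1 (k * 2 ^ m i + j)%N)) by apply: avg_closed => //.
  apply: le_trans (sdist_mono hD Ky Ka yf).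
  by have := sdist_lip D (f i k) y; lra.
have Alow i : c + g / 2 <= A i.
  suff : sdist D x0 - g / 4 * \sum_(0 <= j < i) 2^-1 ^+ j <= A i.
    have := sum_half_pow_le (R := R) 0 i; rewrite expr0 /g; move: g0; rewrite /g; nra.
  elim: i => [|i IH]; first by rewrite big_geq // mulr0 subr0 A0.
  by rewrite big_nat_recr //= mulrDr; have := AS i; lra.
have [B B0 hB] := sdist_bounded D.
have moved i k : (k < 2 ^ N i.+1)%N ->
    sdist D (f i.+1 k) <= c + B / e * `|f i.+1 k - f i (k %/ 2 ^ m i)%N|.
  rewrite NS => kN; have kN' : (k %/ 2 ^ m i < 2 ^ N i)%N by rewrite ltn_divLR ?expn_gt0 // -expnD.
  have [_ h _] := step i _ kN'.
  have := h (k %% 2 ^ m i)%N; rewrite ltn_mod expn_gt0 -divn_eq => /(_ isT) [h1|h1].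
    by apply: le_trans h1 _; rewrite lerDl; apply: mulr_ge0 => //; apply: divr_ge0; lra.
  apply: le_trans (hB _ (Kf _ _)) _; rewrite -[leLHS]add0r; apply: lerD => //.
  by rewrite mulrAC ler_pdivlMr //; apply: ler_wpM2l => //; exact: ltW.
have be0 : 0 < B / e by exact: divr_gt0.
(* The tolerance [(g / 4) / (B / e)] brings the average of [sdist D] down to [c + g / 4], against
   the lower bound [c + g / 2] of [Alow]. *)
have [|i hi] := conv (N := N) (m := m) (f := f) (c := g / 4) m0 NS Kf _ (divr_gt0 (divr_gt0 g0 (ltr0n R 4)) be0).
  by move=> i k kN; have [_ _ h] := step i k kN.
have h1 : A i.+1 <= c + B / e * (g / 4 / (B / e)).
  apply: le_trans (avg_le (moved i)) _.
  have -> : avg (X := R^o) (N i.+1) (fun k => c + B / e * `|f i.+1 k - f i (k %/ 2 ^ m i)%N|) =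
     c + B / e * avg (X := R^o) (N i.+1) (fun k => `|f i.+1 k - f i (k %/ 2 ^ m i)%N|).
    rewrite -{2}(avg_cst (X := R^o) (N i.+1) c) /avg big_split /= scalerDr; congr (_ + _).
    by rewrite -mulr_sumr scalerAr.
  by rewrite lerD2l; apply: ler_wpM2l hi; exact: ltW.
have := Alow i.+1; rewrite mulrC divfK ?gt_eqF // in h1; lra.
Qed.

Lemma separation_step e x0 : 0 < e -> K x0 -> c < sdist D x0 ->
  exists D' x, [/\ dom_ideal D', K x, 0 < sdist D' x &
    forall y, K y -> 0 < sdist D' y -> c < sdist D y /\ `|y - x| < e].
Proof.
move=> e0 Kx0 cx0; have [x [Kx cx nx]] := avoiding_gap e0 Kx0 cx0.
exists (avoiding x e), x; split=> //; [exact: avoiding_ideal|exact: sdist_gt0|].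
move=> y Ky hy.
have nav : ~ low_or_far x e y.
  move=> hl; move: hy; rewrite sdist_eq0 ?ltxx //; split=> //.
  by exists 0%N, (fun=> y); split=> //; rewrite avg0; exact: dom_refl.
by split; rewrite ltNge; apply/negP => h; apply: nav; [left|right].
Qed.
End Step.

(* Nested slices [{sdist (D n) > c n}] of vanishing diameter shrink to the point. *)
Lemma dom_extreme_ex D x0 : dom_ideal D -> K x0 -> 0 < sdist D x0 ->
  exists a, [/\ K a, 0 < sdist D a &
    forall u v, K u -> K v -> dom a (mid u v) -> u = a /\ v = a].
Proof.
move=> hD Kx0 hx0.
pose st := {p : set X * X | [/\ dom_ideal p.1, K p.2 & 0 < sdist p.1 p.2]}.
pose lev (p : st) : R := sdist (sval p).1 (sval p).2 / 2.
have lev0 p : 0 < lev p by case: p => -[E x] [/= ? ? ?]; rewrite /lev /=; lra.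
have ex (n : nat) (p : st) : exists q : st, forall y, K y -> 0 < sdist (sval q).1 y ->
    lev p < sdist (sval p).1 y /\ `|y - (sval q).2| < 2^-1 ^+ n.
  case: p => -[E x] [/= h1 h2 h3]; rewrite /lev /=.
  have [||E' [x' [k1 k2 k3 k4]]] := @separation_step E (sdist E x / 2) h1 _ (2^-1 ^+ n) x (half_pow_gt0 n) h2.
  - by lra.
  - by lra.
  by exists (exist _ (E', x') (And3 k1 k2 k3)).
have ex2 n : exists nx : st -> st, forall p y, K y -> 0 < sdist (sval (nx p)).1 y ->
    lev p < sdist (sval p).1 y /\ `|y - (sval (nx p)).2| < 2^-1 ^+ n.
  by have [nx hnx] := choice (ex n); exists nx.
have [nx hnx] := choice ex2.
pose s := fix s n := if n is k.+1 then nx k (s k) else exist _ (D, x0) (And3 hD Kx0 hx0) : st.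
pose E n := (sval (s n)).1; pose x n := (sval (s n)).2.
have hE n : dom_ideal (E n) by rewrite /E; case: (svalP (s n)).
have Kx n : K (x n) by rewrite /x; case: (svalP (s n)).
have x0' n : 0 < sdist (E n) (x n) by rewrite /E /x; case: (svalP (s n)).
have hs n y : K y -> 0 < sdist (E n.+1) y -> lev (s n) < sdist (E n) y /\ `|y - x n.+1| < 2^-1 ^+ n.
  exact: hnx.
have dec n y : K y -> 0 < sdist (E n.+1) y -> 0 < sdist (E n) y.
  by move=> Ky /(hs n y Ky) [h _]; exact: lt_trans (lev0 _) h.
have dec' n k y : K y -> 0 < sdist (E (k + n)%N) y -> 0 < sdist (E n) y.
  by move=> Ky; elim: k => [//|k IH] h; apply: IH; exact: dec h.
have xin n k : 0 < sdist (E n) (x (k + n)%N) by exact: dec' (x0' _).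
have [|a ha _] := @cauchy_geom R X (fun n => x n.+1) 1.
  by move=> n; rewrite mul1r; apply/ltW; have [] := hs n (x n.+2) (Kx _) (xin n.+1 1%N).
have Ka : K a by apply: closed_seqlim K_closed _ ha => n; exact: Kx.
(* Positivity alone would not survive the limit; the later points lie above the fixed level
   [lev (s n)], half the distance of [x n], and this passes to [a]. *)
have a0 n : 0 < sdist (E n) a.
  apply: lt_le_trans (lev0 (s n)) _; apply/ler_addgt0Pr => e e0.
  have [M hM] := ha e e0; have := hM (M + n)%N (leq_addr _ _) => h1.
  have [h2 _] := hs n (x (M + n).+1) (Kx _) ltac:(by rewrite -addnS; exact: xin).
  have := sdist_lip (E n) (x (M + n).+1) a; lra.
exists a; split=> //; first exact: (a0 0%N).
have near u : K u -> (forall n, 0 < sdist (E n) u) -> u = a.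
  move=> Ku hu; apply/eqP; rewrite -subr_eq0; apply/eqP/norm_eq0_small => e e0.
  have [n hn] := half_pow_small 2 e0; have {}hn := hn n (leqnn n).
  have [_ h1] := hs n u Ku (hu _); have [_ h2] := hs n a Ka (a0 _).
  have -> : u - a = (u - x n.+1) - (a - x n.+1) by vlin.
  by apply: le_trans (ler_normB _ _) _; lra.
(* The distance at [a] is at most the mean of those at [u] and [v], so they cannot both vanish. *)
have one u v n : K u -> K v -> dom a (mid u v) -> ~ 0 < sdist (E n) u -> 0 < sdist (E n) v.
  move=> Ku Kv auv nu; have [_ Em _] := hE n.
  have := sdist_mono (hE n) Ka (K_mid Ku Kv) auv; have := sdist_mid u v Em; have := a0 n.
  have := sdist_ge0 (E n) u; move/negP: nu; rewrite -leNgt; lra.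
have half u v : K u -> K v -> dom a (mid u v) -> u = a -> v = a.
  move=> Ku Kv auv ua; apply: near => // n; rewrite ua in auv.
  exact: lt_le_trans (a0 n) (sdist_mono (hE n) Ka Kv (dom_half auv)).
have midC u v : mid u v = mid v u :> X by rewrite /mid addrC.
move=> u v Ku Kv auv.
have [hu|] := pselect (forall n, 0 < sdist (E n) u).
  by have ua := near u Ku hu; split=> //; exact: half ua.
move=> /existsNP [n nu].
(* If [u] is outside slice [n] it is outside all later ones, so [v] lies in all of these and, as
   they are nested, in every slice; hence [v = a], and then [u = a] by [half]. *)
suff va : v = a by split=> //; apply: (half v u) => //; rewrite midC.
apply: near => // k; have [kn|nk] := leqP k n.
  by have := one u v n Ku Kv auv nu; rewrite -(subnK kn); exact: dec'.
apply: (one u) => // h; apply: nu; apply: (dec' n (k - n)%N) => //; by rewrite subnK // ltnW.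
Qed.
End DominatedExtreme.

(** * Convergence of dyadic processes *)

Section DyadicProcess.
Context (d : measure_display) (T : measurableType d).
Variables (R : realType) (X : completeNormedModType R).
Variable mu : {finite_measure set T -> \bar R}.
Local Notation mes := (mes mu).
Variable dl : dyadic_system mu.
Hypothesis rnp : RNP X.
Ltac vlin := vlin_with R X.

Definition step_int (n : nat) (f : nat -> X) (E : set T) : X :=
  \sum_(k <- rng (dl n)) mes (E `&` cell (dl n) k) *: f k.

Lemma step_int_add n f : fadd (step_int n f).
Proof.
move=> A B mA mB AB; rewrite /step_int -big_split; apply: eq_bigr => k _ /=.
rewrite -scalerDl setIUl mes_add //; try by apply: measurableI => //; exact: measurable_cell.
by rewrite setIACA AB set0I.
Qed.

Lemma step_int_bnd n f B E : (forall k, `|f k| <= B) -> measurable E -> `|step_int n f E| <= B * mes E.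
Proof.
move=> hB mE; rewrite (fadd_label (dl n) (mes_add mu) mE) mulr_sumr.
apply: le_trans (ler_norm_sum _ _ _) _; apply: ler_sum => k _.
by rewrite normrZ ger0_norm ?mes_ge0 // mulrC; apply: ler_wpM2r; [exact: mes_ge0|exact: hB].
Qed.

Lemma mes_cellI n m k q : (q < 2 ^ (n + m))%N ->
  mes (cell (dl n) k `&` cell (dl (n + m)%N) q) = if (q %/ 2 ^ m)%N == k then 2^-1 ^+ (n + m) else 0.
Proof.
move=> qn; rewrite (cell_dyadic dl n m k); case: eqP => qk.
  rewrite -(dyadic_mes dl qn); congr mes; apply/seteqP; split=> [t []|t tq] //; split=> //.
  by rewrite /= (tq : dl _ t = q) qk.
rewrite [X in mes X](_ : _ = set0) ?mes0 //; apply/seteqP; split=> // t [/= + tq].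
by rewrite (tq : dl _ t = q) => /eqP.
Qed.

Lemma step_int_cell n m f k : (k < 2 ^ n)%N ->
  step_int (n + m) f (cell (dl n) k) = 2^-1 ^+ n *: avg m (fun j => f (k * 2 ^ m + j)%N).
Proof.
move=> kn; rewrite /step_int dyadic_rng /avg scalerA -exprD scaler_sumr expnD.
rewrite big_nat_cond (eq_bigr (fun q => if (q %/ 2 ^ m)%N == k then 2^-1 ^+ (n + m) *: f q else 0)); last first.
  by move=> q /andP[/andP[_ qn] _]; rewrite mes_cellI ?expnD //; case: ifP => // _; rewrite scale0r.
rewrite -big_nat_cond sum_blocks (bigD1_seq k) /=; first last.
- exact: iota_uniq.
- by rewrite mem_index_iota.
have blk i j : (j < 2 ^ m)%N -> ((i * 2 ^ m + j) %/ 2 ^ m)%N = i.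
  by move=> jm; rewrite divnMDl ?expn_gt0 // divn_small // addn0.
rewrite [X in _ + X]big1 ?addr0 => [|i /negbTE ik].
  rewrite big_nat_cond [RHS]big_nat_cond; apply: eq_bigr => j /andP[/andP[_ jm] _].
  by rewrite blk // eqxx.
by rewrite big_nat_cond big1 // => j /andP[/andP[_ jm] _]; rewrite blk // ik.
Qed.

Lemma step_int_cell0 n f k : (k < 2 ^ n)%N -> step_int n f (cell (dl n) k) = 2^-1 ^+ n *: f k.
Proof. by move=> kn; have := step_int_cell 0 f kn; rewrite addn0 avg0 expn0 muln1 addn0. Qed.

Lemma fadd_cell (V : zmodType) (D : set T -> V) n m k : fadd D ->
  D (cell (dl n) k) = \sum_(0 <= q < 2 ^ (n + m) | (q %/ 2 ^ m)%N == k) D (cell (dl (n + m)%N) q).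
Proof.
move=> hD; rewrite (cell_dyadic dl n m k).
by rewrite (fadd_pred (dl (n + m)%N) (fun q => (q %/ 2 ^ m)%N == k) hD) dyadic_rng.
Qed.

Lemma sum_parent (n m : nat) (g : nat -> R) :
  \sum_(0 <= k < 2 ^ (n + m)) 2^-1 ^+ m * g (k %/ 2 ^ m)%N = \sum_(0 <= k < 2 ^ n) g k.
Proof.
rewrite -mulr_sumr expnD sum_blocks mulr_sumr; apply: eq_bigr => K _.
rewrite big_nat_cond (eq_bigr (fun=> g K)); last first.
  by move=> j /andP[/andP[_ jm] _]; rewrite divnMDl ?expn_gt0 // divn_small // addn0.
rewrite -big_nat_cond sumr_const_nat subn0 -[g K *+ _]mulr_natl natrX mulrA -exprMn mulVf ?pnatr_eq0 //.
by rewrite expr1n mul1r.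
Qed.

Lemma sum_cells (n : nat) (c : R) : \sum_(0 <= k < 2 ^ n) c * 2^-1 ^+ n = c.
Proof.
rewrite sumr_const_nat subn0 -[_ *+ (2 ^ n)%N]mulr_natl natrX mulrCA -exprMn mulfV ?pnatr_eq0 //.
by rewrite expr1n mulr1.
Qed.

Section Process.
Variables (N m : nat -> nat) (f : nat -> nat -> X) (c B : R).
Hypothesis m0 : forall i, (0 < m i)%N.
Hypothesis NS : forall i, N i.+1 = (N i + m i)%N.
Hypothesis f_bnd : forall i k, `|f i k| <= B.
Hypothesis c0 : 0 <= c.

Local Notation s i := (step_int (N i) (f i)).

Lemma level_le i j : (i <= j)%N -> (N i <= N j)%N.
Proof.
move=> /subnK <-; elim: (j - i)%N => [|k IH] //=.
by rewrite addSn NS; apply: leq_trans IH _; exact: leq_addr.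
Qed.

Lemma level_ge i : (i <= N i)%N.
Proof. by elim: i => // i IH; rewrite NS -addn1; apply: leq_add. Qed.

(** The increment from [f i] to [f i.+1] is compared through averages of [F] at levels [N i.+1],
    [N i] and a fixed level [M]. The process is within [e / 4] of [F] at either level, and [F] at
    either level is within [e / 4] of its average at level [M]. *)
Lemma process_converges (F : set T -> X) :
  (forall e : R, 0 < e -> exists M, forall n, (M <= n)%N ->
    \sum_(0 <= k < 2 ^ n) `|F (cell (dl n) k) - 2^-1 ^+ (n - M) *: F (cell (dl M) (k %/ 2 ^ (n - M)))| <= e) ->
  (forall e : R, 0 < e -> exists I, forall i, (I <= i)%N ->
    \sum_(0 <= k < 2 ^ N i) `|F (cell (dl (N i)) k) - s i (cell (dl (N i)) k)| <= e) ->
  forall e : R, 0 < e -> exists i,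
    avg (X := R^o) (N i.+1) (fun k => `|f i.+1 k - f i (k %/ 2 ^ m i)%N|) <= e.
Proof.
move=> hF hs e e0; have [M hM] := hF (e / 4) ltac:(lra); have [I hI] := hs (e / 4) ltac:(lra).
pose i := maxn I M; exists i.
have hi := hI i (leq_maxl _ _); have hi1 := hI i.+1 (leqW (leq_maxl _ _)).
have Mi : (M <= N i)%N := leq_trans (leq_maxr I M) (level_ge i).
have Mi1 : (M <= N i.+1)%N := leq_trans Mi (level_le (leqnSn i)).
have hMi := hM _ Mi; have hMi1 := hM _ Mi1.
pose G n k := F (cell (dl n) k).
have half0 n : 0 <= 2^-1 ^+ n :> R by exact: ltW (half_pow_gt0 n).
pose A k := `|G (N i) k - s i (cell (dl (N i)) k)|.
pose C k := `|G (N i) k - 2^-1 ^+ (N i - M) *: G M (k %/ 2 ^ (N i - M))%N|.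
apply: le_trans (_ : \sum_(0 <= k < 2 ^ N i.+1) (`|G (N i.+1) k - s i.+1 (cell (dl (N i.+1)) k)| +
   (`|G (N i.+1) k - 2^-1 ^+ (N i.+1 - M) *: G M (k %/ 2 ^ (N i.+1 - M))%N| +
   (2^-1 ^+ m i * C (k %/ 2 ^ m i)%N + 2^-1 ^+ m i * A (k %/ 2 ^ m i)%N))) <= _); last first.
  rewrite !big_split /= NS !sum_parent -NS; rewrite -/A -/C in hi hMi *.
  have -> : e = e / 4 + (e / 4 + (e / 4 + e / 4)) by lra.
  by apply: lerD => //; apply: lerD => //; apply: lerD.
rewrite /avg /= [X in X <= _](_ : _ = \sum_(0 <= k < 2 ^ N i.+1) 2^-1 ^+ N i.+1 * `|f i.+1 k - f i (k %/ 2 ^ m i)%N|); last first.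
  by rewrite -mulr_sumr.
apply: ler_sum_nat => k /andP[_ kn].
have kp : (k %/ 2 ^ m i < 2 ^ N i)%N by rewrite ltn_divLR ?expn_gt0 // -expnD -NS.
have e1 : (2^-1 ^+ N i.+1 * `|f i.+1 k - f i (k %/ 2 ^ m i)%N| =
   `|s i.+1 (cell (dl (N i.+1)) k) - 2^-1 ^+ m i *: s i (cell (dl (N i)) (k %/ 2 ^ m i)%N)|)%R.
  rewrite !step_int_cell0 // scalerA -exprD addnC -NS -scalerBr normrZ ger0_norm //.
have e2 : 2^-1 ^+ (N i.+1 - M) *: G M (k %/ 2 ^ (N i.+1 - M))%N =
   2^-1 ^+ m i *: (2^-1 ^+ (N i - M) *: G M ((k %/ 2 ^ m i) %/ 2 ^ (N i - M))%N).
  by rewrite scalerA -exprD -divnMA -expnD NS addnC addnBA // addnC.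
have nq (z : X) : 2^-1 ^+ m i * `|z| = `|2^-1 ^+ m i *: z| by rewrite normrZ ger0_norm.
rewrite e1 e2 /A /C !nq.
set a1 := G _ _; set a2 := s i.+1 _; set a3 := G (N i) _; set a4 := _ *: G M _; set a5 := s i _.
set q := 2^-1 ^+ m i.
have -> : a2 - q *: a5 = - (a1 - a2) + ((a1 - q *: a4) + (- (q *: (a3 - a4)) + q *: (a3 - a5))) by vlin.
apply: le_trans (ler_normD _ _) _; rewrite normrN lerD2l.
apply: le_trans (ler_normD _ _) _; rewrite lerD2l.
by apply: le_trans (ler_normD _ _) _; rewrite normrN.
Qed.

Section Equality.
Hypothesis quasi : forall i k, (k < 2 ^ N i)%N ->
  `|f i k - avg (m i) (fun j => f i.+1 (k * 2 ^ m i + j)%N)| <= c * 2^-1 ^+ i.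

Lemma quasi_martingale_step i n k : (k < 2 ^ n)%N -> (n <= N i)%N ->
  `|s i.+1 (cell (dl n) k) - s i (cell (dl n) k)| <= c * mes (cell (dl n) k) * 2^-1 ^+ i.
Proof.
move=> kn nN; have e : N i = (n + (N i - n))%N by rewrite subnKC.
rewrite mulrAC.
rewrite (fadd_cell n (N i - n) k (step_int_add (N i.+1) (f i.+1))) (fadd_cell n (N i - n) k (step_int_add (N i) (f i))).
rewrite (fadd_cell n (N i - n) k (mes_add mu)) -!e -sumrB mulr_sumr.
apply: le_trans (ler_norm_sum _ _ _) _; rewrite big_nat_cond [leRHS]big_nat_cond.
apply: ler_sum => q /andP[/andP[_ qN] _].
rewrite step_int_cell0 // dyadic_mes // NS step_int_cell // -scalerBr normrZ ger0_norm; last exact: ltW (half_pow_gt0 _).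
rewrite mulrC; apply: ler_wpM2r; first exact: ltW (half_pow_gt0 _).
by rewrite distrC; exact: quasi.
Qed.

Lemma quasi_martingale_lim i n k : (k < 2 ^ n)%N -> (n <= N i)%N ->
  exists2 l, seqlim (fun j => s j (cell (dl n) k)) l &
     `|s i (cell (dl n) k) - l| <= 2 * c * 2^-1 ^+ i * mes (cell (dl n) k).
Proof.
move=> kn nN.
have [|l hl bl] := @cauchy_geom R X (fun j => s (j + i)%N (cell (dl n) k)) (c * mes (cell (dl n) k) * 2^-1 ^+ i).
  move=> j; have := @quasi_martingale_step (j + i)%N n k kn (leq_trans nN (level_le (leq_addl j i))).
  by rewrite exprD mulrA mulrAC.
exists l; first by apply/(seqlim_shift _ _ i).
have := bl 0%N; rewrite add0n expr0 mulr1 => h; apply: (le_trans h); rewrite le_eqVlt; apply/orP; left; apply/eqP; ring.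
Qed.

Lemma quasi_martingale_converges (e : R) : 0 < e -> exists i,
  avg (X := R^o) (N i.+1) (fun k => `|f i.+1 k - f i (k %/ 2 ^ m i)%N|) <= e.
Proof.
have [||| F [F1 F2 F3 F4]] := @RNP_dyadic _ T R mu dl X (fun i => s i) B _ _ _ rnp.
- by move=> i; exact: step_int_add.
- by move=> i E mE; apply: step_int_bnd.
- by move=> n k kn; have [l hl _] := quasi_martingale_lim kn (level_ge n); exists l.
apply: (process_converges F4) => e1 e0.
have [I hI] := half_pow_small (2 * c) e0; exists I => i Ii.
apply: le_trans (hI i Ii); rewrite -[leRHS](sum_cells (N i)); apply: ler_sum_nat => k /andP[_ kN].
have [l hl bl] := quasi_martingale_lim kN (leqnn _).
by rewrite (seqlim_uniq (F2 _ (measurable_cell _ _)) hl) distrC -(dyadic_mes dl kN).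
Qed.
End Equality.
End Process.
End DyadicProcess.

(** * Submartingales in a Banach lattice *)

Section DyadicSubmartingale.
Context (d : measure_display) (T : measurableType d).
Variables (R : realType) (X : completeNormedModType R) (L : vector_lattice X).
Hypothesis hL : lattice_norm L.
Hypothesis kb : KB L.
Hypothesis rnp : RNP X.
Variable mu : {finite_measure set T -> \bar R}.
Local Notation mes := (mes mu).
Variable dl : dyadic_system mu.
Local Notation "x ⊑ y" := (vle L x y) (at level 70).
Local Notation vpos := (vpos L).
Local Notation vinf := (vinf L).
Ltac vlin := vlin_with R X.

Variables (N m : nat -> nat) (f : nat -> nat -> X) (c B : R).
Hypothesis m0 : forall i, (0 < m i)%N.
Hypothesis NS : forall i, N i.+1 = (N i + m i)%N.
Hypothesis f_bnd : forall i k, `|f i k| <= B.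
Hypothesis f_ge0 : forall i k, 0 ⊑ f i k.
Hypothesis c0 : 0 <= c.

Local Notation children i k := (avg (m i) (fun j => f i.+1 (k * 2 ^ m i + j)%N)).
Hypothesis quasi : forall i k, (k < 2 ^ N i)%N -> `|vpos (f i k - children i k)| <= c * 2^-1 ^+ i.

Local Notation s i := (step_int dl (N i) (f i)).

(** What the average of the successors fails to dominate; it is 0 past the last cell so that the
    bound holds for every index. *)
Definition defect (i k : nat) : X := if (k < 2 ^ N i)%N then vpos (f i k - children i k) else 0.
Local Notation r i := (step_int dl (N i) (defect i)).

Lemma step_int_ge0 n g E : (forall k, 0 ⊑ g k) -> 0 ⊑ step_int dl n g E.
Proof. by move=> g0; apply: vsum_ge0 => k _; apply: vscale_ge0 => //; exact: mes_ge0. Qed.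

Lemma defect_ge0 i k : 0 ⊑ defect i k.
Proof. by rewrite /defect; case: ifP => _; [exact: vpos_ge0|exact: vlexx]. Qed.

Lemma defect_bnd i E : measurable E -> `|r i E| <= c * mes E * 2^-1 ^+ i.
Proof.
move=> mE; rewrite mulrAC; apply: step_int_bnd => // k; rewrite /defect; case: ifP => [/quasi //|_].
by rewrite normr0; apply: mulr_ge0 => //; exact: ltW (half_pow_gt0 i).
Qed.

Lemma submartingale_step i n k : (k < 2 ^ n)%N -> (n <= N i)%N ->
  s i (cell (dl n) k) ⊑ s i.+1 (cell (dl n) k) + r i (cell (dl n) k).
Proof.
move=> kn nN; have e : N i = (n + (N i - n))%N by rewrite subnKC.
rewrite (fadd_cell dl n (N i - n) k (step_int_add dl (N i.+1) (f i.+1))).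
rewrite (fadd_cell dl n (N i - n) k (step_int_add dl (N i) (f i))).
rewrite (fadd_cell dl n (N i - n) k (step_int_add dl (N i) (defect i))) -!e -big_split /=.
apply: vle_sum_seq => q; rewrite mem_index_iota => /= qN _.
rewrite !step_int_cell0 // NS step_int_cell // -scalerDr.
apply: vle_scale; first exact: ltW (half_pow_gt0 _).
rewrite /defect qN; have h := vpos_ge (L := L) (f i q - children i q).
by apply: (vle_by h); vlin.
Qed.

(** Adding the accumulated defects, a geometrically convergent series, makes the sequence increasing
    and keeps it bounded, so KB applies. Only the positive part of [s i] minus the limit is
    controlled by the remaining defects. *)
Lemma submartingale_lim i n k : (k < 2 ^ n)%N -> (n <= N i)%N ->
  exists2 l, seqlim (fun j => s j (cell (dl n) k)) l &
     `|vpos (s i (cell (dl n) k) - l)| <= 2 * c * 2^-1 ^+ i * mes (cell (dl n) k).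
Proof.
move=> kn nN; set C := cell (dl n) k; have mC : measurable C by exact: measurable_cell.
pose S j := \sum_(0 <= l < j) r (l + i)%N C.
have [|a ha ba] := @cauchy_geom R X S (c * mes C * 2^-1 ^+ i).
  move=> j; rewrite /S big_nat_recr //= addrAC subrr add0r.
  by apply: le_trans (defect_bnd _ mC) _; rewrite exprD mulrA mulrAC.
have S0 j : 0 ⊑ S j by apply: vsum_ge0 => l _; apply: step_int_ge0; exact: defect_ge0.
pose t j := s (j + i)%N C + S j.
have tinc j : t j ⊑ t j.+1.
  rewrite /t /S big_nat_recr //=.
  have h := @submartingale_step (j + i)%N n k kn (leq_trans nN (level_le NS (leq_addl j i))).
  by apply: (vle_by h); rewrite -/C; vlin.
have [|b hb] := kb tinc.
  exists (B * mes C + (2 * (c * mes C * 2^-1 ^+ i) + `|a|)) => j.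
  apply: le_trans (ler_normD _ _) _; apply: lerD; first exact: step_int_bnd.
  have -> : S j = (S j - a) + a by vlin.
  apply: le_trans (ler_normD _ _) _; rewrite lerD2r; apply: le_trans (ba j) _.
  rewrite -[leRHS]mulr1; apply: ler_wpM2l; last by apply: exprn_ile1; lra.
  by rewrite !mulr_ge0 ?mes_ge0 // ltW // half_pow_gt0.
have hs : seqlim (fun j => s (j + i)%N C) (b - a).
  have := seqlimB hb ha; congr seqlim; apply/funext => j; rewrite /t; vlin.
exists (b - a); first by apply/(seqlim_shift _ _ i).
have sb : s i C ⊑ b.
  have := incr_lim_ge hL tinc hb 0%N; rewrite /t /S big_geq // addr0 add0n; exact.
have a0 : 0 ⊑ a by apply: (vge0_lim hL ha); exists 0%N.
apply: le_trans (_ : `|a| <= _).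
  apply: (norm_vle hL); first exact: vpos_ge0.
  by apply: vpos_least => //; apply: (vle_by sb); vlin.
have := ba 0%N; rewrite /S big_geq // sub0r normrN expr0 mulr1 => h; apply: (le_trans h).
by rewrite le_eqVlt; apply/orP; left; apply/eqP; ring.
Qed.

(** [submartingale_lim] controls [(s i - F)^+] cell by cell. For [(F - s i)^+] only the total over
    all cells is known to be small. Its infimum [z] with the level-[M] average [H] of [F] lies below
    a multiple of [u = F setT], so [norm_sum_interval] passes from the norm of the sum to the sum of
    norms; what exceeds [H] is at most [|G - H|], small because the averages of [F] are Cauchy. *)
Lemma submartingale_converges (e : R) : 0 < e -> exists i,
  avg (X := R^o) (N i.+1) (fun k => `|f i.+1 k - f i (k %/ 2 ^ m i)%N|) <= e.
Proof.
have [||| F [F1 F2 F3 F4]] := @RNP_dyadic _ T R mu dl X (fun i => s i) B _ _ _ rnp.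
- by move=> i; exact: step_int_add.
- by move=> i E mE; apply: step_int_bnd.
- by move=> n k kn; have [l hl _] := submartingale_lim kn (level_ge m0 NS n); exists l.
apply: (process_converges m0 NS F4) => e1 e0.
have F0 E : measurable E -> 0 ⊑ F E.
  by move=> mE; apply: (vge0_lim hL (F2 E mE)); exists 0%N => i _; exact: step_int_ge0.
have [M hM] := F4 (e1 / 8) ltac:(lra).
pose u := F setT; have u0 : 0 ⊑ u by exact: F0.
have Fu E : measurable E -> F E ⊑ u.
  move=> mE; rewrite /u (fadd_setD F1 measurableT mE) //.
  by apply: (vle_by (F0 _ (measurableD measurableT mE))); vlin.
have p0 n : 0 < 2 ^+ n :> R by exact: exprn_gt0.
(* The coefficients [2^-p] of all cells of level [N i] add up to [2^M], hence the division by
   [2^M]. *)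
have [K K0 hK] := norm_sum_interval hL kb u0 (divr_gt0 (divr_gt0 e0 (ltr0n R 8)) (p0 M)).
have K1 : 0 < K + 1 by lra.
have [I1 hI1] := F2 setT measurableT (e1 / 8 / (K + 1)) (divr_gt0 (divr_gt0 e0 (ltr0n R 8)) K1).
have [I2 hI2] := half_pow_small (2 * c) (divr_gt0 (divr_gt0 e0 (ltr0n R 8)) K1).
exists (maxn M (maxn I1 I2)) => i; rewrite !geq_max => /and3P[Mi I1i I2i].
have MN : (M <= N i)%N := leq_trans Mi (level_ge m0 NS i).
have {}hM := hM _ MN; have {}hI1 := hI1 i I1i; have {}hI2 := hI2 i I2i.
set dlt := e1 / 8 / (K + 1) in hI1 hI2.
have dK : K * dlt + dlt = e1 / 8 by rewrite -{2}[dlt]mul1r -mulrDl mulrC /dlt divfK // gt_eqF.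
have dlt0 : 0 <= dlt by apply: divr_ge0; lra.
pose p := (N i - M)%N.
pose G k := F (cell (dl (N i)) k).
pose H k := 2^-1 ^+ p *: F (cell (dl M) (k %/ 2 ^ p)).
pose Z k := G k - s i (cell (dl (N i)) k).
have G0 k : 0 ⊑ G k by apply: F0; exact: measurable_cell.
have H0 k : 0 ⊑ H k.
  by apply: vscale_ge0; [exact: ltW (half_pow_gt0 p)|apply: F0; exact: measurable_cell].
have Zneg k : (k < 2 ^ N i)%N -> `|vpos (- Z k)| <= 2 * c * 2^-1 ^+ i * 2^-1 ^+ N i.
  move=> kN; have [l hl bl] := submartingale_lim kN (leqnn _).
  rewrite (dyadic_mes dl kN) in bl; rewrite /Z opprB /G.
  by rewrite (seqlim_uniq (F2 _ (measurable_cell _ _)) hl).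
have Zn : \sum_(0 <= k < 2 ^ N i) `|vpos (- Z k)| <= dlt.
  apply: le_trans hI2; rewrite -[leRHS](sum_cells (N i)).
  by apply: ler_sum_nat => k /andP[_ kN]; exact: Zneg.
pose z k := vinf (vpos (Z k)) (H k).
have zsplit k : vpos (Z k) = z k + vpos (vpos (Z k) - H k) by rewrite vinf_split.
have z0 k : 0 ⊑ z k by apply: vinf_ge0 => //; exact: vpos_ge0.
have ZG k : vpos (Z k) ⊑ G k.
  apply: vpos_least => //; have h := step_int_ge0 (N i) (cell (dl (N i)) k) (f_ge0 i).
  by apply: (vle_by h); rewrite /Z; vlin.
have rest k : `|vpos (vpos (Z k) - H k)| <= `|G k - H k|.
  apply: le_trans (norm_vpos hL (G k - H k)); apply: (norm_vle hL); first exact: vpos_ge0.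
  by apply: vpos_mono; apply: (vle_by (ZG k)); vlin.
have sumz : \sum_(0 <= k < 2 ^ N i) `|z k| <= e1 / 8 + K * (dlt + dlt).
  have h := hK _ (index_iota 0 (2 ^ N i)) xpredT (fun=> 2^-1 ^+ p) z _ _.
  apply: le_trans (h _ _) _.
  - by move=> k _; exact: ltW (half_pow_gt0 p).
  - move=> k _; split=> //; apply: vle_trans (vinf_lbr _ _) _.
    by apply: vle_scale; [exact: ltW (half_pow_gt0 p)|apply: Fu; exact: measurable_cell].
  apply: lerD.
    have -> : \sum_(0 <= k < 2 ^ N i) 2^-1 ^+ p = 2 ^+ M :> R.
      have e2 : (2 ^ N i = 2 ^ M * 2 ^ p)%N by rewrite -expnD /p subnKC.
      rewrite sumr_const_nat subn0 -[_ *+ (2 ^ N i)%N]mulr_natl e2 natrM !natrX -mulrA -exprMn mulfV ?pnatr_eq0 //.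
      by rewrite expr1n mulr1.
    by rewrite divfK // gt_eqF.
  apply: ler_wpM2l => //.
  have sumZ : \sum_(0 <= k < 2 ^ N i) Z k = u - s i setT.
    rewrite /Z sumrB /u (fadd_total (dl (N i)) F1).
    by rewrite (fadd_total (dl (N i)) (step_int_add dl (N i) (f i))) dyadic_rng.
  have bnd : \sum_(0 <= k < 2 ^ N i) z k ⊑ (u - s i setT) + \sum_(0 <= k < 2 ^ N i) vpos (- Z k).
    rewrite -sumZ -big_split /=; apply: vle_sum => k _.
    apply: vle_trans (vinf_lbl _ _) _; rewrite vposN.
    by apply: (vle_by (vlexx (L := L) 0)); vlin.
  apply: le_trans (norm_vle hL _ bnd) _; first exact: vsum_ge0.
  apply: le_trans (ler_normD _ _) _; apply: lerD; first by rewrite distrC.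
  exact: le_trans (ler_norm_sum _ _ _) Zn.
apply: le_trans (_ : \sum_(0 <= k < 2 ^ N i) (`|z k| + `|G k - H k| + `|vpos (- Z k)|) <= _).
  apply: ler_sum => k _.
  have -> : F (cell (dl (N i)) k) - s i (cell (dl (N i)) k) = vpos (Z k) - vpos (- Z k).
    by rewrite vposN -/(G k) -/(Z k); vlin.
  apply: le_trans (ler_normB _ _) _; rewrite lerD2r zsplit.
  by apply: le_trans (ler_normD _ _) _; rewrite lerD2l.
rewrite !big_split /=.
have hGH : \sum_(0 <= k < 2 ^ N i) `|G k - H k| <= e1 / 8 by exact: hM.
have : K * (dlt + dlt) <= e1 / 8 + e1 / 8 by rewrite mulrDr; lra.
have : dlt <= e1 / 8 by have := mulr_ge0 K0 dlt0; lra.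
lra.
Qed.
End DyadicSubmartingale.

(** * The equivalences *)

Section Implications.
Variables (R : realType) (X : completeNormedModType R).
Ltac vlin := vlin_with R X.

(** For [t <= 1/2] the point [(1 - t) x0 + t x1] is the midpoint of [x0] and [(1 - 2t) x0 + 2t x1];
    larger [t] follow by exchanging the endpoints. *)
Lemma dom_extreme_segment (K : set X) (dom : X -> X -> Prop) a : convex_set K ->
  (forall u v, K u -> K v -> dom a (mid u v) -> u = a /\ v = a) ->
  forall x0 x1, K x0 -> K x1 -> forall t : R, 0 < t < 1 ->
    dom a ((1 - t) *: x0 + t *: x1) -> x0 = a /\ x1 = a.
Proof.
move=> cK ex.
have key x0 x1 : K x0 -> K x1 -> forall t : R, 0 < t <= 2^-1 ->
    dom a ((1 - t) *: x0 + t *: x1) -> x0 = a /\ x1 = a.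
  move=> K0 K1 t /andP[t0 t1] h.
  have Kv : K ((1 - 2 * t) *: x0 + (2 * t) *: x1) by apply: cK => //; apply/andP; split; lra.
  have e : (1 - t) *: x0 + t *: x1 = mid x0 ((1 - 2 * t) *: x0 + (2 * t) *: x1).
    by rewrite /mid; vlin.
  rewrite e in h; have [e0 e1] := ex _ _ K0 Kv h; split=> //.
  have tn : 2 * t != 0 by rewrite gt_eqF //; lra.
  apply: (scalerI tn); rewrite e0 in e1.
  have -> : (2 * t) *: x1 = ((1 - 2 * t) *: a + (2 * t) *: x1) - (1 - 2 * t) *: a by vlin.
  by rewrite e1; vlin.
move=> x0 x1 K0 K1 t /andP[t0 t1] h; have [th|th] := leP t 2^-1.
  by apply: (key _ _ K0 K1 t) => //; apply/andP; split.
have [|| e1 e0] := key x1 x0 K1 K0 (1 - t); last by [].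
- by apply/andP; split; lra.
- by have -> : (1 - (1 - t)) *: x1 + (1 - t) *: x0 = (1 - t) *: x0 + t *: x1 by vlin.
Qed.

Lemma conv_hull_convex (S : set X) : convex_set (conv_hull S).
Proof. by move=> x y hx hy t t01 C cC SC; exact: cC (hx C cC SC) (hy C cC SC) t t01. Qed.

Lemma closed_hull_sub (A H : set X) : closed A -> H `<=` A -> closure H `<=` A.
Proof. by move=> cA HA x /(closureS HA) h; apply: cA. Qed.

Lemma RNP_KMP : RNP X -> KMP X.
Proof.
move=> rnp A cA [B hB] vA; apply/seteqP; split; last first.
  by apply: closed_hull_sub => // x; apply=> // y [].
move=> x Ax; apply: contrapT => nx.
set D := closure (conv_hull (extreme_points A)) in nx.
have cD : convex_set D by apply: convex_closure; exact: conv_hull_convex.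
have DA : D `<=` A by apply: closed_hull_sub => // y; apply=> // z [].
have conv : dyadic_convergence A (fun x y => x = y).
  move=> N m f c m0 NS Kf quasi e e0.
  apply: (@quasi_martingale_converges _ _ R X _ (unit_dyadic R) rnp N m f c B m0 NS) => //.
  - by move=> i k; apply: hB; exact: Kf.
  - by move=> i k kN; have [y [_ h e1]] := quasi i k kN; rewrite -e1.
have [a [Aa a0 ex]] : exists a, [/\ A a, 0 < sdist D a &
    forall u v, A u -> A v -> a = mid u v -> u = a /\ v = a].
  apply: (@dom_extreme_ex R X A (fun x y => x = y) cA _ _ _ _ _ _ _ conv D x) => //.
  - by exists B.
  - by move=> y z Ay Az; exact: midpoint_convex.
  - by move=> y z w -> ->.
  - by move=> y y' z z' -> ->.
  - by move=> y z w Ay Az Aw ->; exists w.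
  - move=> b y e; have -> : y = 2 *: mid b y - b by rewrite /mid; vlin.
    by rewrite -e; vlin.
  - by split=> // [y z Dy Dz|y z _ ->] //; exact: (midpoint_convex cD).
  - apply: sdist_gt0 => h; apply: nx; exact: (@closed_closure _ _ x h).
have : D a.
  apply: (@subset_closure _ (conv_hull (extreme_points A)) a) => C cC; apply; split=> // y0 y1 A0 A1 t t01 e.
  exact: (dom_extreme_segment vA ex A0 A1 t01 e).
by move=> /sdist_eq0 e; rewrite e ltxx in a0.
Qed.

Variable L : vector_lattice X.
Hypothesis hL : lattice_norm L.
Local Notation "x ⊑ y" := (vle L x y) (at level 70).
Local Notation vpos := (vpos L).
Local Notation vinf := (vinf L).
Local Notation vabs := (vabs L).

Lemma KMP_solid_extreme : KMP X -> solid_extreme_property L.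
Proof.
move=> kmp A cA bA sA vA [x Ax]; apply: contrapT => no.
have e := kmp A cA bA vA; rewrite e in Ax.
have [y hy _] := closure_near Ax (e := 1) ltac:(lra).
have h : extreme_points A `<=` set0 by move=> z Az; apply: no; exists z.
by apply: (hy set0).
Qed.

Lemma order_extreme_extreme A : order_extreme_points L A `<=` extreme_points A.
Proof.
move=> a [Aa h]; split=> // x0 x1 A0 A1 t t01 e; apply: h A0 A1 _ t01 _.
by rewrite -e; exact: vlexx.
Qed.

Lemma SKMP_solid_extreme : SKMP L -> solid_extreme_property L.
Proof.
move=> skmp A cA bA sA vA [x Ax]; apply: contrapT => no.
have e := skmp A cA bA sA vA; rewrite e in Ax.
have [y hy _] := closure_near Ax (e := 1) ltac:(lra).
have h : order_extreme_points L A `<=` set0.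
  by move=> z Az; apply: no; exists z; exact: order_extreme_extreme.
by apply: (hy set0).
Qed.

Lemma solid_conv_hull_convex S : convex_set (solid_conv_hull L S).
Proof. by move=> x y hx hy t t01 C cC sC SC; exact: cC (hx C cC sC SC) (hy C cC sC SC) t t01. Qed.

Lemma solid_conv_hull_solid S : solid L (solid_conv_hull L S).
Proof. by move=> x z hz xz C cC sC SC; exact: sC (hz C cC sC SC) xz. Qed.

Lemma vpos_sub_norm y z w : y ⊑ z -> `|vpos (y - w)| <= `|z - w|.
Proof.
move=> yz; apply: le_trans (norm_vpos hL (z - w)); apply: (norm_vle hL); first exact: vpos_ge0.
by apply: vpos_mono; apply: (vle_by yz); vlin.
Qed.

(** The domination argument runs on the positive part of [A], where the order is compatible with
    truncation by infima; an arbitrary [x] is replaced by [|x|], and solidity returns to [x]. *)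
Lemma RNP_SKMP : RNP X -> SKMP L.
Proof.
move=> rnp A cA [B hB] sA vA; apply/seteqP; split; last first.
  by apply: closed_hull_sub => // x; apply=> // y [].
move=> x Ax; apply: contrapT => nx.
have kb : KB L by apply: solid_extreme_KB => //; apply: KMP_solid_extreme; exact: RNP_KMP.
set D := closure (solid_conv_hull L (order_extreme_points L A)) in nx.
have cD : convex_set D by apply: convex_closure; exact: solid_conv_hull_convex.
have sD : solid L D by apply: solid_closure => //; exact: solid_conv_hull_solid.
have DA : D `<=` A by apply: closed_hull_sub => // y; apply=> // z [].
pose K := A `&` [set y | 0 ⊑ y].
have sK y z : K z -> 0 ⊑ y -> y ⊑ z -> K y.
  move=> [Az z0] y0 yz; split=> //; apply: sA Az _; by rewrite !vabs_id.
have mid_ge0 y z : 0 ⊑ y -> 0 ⊑ z -> 0 ⊑ mid y z.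
  by move=> y0 z0; apply: vscale_ge0; [lra|exact: vaddr_ge0].
have cK : closed K.
  apply: closedI => // y hy; apply: (vge0_approx hL) => e e0.
  by have [z z0 h] := closure_near hy e0; exists z.
have Kmid y z : K y -> K z -> K (mid y z).
  by move=> [Ay y0] [Az z0]; split; [exact: midpoint_convex|exact: mid_ge0].
have conv : dyadic_convergence K (fun y z => y ⊑ z).
  move=> N m f c m0 NS Kf quasi e e0.
  apply: (@submartingale_converges _ _ R X L hL kb rnp _ (unit_dyadic R) N m f c B m0 NS) => //.
  - by move=> i k; apply: hB; case: (Kf i k).
  - by move=> i k; case: (Kf i k).
  - have [y [_ h _]] := quasi 0%N 0%N (expn_gt0 2 _).
    by rewrite expr0 mulr1 in h; exact: le_trans (normr_ge0 _) h.
  move=> i k kN; have [y [_ h e1]] := quasi i k kN; apply: le_trans h.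
  apply: le_trans (norm_vpos hL _); apply: (norm_vle hL); first exact: vpos_ge0.
  by apply: vpos_mono; apply: (vle_by e1); vlin.
have vabs_norm y : `|vabs y| = `|y| by exact: norm_vabs.
have [a [[Aa pa] a0 ex]] : exists a, [/\ K a, 0 < sdist (D `&` K) a &
    forall u v, K u -> K v -> a ⊑ mid u v -> u = a /\ v = a].
  apply: (@dom_extreme_ex R X K (fun y z => y ⊑ z) cK _ Kmid _ _ _ _ _ conv (D `&` K) (vabs x)) => //.
  - by exists B => y [/hB].
  - exact: vlexx.
  - exact: vle_trans.
  - by move=> y y' z z' h h'; apply: vle_scale; [lra|exact: vleD].
  - move=> y z w Ky Kz Kw yz; exists (vinf y w).
    have iy := vinf_lbl (L := L) y w; have iw := vinf_lbr (L := L) y w.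
    split=> //; first by apply: (sK _ _ Kw _ iw); apply: vinf_ge0; [case: Ky|case: Kw].
    by rewrite /vinf subKr; exact: vpos_sub_norm.
  - move=> b y h; have h2 := vle_scale (a := 2) ltac:(lra) h.
    by apply: (vle_by h2); rewrite /mid; vlin.
  - split=> [y []|y z [Dy Ky] [Dz Kz]|y z Ky yz [Dz Kz]] //.
      by split; [exact: (midpoint_convex cD)|exact: Kmid].
    by split=> //; apply: (sD _ _ Dz); case: Ky => _ y0; case: Kz => _ z0; rewrite !vabs_id.
  - by split; [apply: sA Ax _; rewrite vabs_vabs; exact: vlexx|exact: vabs_ge0].
  (* [|x|] in [D] would put [x] in [D], because [D] is solid. *)
  - apply: sdist_gt0 => h; apply: nx.
    have : D (vabs x) by apply: closed_closure; apply: closureS h => y [].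
    by move=> h2; apply: sD h2 _; rewrite vabs_vabs; exact: vlexx.
have vK : convex_set K.
  move=> y z [Ay y0] [Az z0] t t01; split; first exact: vA.
  by case/andP: t01 => t0 t1; apply: vaddr_ge0; apply: vscale_ge0 => //; lra.
suff oa : order_extreme_points L A a.
  have Da : (D `&` K) a by split=> //; apply: (@subset_closure _ (solid_conv_hull L (order_extreme_points L A)) a) => C cC sC; apply.
  by move: a0; rewrite (sdist_eq0 Da) ltxx.
split=> // x0 x1 A0 A1 t t01 h.
have abs_in y : A y -> K (vabs y).
  by move=> Ay; split; [apply: sA Ay _; rewrite vabs_vabs; exact: vlexx|exact: vabs_ge0].
have /andP[t0 t1] := t01; have s0 : 0 < 1 - t by lra.
have hx y : y ⊑ vabs y by exact: vabs_ge.
have [e0 e1] := dom_extreme_segment vK ex (abs_in _ A0) (abs_in _ A1) t01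
  (vle_trans h (vleD (vle_scale (ltW s0) (hx x0)) (vle_scale (ltW t0) (hx x1)))).
(* So far only [|x0| = |x1| = a] is known. Then [a - x0] and [a - x1] are positive, while their
   combination with weights [1 - t] and [t] is at most 0, so both vanish. *)
have l0 : 0 ⊑ a - x0 by apply: vsub_ge0; rewrite -e0.
have l1 : 0 ⊑ a - x1 by apply: vsub_ge0; rewrite -e1.
have z0 : (1 - t) *: (a - x0) ⊑ 0.
  by apply: (vle_by (vleD h (vscale_ge0 (ltW t0) l1))); vlin.
have z1 : t *: (a - x1) ⊑ 0.
  by apply: (vle_by (vleD h (vscale_ge0 (ltW s0) l0))); vlin.
have zero (b : R) y : 0 < b -> 0 ⊑ y -> b *: y ⊑ 0 -> y = 0.
  move=> b0 y0 by0; have := vle_anti by0 (vscale_ge0 (ltW b0) y0).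
  by move/eqP; rewrite scaler_eq0 gt_eqF //= => /eqP.
by split; apply/esym/eqP; rewrite -subr_eq0; apply/eqP; [exact: zero z0|exact: zero z1].
Qed.
End Implications.

Theorem mainTheorem20 (R : realType) (X : completeNormedModType R)
  (L : vector_lattice X) (hL : lattice_norm L) :
  (SKMP L <-> KMP X) /\ (KMP X <-> RNP X).
Proof.
have sr : SKMP L -> RNP X by move=> h; apply: (solid_extreme_RNP hL); exact: SKMP_solid_extreme.
have kr : KMP X -> RNP X by move=> h; apply: (solid_extreme_RNP hL); exact: KMP_solid_extreme.
split; split=> h.
- by apply: RNP_KMP; exact: sr.
- by apply: RNP_SKMP => //; exact: kr.
- exact: kr.
- exact: RNP_KMP.
Qed.
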